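(* Let $p_{XY}$ have full support on $\mathcal X\times\mathcal Y$ and let $p_{Z|XY}$ be in normal form, and consider any secure protocol $\Pi(p_{XY},p_{Z|XY})$. (1) Suppose there is no partition $\mathcal X=\mathcal X_1\cup\mathcal X_2$ into two disjoint nonempty sets such that the sets $\mathcal Z_k=\{z: \exists x\in\mathcal X_k, y\in\mathcal Y,\ p(z|x,y)>0\}$, $k=1,2$, are disjoint. Then \[H(M_{31})\ge \sup_{p_{X'}}\Big(\Big(\sup_{p_{Y'}} RI(Y';Z')\Big)+\Big(\sup_{p_{Y''}} H(X',Z''|Y'')\Big)\Big),\] with the terms evaluated under $p_{X'}(x')p_{Y'}(y')p_{Z|XY}(z'|x',y')p_{Y''}(y'')p_{Z|XY}(z''|x',y'')$. (2) Suppose there is no partition $\mathcal Y=\mathcal Y_1\cup\mathcal Y_2$ into two disjoint nonempty sets such that the sets $\mathcal Z_k=\{z: \exists x\in\mathcal X, y\in\mathcal Y_k,\ p(z|x,y)>0\}$, $k=1,2$, are disjoint. Then \[H(M_{23})\ge \sup_{p_{Y'}}\Big(\Big(\sup_{p_{X'}} RI(X';Z')\Big)+\Big(\sup_{p_{X''}} H(Y',Z''|X'')\Big)\Big),\] with the terms evaluated under $p_{X'}(x')p_{Y'}(y')p_{Z|XY}(z'|x',y')p_{X''}(x'')p_{Z|XY}(z''|x'',y')$. All suprema range over distributions with full support; left-hand sides are computed under the original $p_{XY}$ and the protocol.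
   Context: Setting: $\mathcal X,\mathcal Y,\mathcal Z$ are finite sets. Alice (party 1) holds input $X\in\mathcal X$, Bob (party 2) holds $Y\in\mathcal Y$, with $(X,Y)\sim p_{XY}$; Charlie (party 3) has no input and outputs $Z\in\mathcal Z$. A randomized function is a conditional distribution $p_{Z|XY}$. In a protocol the three parties, each using private randomness (no shared randomness), exchange messages over multiple rounds on three pairwise private links; each message on a link is a codeword of a prefix-free code determined by the previous messages on that link, and the protocol terminates with probability 1. The protocol may depend on $p_{XY}$. $M_{12},M_{23},M_{31}$ denote the final transcripts on the Alice–Bob, Bob–Charlie and Charlie–Alice links. A secure protocol $\Pi(p_{XY},p_{Z|XY})$ satisfies: (correctness) on inputs $x,y$ Charlie's output is distributed as $p_{Z|X=x,Y=y}$; (privacy) under the joint distribution induced by $(X,Y)\sim p_{XY}$ and the protocol, the Markov chains $(M_{12},M_{31})-X-(Y,Z)$, $(M_{12},M_{23})-Y-(X,Z)$, $(M_{23},M_{31})-Z-(X,Y)$ hold. Logarithms base 2. Normal form: $p_{Z|XY}$ is in normal form if (i) $p(z|x,y)=p(z|x',y)$ for all $y,z$ implies $x=x'$; (ii) $p(z|x,y)=p(z|x,y')$ for all $x,z$ implies $y=y'$; (iii) existence of a constant $c$ with $p(z|x,y)=c\,p(z'|x,y)$ for all $x,y$ implies $z=z'$. Residual information: $RI(U;V)=I(U;V)-H(U\sqcap V)$, where $U\sqcap V$ is a random variable of maximum entropy among those of the form $f(U)=g(V)$ for deterministic $f,g$. *)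

(* Defs.v *)
(* Secure computation of a randomized function p_{Z|XY} by three parties
   (Alice = party 1 with input X, Bob = party 2 with input Y, Charlie = party 3,
   no input, output Z), over three pairwise private links. *)
From HB Require Import structures.
From mathcomp Require Import all_boot all_order all_algebra.
From mathcomp Require Import all_classical all_reals all_analysis.

Set Implicit Arguments.
Unset Strict Implicit.
Unset Printing Implicit Defensive.

Import Order.TTheory GRing.Theory Num.Theory.
Local Open Scope classical_set_scope.
Local Open Scope ring_scope.

Section Info.
Variable R : realType.

Definition log2 (x : R) : R := ln x / ln 2.

Definition ent (p : R) : R := if p == 0 then 0 else - (p * log2 p).

Definition entE (e : \bar R) : \bar R := (ent (fine e))%:E.

Definition fullDist (T : finType) (p : T -> R) : Prop :=
  (forall t, 0 < p t) /\ \sum_(t : T) p t = 1.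

Definition Hf (T : finType) (U : eqType) (p : T -> R) (g : T -> U) : R :=
  \sum_(u <- undup (map g (enum T))) ent (\sum_(t : T | g t == u) p t).

Definition Ifin (T : finType) (U V : eqType) (p : T -> R)
    (ga : T -> U) (gb : T -> V) : R :=
  Hf p ga + Hf p gb - Hf p (fun t => (ga t, gb t)).

(* H(U /\ V) (Gacs-Korner common part): the maximum entropy of a random
   variable of the form f(U) = g(V) (almost surely), f, g deterministic. *)
Definition commonH (T : finType) (U V : eqType) (p : T -> R)
    (ga : T -> U) (gb : T -> V) : \bar R :=
  ereal_sup [set e | exists (f : U -> nat) (g : V -> nat),
     (forall t, 0 < p t -> f (ga t) = g (gb t)) /\
     e = (Hf p (fun t => f (ga t)))%:E].

Definition RI (T : finType) (U V : eqType) (p : T -> R)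
    (ga : T -> U) (gb : T -> V) : \bar R :=
  (Ifin p ga gb)%:E - commonH p ga gb.

(* countable-valued setting: a (sub)distribution J on an arbitrary type,
   marginal of a function g, and entropy (possibly +oo) of g *)
Definition marg (T U : choiceType) (J : T -> \bar R) (g : T -> U) (u : U) : \bar R :=
  \esum_(t in [set t | g t = u]) J t.

Definition Hc (T : choiceType) (U : choiceType) (J : T -> \bar R) (g : T -> U) : \bar R :=
  \esum_(u in [set: U]) entE (marg J g u).

Definition markov (T A B C : choiceType) (J : T -> \bar R)
    (ga : T -> A) (gb : T -> B) (gc : T -> C) : Prop :=
  forall a b c,
    (marg J (fun t => (ga t, gb t, gc t)) (a, b, c) * marg J gb b =
     marg J (fun t => (ga t, gb t)) (a, b) * marg J (fun t => (gb t, gc t)) (b, c))%E.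

End Info.

Inductive party := Alice | Bob | Charlie.
Inductive link := L12 | L23 | L31.
Inductive dir := d12 | d21 | d23 | d32 | d31 | d13.

Definition party_eqb (a b : party) : bool :=
  match a, b with
  | Alice, Alice | Bob, Bob | Charlie, Charlie => true | _, _ => false end.
Definition link_eqb (a b : link) : bool :=
  match a, b with
  | L12, L12 | L23, L23 | L31, L31 => true | _, _ => false end.

Definition sender (d : dir) : party :=
  match d with d12 | d13 => Alice | d21 | d23 => Bob | d31 | d32 => Charlie end.
Definition lnk (d : dir) : link :=
  match d with d12 | d21 => L12 | d23 | d32 => L23 | d31 | d13 => L31 end.
Definition involved (i : party) (l : link) : bool :=
  match i, l with
  | Alice, (L12 | L31) | Bob, (L12 | L23) | Charlie, (L23 | L31) => true
  | _, _ => false end.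

Definition msg := seq bool.

Definition prefix_free (c : msg -> bool) : Prop :=
  forall u v, c u -> c v -> prefix u v -> u = v.

(* A protocol: round t = 0,1,2,... uses the directed link [sched t]; the
   message on that link is a codeword of the prefix-free code
   [code l lh] determined by the previous messages [lh] on the link l.
   Each party chooses its message by a randomized rule (a kernel) depending
   on the round, its own input and its view (all messages so far on its own
   links); this is equivalent to using private randomness.  Charlie's output
   is a randomized function of his final transcripts (M23, M31). *)
Record protocol (R : realType) (X Y Z : finType) := Protocol {
  sched : nat -> dir;
  code : link -> seq msg -> msg -> bool;
  kA : nat -> X -> seq msg -> msg -> R;
  kB : nat -> Y -> seq msg -> msg -> R;
  kC : nat -> seq msg -> msg -> R;
  out : seq msg -> seq msg -> Z -> R
}.

Section ProtocolSemantics.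
Variables (R : realType) (X Y Z : finType) (P : protocol R X Y Z).

(* a global history h is the list of messages of rounds 0 .. size h - 1 *)
Definition rounds (h : seq msg) : seq (nat * msg) := zip (iota 0 (size h)) h.

Definition linkhist (l : link) (h : seq msg) : seq msg :=
  [seq tm.2 | tm <- rounds h & link_eqb (lnk (sched P tm.1)) l].

Definition view (i : party) (h : seq msg) : seq msg :=
  [seq tm.2 | tm <- rounds h & involved i (lnk (sched P tm.1))].

Definition stepP (x : X) (y : Y) (h : seq msg) (m : msg) : R :=
  let t := size h in
  match sender (sched P t) with
  | Alice => kA P t x (view Alice h) m
  | Bob => kB P t y (view Bob h) m
  | Charlie => kC P t (view Charlie h) m
  end.

Definition histP (x : X) (y : Y) (h : seq msg) : R :=
  \prod_(t < size h) stepP x y (take t h) (nth [::] h t).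

(* link l has fallen silent: from now on only the empty word is a
   codeword (an empty codeword of a prefix-free code is its only codeword) *)
Definition link_done (l : link) (lh : seq msg) : Prop :=
  forall k, code P l (lh ++ nseq k [::]) [::].

Definition terminal (h : seq msg) : Prop := forall l, link_done l (linkhist l h).

Definition min_terminal (h : seq msg) : Prop :=
  terminal h /\ forall t, (t < size h)%N -> ~ terminal (take t h).

(* final transcript on link l: the messages on the link, without the
   (forced) empty messages after the link has fallen silent *)
Definition trimT (lh : seq msg) : seq msg :=
  take (size lh - find (fun m => m != [::]) (rev lh)) lh.

Definition Mtrans (l : link) (h : seq msg) : seq msg := trimT (linkhist l h).

Definition valid_protocol : Prop :=
  (forall l lh, prefix_free (code P l lh)) /\
  (forall x y h, 0 < histP x y h ->
     (forall m, 0 <= stepP x y h m) /\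
     (forall m, 0 < stepP x y h m ->
        code P (lnk (sched P (size h))) (linkhist (lnk (sched P (size h))) h) m) /\
     (\esum_(m in [set: msg]) (stepP x y h m)%:E = 1%E)) /\
  (forall a b z, 0 <= out P a b z) /\
  (forall a b, \sum_(z : Z) out P a b z = 1) /\
  (forall x y, \esum_(h in [set h | min_terminal h]) (histP x y h)%:E = 1%E).

Definition outcome := (X * Y * (seq msg * seq msg * seq msg) * Z)%type.

Definition jointP (pXY : X -> Y -> R) (w : outcome) : \bar R :=
  let: (x, y, (m12, m23, m31), z) := w in
  ((pXY x y)%:E *
   (\esum_(h in [set h | min_terminal h /\ Mtrans L12 h = m12 /\
                         Mtrans L23 h = m23 /\ Mtrans L31 h = m31])
        (histP x y h)%:E) * (out P m23 m31 z)%:E)%E.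

Definition oX (w : outcome) : X := w.1.1.1.
Definition oY (w : outcome) : Y := w.1.1.2.
Definition oZ (w : outcome) : Z := w.2.
Definition oM12 (w : outcome) : seq msg := w.1.2.1.1.
Definition oM23 (w : outcome) : seq msg := w.1.2.1.2.
Definition oM31 (w : outcome) : seq msg := w.1.2.2.

Definition secure (pXY : X -> Y -> R) (W : X -> Y -> Z -> R) : Prop :=
  valid_protocol /\
  (forall x y z,
     \esum_(h in [set h | min_terminal h])
        (histP x y h * out P (Mtrans L23 h) (Mtrans L31 h) z)%:E
     = (W x y z)%:E) /\
  markov (jointP pXY) (fun w => (oM12 w, oM31 w)) oX (fun w => (oY w, oZ w)) /\
  markov (jointP pXY) (fun w => (oM12 w, oM23 w)) oY (fun w => (oX w, oZ w)) /\
  markov (jointP pXY) (fun w => (oM23 w, oM31 w)) oZ (fun w => (oX w, oY w)).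

End ProtocolSemantics.

Section Bounds.
Variables (R : realType) (X Y Z : finType).

Definition cond_dist (W : X -> Y -> Z -> R) : Prop :=
  (forall x y z, 0 <= W x y z) /\ (forall x y, \sum_(z : Z) W x y z = 1).

Definition normal_form (W : X -> Y -> Z -> R) : Prop :=
  (forall x x', (forall y z, W x y z = W x' y z) -> x = x') /\
  (forall y y', (forall x z, W x y z = W x y' z) -> y = y') /\
  (forall z z', (exists c : R, forall x y, W x y z = c * W x y z') -> z = z').

Definition ZofX (W : X -> Y -> Z -> R) (A : {set X}) : {set Z} :=
  [set z | [exists x in A, [exists y, 0 < W x y z]]].
Definition ZofY (W : X -> Y -> Z -> R) (B : {set Y}) : {set Z} :=
  [set z | [exists x, [exists y in B, 0 < W x y z]]].

Definition no_partition_X (W : X -> Y -> Z -> R) : Prop :=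
  ~ exists X1 : {set X}, X1 != finset.set0 /\ ~: X1 != finset.set0 /\
      ZofX W X1 :&: ZofX W (~: X1) == finset.set0.
Definition no_partition_Y (W : X -> Y -> Z -> R) : Prop :=
  ~ exists Y1 : {set Y}, Y1 != finset.set0 /\ ~: Y1 != finset.set0 /\
      ZofY W Y1 :&: ZofY W (~: Y1) == finset.set0.

Definition jointF (W : X -> Y -> Z -> R) (pX : X -> R) (pY : Y -> R)
    (t : X * Y * Z) : R :=
  pX t.1.1 * pY t.1.2 * W t.1.1 t.1.2 t.2.

Definition tX (t : X * Y * Z) : X := t.1.1.
Definition tY (t : X * Y * Z) : Y := t.1.2.
Definition tZ (t : X * Y * Z) : Z := t.2.

Definition rhs1 (W : X -> Y -> Z -> R) : \bar R :=
  ereal_sup [set e | exists pX : X -> R, fullDist pX /\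
    e = (ereal_sup [set r | exists pY : Y -> R, fullDist pY /\
                       r = RI (jointF W pX pY) tY tZ] +
         ereal_sup [set r | exists pY : Y -> R, fullDist pY /\
                       r = (Hf (jointF W pX pY) id - Hf (jointF W pX pY) tY)%:E])%E].

Definition rhs2 (W : X -> Y -> Z -> R) : \bar R :=
  ereal_sup [set e | exists pY : Y -> R, fullDist pY /\
    e = (ereal_sup [set r | exists pX : X -> R, fullDist pX /\
                       r = RI (jointF W pX pY) tX tZ] +
         ereal_sup [set r | exists pX : X -> R, fullDist pX /\
                       r = (Hf (jointF W pX pY) id - Hf (jointF W pX pY) tX)%:E])%E].

End Bounds.

(* Main.v *)
(** The idea is to split
    [- log p(m31) = log (p(m12,m31) / (p(m12) p(m31))) + log (p(m12) / p(m12,m31))]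
    under a product input distribution.  By privacy against Alice the law of
    (M12, M31) does not depend on the law of Bob's input, so the two terms may be
    averaged over runs with different inputs Y', Y'' that share X' and (M12, M31).
    Since [X'] is a function of (M12, M31), the second average is at least
    H(X', Z'' | Y'').  For the first one, let Alice be replaced by a strategy that
    talks to Bob and to Charlie independently, with the marginal laws of her two
    links: then M12 and M31 become independent given M23, and the cost of this
    replacement is at most I(M12; M31), because the marginal law of each link is
    itself a product of two strategies.  This leaves I(Y'; Z' | M23), and M23 is
    correlated with Y' (and with Z') only through a common function of Y' and Z',
    so I(Y'; Z' | M23) is at least RI(Y'; Z').  Every entropy inequality is an
    instance of [ln t <= t - 1]: the logarithms are added pointwise before any
    infinite sum is taken, and each ratio [t] has expectation at most 1.  Finally,
    if there is no partition, privacy against Alice and Charlie forces the law of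
    M31 to be the same for all inputs. *)

(* Full support of [pXY] turns each Markov chain into an identity valid for every input pair, so the
   same protocol can be studied under any other input law. Normal form enters twice:
   non-proportional outputs make Charlie's output a function [zeta] of (M23, M31), and distinct
   rows, combined with the factorization of a run into one weight per party, let the transcripts
   determine Alice's input. The obstacle is that these weights are not laws by themselves: runs have
   no bounded length, and a partial sum of weights may be infinite. Each weight is therefore a
   product over all rounds, a finished run being prolonged by empty words, and a change of strategy
   is only ever used through the fact that the new total mass is at most 1. Five ratios occur, four
   for the run with Y' and one for the run with Y''. Their masses cancel the constant 5 left by five
   uses of [ln t <= t - 1]. Everything is proved for one pivotal party; exchanging Alice and Bob
   keeps M12 and swaps M31 with M23. *)
Require Import Defs.
From HB Require Import structures.
From mathcomp Require Import all_boot all_order all_algebra.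
From mathcomp Require Import all_classical all_reals all_analysis.
From mathcomp Require Import ring lra.
Import Order.TTheory GRing.Theory Num.Theory.
Local Open Scope classical_set_scope.
Local Open Scope ring_scope.

Set Implicit Arguments.
Unset Strict Implicit.
Unset Printing Implicit Defensive.

(** * Countable sums *)

Notation "\Sum_ i F" := (esum [set: _] (fun i => F%E))
  (at level 36, i binder, F at level 36, format "\Sum_ i  F") : ereal_scope.

Section SumToolkit.
Variable R : realType.
Local Open Scope ereal_scope.

Lemma Sum_ge0 (T : choiceType) (f : T -> \bar R) :
  (forall i, 0 <= f i) -> 0 <= \Sum_i f i.
Proof. by move=> f0; apply: esum_ge0 => i _. Qed.

Lemma Sum_pair (T1 T2 : choiceType) (f : T1 -> T2 -> \bar R) :
  (forall i j, 0 <= f i j) ->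
  \Sum_(k : T1 * T2) f k.1 k.2 = \Sum_i \Sum_j f i j.
Proof.
move=> f0; rewrite (@esum_esum _ _ _ [set: T1] (fun=> [set: T2]))//.
by congr esum; apply/seteqP; split.
Qed.

Lemma Sum_swap (T1 T2 : choiceType) (f : T1 -> T2 -> \bar R) :
  (forall i j, 0 <= f i j) ->
  \Sum_i \Sum_j f i j = \Sum_j \Sum_i f i j.
Proof.
move=> f0; rewrite -!Sum_pair//.
rewrite (@reindex_esum _ _ _ [set: T2 * T1] _ (fun x => (x.2, x.1)))//.
by split => //= [[a b] [c d] _ _ [-> ->]//|[a b] _]; exists (b, a).
Qed.

Lemma le_Sum (T : choiceType) (f g : T -> \bar R) :
  (forall i, f i <= g i) -> \Sum_i f i <= \Sum_i g i.
Proof. by move=> fg; apply: le_esum => i _. Qed.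

Lemma eq_Sum (T : choiceType) (f g : T -> \bar R) :
  (forall i, f i = g i) -> \Sum_i f i = \Sum_i g i.
Proof. by move=> fg; apply: eq_esum => i _. Qed.

Lemma SumD (T : choiceType) (f g : T -> \bar R) :
  (forall i, 0 <= f i) -> (forall i, 0 <= g i) ->
  \Sum_i (f i + g i) = \Sum_i f i + \Sum_i g i.
Proof. by move=> f0 g0; rewrite esumD. Qed.

Lemma SumZl (T : choiceType) (k : R) (f : T -> \bar R) :
  (0 <= k)%R -> (forall i, 0 <= f i) ->
  \Sum_i (k%:E * f i) = k%:E * \Sum_i f i.
Proof.
move=> k0 f0; rewrite /esum -ereal_supZl//; last first.
  by apply/set0P; exists (\sum_(x \in set0) f x); exists set0 => //; exact: fsets_set0.
congr ereal_sup; apply/seteqP; split => [_ [A [fA AT] <-]|_ [_ [A [fA AT] <-] <-]].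
  exists (\sum_(x \in A) f x); first by exists A.
  by rewrite ge0_mule_fsumr.
by exists A => //; rewrite ge0_mule_fsumr.
Qed.

Lemma SumZr (T : choiceType) (k : R) (f : T -> \bar R) :
  (0 <= k)%R -> (forall i, 0 <= f i) ->
  \Sum_i (f i * k%:E) = (\Sum_i f i) * k%:E.
Proof.
by move=> k0 f0; rewrite muleC -SumZl//; apply: eq_Sum => i; rewrite muleC.
Qed.

Lemma Sum_fin (T : finType) (f : T -> \bar R) :
  (forall i, 0 <= f i) -> \Sum_i f i = \sum_(i : T) f i.
Proof.
move=> f0; have fT : finite_set [set: T] by exact: finite_finset.
rewrite esum_fset// fsbig_finite//=.
apply: perm_big; apply: uniq_perm; [exact: finmap.fset_uniq|exact: index_enum_uniq|].
by move=> i; rewrite mem_index_enum in_fset_set//; apply: mem_set.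
Qed.

Lemma Sum_ub (T : choiceType) (f : T -> \bar R) i :
  (forall i, 0 <= f i) -> f i <= \Sum_i f i.
Proof.
move=> f0; apply: esum_ge; exists [set i]; last by rewrite fsbig_set1.
by split.
Qed.

Lemma Sum0 (T : choiceType) (f : T -> \bar R) :
  (forall i, f i = 0) -> \Sum_i f i = 0.
Proof. by move=> f0; apply: esum1 => i _. Qed.

Lemma Sum_le_finite (T : choiceType) (f : T -> \bar R) (c : \bar R) :
  (forall s : seq T, uniq s -> \sum_(i <- s) f i <= c) -> \Sum_i f i <= c.
Proof.
move=> H; apply: ge_ereal_sup => _ [A [fA _] <-].
by rewrite fsbig_finite//; apply: H; exact: finmap.fset_uniq.
Qed.

Lemma Sum_one (T : choiceType) (f : T -> \bar R) i :
  0 <= f i -> (forall j, j != i -> f j = 0) -> \Sum_i f i = f i.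
Proof.
move=> f0 fj; rewrite -[RHS]esum_set1// [RHS]esum_mkcond.
apply: eq_Sum => j; case: ifPn => //; rewrite notin_setE => ji.
by apply: fj; apply/eqP => ji'; apply: ji.
Qed.

(** [fine] sends an infinite sum to 0, so this value is meaningful only together with a bound, as in
    [rsumE]. *)
Definition rsum (T : choiceType) (f : T -> R) : R := fine (\Sum_i (f i)%:E).

Lemma rsum_ge0 (T : choiceType) (f : T -> R) :
  (forall i, 0 <= f i)%R -> (0 <= rsum f)%R.
Proof. by move=> f0; apply: fine_ge0; apply: Sum_ge0 => i; rewrite lee_fin. Qed.

Lemma rsumE (T : choiceType) (f : T -> R) (c : R) :
  (forall i, 0 <= f i)%R -> \Sum_i (f i)%:E <= c%:E ->
  \Sum_i (f i)%:E = (rsum f)%:E.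
Proof.
move=> f0 fc; rewrite fineK// ge0_fin_numE.
  by apply: le_lt_trans fc _; rewrite ltry.
by apply: Sum_ge0 => i; rewrite lee_fin.
Qed.

End SumToolkit.

Ltac nn := repeat (first
 [ exact: ler01 | assumption | apply: Sum_ge0 => ? | apply: adde_ge0 | apply: mule_ge0
 | rewrite lee_fin | apply: addr_ge0 | apply: mulr_ge0 | rewrite invr_ge0 | rewrite ler0n
 | match goal with H : _ |- _ => solve [apply: H] end ]).

Section RealSums.
Variable R : realType.
Local Open Scope ereal_scope.

Lemma SumrZl (T : choiceType) (k : R) (f : T -> R) :
  (0 <= k)%R -> (forall i, 0 <= f i)%R ->
  \Sum_i (k * f i)%:E = k%:E * \Sum_i (f i)%:E.
Proof. by move=> k0 f0; rewrite -SumZl//; exact: f0. Qed.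

Lemma SumrZr (T : choiceType) (k : R) (f : T -> R) :
  (0 <= k)%R -> (forall i, 0 <= f i)%R ->
  \Sum_i (f i * k)%:E = (\Sum_i (f i)%:E) * k%:E.
Proof. by move=> k0 f0; rewrite -SumZr//; exact: f0. Qed.

Lemma Sum_delta (T : choiceType) (f : T -> R) (a : T) :
  (0 <= f a)%R -> \Sum_z (f z * (a == z)%:R)%:E = (f a)%:E.
Proof.
move=> f0; rewrite (@Sum_one _ _ _ a) ?eqxx ?mulr1 ?lee_fin// => j.
by rewrite eq_sym => /negbTE ->; rewrite mulr0.
Qed.

(** The pointwise inequality is multiplied by [P d] and summed, so constants pick up the total mass
    [p]; where [P d] vanishes only the nonnegative [r d] remains. [coupled_bound] uses this once for
    each of its two variables. *)
Lemma average_bound (D : choiceType) (P c r : D -> R) (p A B : R) :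
  (0 <= A)%R -> (0 <= B)%R ->
  (forall d, 0 <= P d)%R -> (forall d, 0 <= c d)%R -> (forall d, 0 <= r d)%R ->
  \Sum_d (P d)%:E = p%:E ->
  (forall d, 0 < P d -> c d + B <= r d / P d + A)%R ->
  \Sum_d (P d * c d)%:E + (p * B)%:E <= \Sum_d (r d)%:E + (p * A)%:E.
Proof.
move=> A0 B0 P0 c0 r0 Pp H.
rewrite !EFinM -!Pp -!SumZr// -?SumD; do ?[by move=> d; nn].
apply: le_Sum => d; rewrite -!EFinM -!EFinD lee_fin.
have := P0 d; rewrite le_eqVlt => /predU1P[<-|Pd].
  by rewrite !mul0r !addr0; exact: r0.
by have := ler_wpM2l (P0 d) (H d Pd); rewrite !mulrDr mulrCA divff ?gt_eqF// mulr1.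
Qed.

(* Given s, draw d with law P1 s / p s and, independently, d' with law P2 s / p s. *)
Lemma coupled_bound (S D : choiceType) (p L : S -> R) (M k : R)
    (P1 P2 c1 c2 r1 r2 : S -> D -> R) :
  (0 <= M)%R -> (0 <= k)%R ->
  (forall s, 0 <= p s)%R -> (forall s, 0 <= L s)%R ->
  (forall s d, 0 <= P1 s d)%R -> (forall s d, 0 <= P2 s d)%R ->
  (forall s d, 0 <= c1 s d)%R -> (forall s d, 0 <= c2 s d)%R ->
  (forall s d, 0 <= r1 s d)%R -> (forall s d, 0 <= r2 s d)%R ->
  (forall s, \Sum_d (P1 s d)%:E = (p s)%:E) ->
  (forall s, \Sum_d (P2 s d)%:E = (p s)%:E) ->
  (forall s d d', 0 < P1 s d -> 0 < P2 s d' ->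
    c1 s d + c2 s d' + k <= L s + M + r1 s d / P1 s d + r2 s d' / P2 s d')%R ->
  \Sum_s \Sum_d (P1 s d * c1 s d)%:E + \Sum_s \Sum_d (P2 s d * c2 s d)%:E
    + k%:E * \Sum_s (p s)%:E <=
  \Sum_s (p s * L s)%:E + \Sum_s \Sum_d (r1 s d)%:E + \Sum_s \Sum_d (r2 s d)%:E
    + M%:E * \Sum_s (p s)%:E.
Proof.
move=> M0 k0 p0 L0 P10 P20 c10 c20 r10 r20 P1p P2p H.
have nP1 s d : (0 <= P1 s d * c1 s d)%R by apply: mulr_ge0.
have nP2 s d : (0 <= P2 s d * c2 s d)%R by apply: mulr_ge0.
have nL s : (0 <= p s * L s)%R by apply: mulr_ge0.
rewrite -!SumZl// -!SumD; do ?[by move=> s; nn].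
apply: le_Sum => s; rewrite -!EFinM.
have S1 : 0 <= \Sum_d (r1 s d)%:E by nn.
have S2 : 0 <= \Sum_d (r2 s d)%:E by nn.
have [r2oo|r2f] := eqVneq (\Sum_d (r2 s d)%:E) +oo.
  by rewrite r2oo; case: (\Sum_d (r1 s d)%:E) S1 => //= *; rewrite leey.
have [[d0 P1d0]|nP] := pselect (exists d, 0 < P1 s d)%R; last first.
  have ps0 : p s = 0%R.
    apply/eqP; rewrite -eqe -P1p; apply/eqP; rewrite Sum0// => d.
    by apply/eqP; rewrite eqe eq_le P10 andbT leNgt; apply/negP => ?; apply: nP; exists d.
  have z (P : S -> D -> R) : (forall s d, 0 <= P s d)%R -> \Sum_d (P s d)%:E = (p s)%:E ->
      forall d, P s d = 0%R.
    move=> P0 Pp d; apply/eqP; rewrite eq_le P0 andbT -lee_fin.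
    by rewrite (le_trans (Sum_ub (f := fun d => (P s d)%:E) d _))// ?Pp ?ps0// => i; nn.
  rewrite ps0 !mulr0 mul0r !adde0 add0e [X in X + _]Sum0 ?add0e ?[X in X <= _]Sum0.
  - by nn.
  - by move=> d; rewrite (z P2)// mul0r.
  - by move=> d; rewrite (z P1)// mul0r.
have pgt0 : (0 < p s)%R.
  rewrite -lte_fin -P1p; apply: (@lt_le_trans _ _ (P1 s d0)%:E) => //.
  by apply: (Sum_ub (f := fun d => (P1 s d)%:E)) => i; nn.
have [R2 R2E] : exists R2 : R, \Sum_d (r2 s d)%:E = R2%:E.
  by case: (\Sum_d (r2 s d)%:E) S2 r2f => // x _ _; exists x.
have R20 : (0 <= R2)%R by rewrite -lee_fin -R2E.
(* With [d] fixed, the average over [d'] comes first; everything that depends on [d] counts as a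
   constant. *)
have step d : (0 < P1 s d)%R ->
    \Sum_d' (P2 s d' * c2 s d')%:E + (p s * (c1 s d + k))%:E <=
    R2%:E + (p s * (L s + M + r1 s d / P1 s d))%:E.
  move=> P1d; rewrite -R2E; apply: average_bound => //.
  - by apply: addr_ge0; [exact: addr_ge0|apply: divr_ge0].
  - exact: addr_ge0.
  - by move=> d' P2d'; have := H s d d' P1d P2d'; lra.
have [C2 C2E] : exists C2 : R, \Sum_d (P2 s d * c2 s d)%:E = C2%:E.
  have := step d0 P1d0; have : 0 <= \Sum_d (P2 s d * c2 s d)%:E by nn.
  by case: (\Sum_d (P2 s d * c2 s d)%:E) => // x _ _; exists x.
have C20 : (0 <= C2)%R by rewrite -lee_fin -C2E; nn.
(* The second average is over [d]. The sums [R2] and [C2] over [d'] are divided by [p s] because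
   [average_bound] multiplies its constants by that mass. *)
have := @average_bound D (P1 s) (c1 s) (r1 s) (p s) (L s + M + R2 / p s)%R
  (k + C2 / p s)%R.
have e1 : (p s * (k + C2 / p s) = C2 + k * p s)%R.
  by rewrite mulrDr mulrCA divff ?gt_eqF// mulr1 mulrC addrC.
have e2 : (p s * (L s + M + R2 / p s) = p s * L s + R2 + M * p s)%R.
  by rewrite !mulrDr [(_ * (R2 / _))%R]mulrCA divff ?gt_eqF// mulr1 -addrA [(_ * M + _)%R]addrC [(p s * M)%R]mulrC addrA.
rewrite e1 e2 C2E R2E => avg.
suff : \Sum_d (P1 s d * c1 s d)%:E + (C2 + k * p s)%:E <=
       \Sum_d (r1 s d)%:E + (p s * L s + R2 + M * p s)%:E.
  rewrite !EFinD !addeA => /le_trans; apply.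
  by rewrite [X in X + _ + _]addeC.
apply: avg => //.
- by apply: addr_ge0; [exact: addr_ge0|apply: divr_ge0].
- by apply: addr_ge0 => //; apply: divr_ge0.
- move=> d P1d; have := step d P1d; rewrite C2E -!EFinD lee_fin => st.
  rewrite -(ler_pM2l pgt0) !mulrDr mulrCA [(_ * (R2 / _))%R]mulrCA divff ?gt_eqF//.
  by move: st; rewrite !mulrDr; lra.
Qed.

End RealSums.

(** * The information-theoretic core *)

Lemma SumM (R : realType) (S T : choiceType) (f : S -> R) (g : T -> R) :
  (forall i, 0 <= f i) -> (forall j, 0 <= g j) ->
  (\Sum_i \Sum_j (f i * g j)%:E = (\Sum_i (f i)%:E) * (\Sum_j (g j)%:E))%E.
Proof.
move=> f0 g0.
transitivity (\Sum_i ((f i)%:E * \Sum_j (g j)%:E))%E.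
  by apply: eq_Sum => i; rewrite SumrZl.
have : (0 <= \Sum_j (g j)%:E)%E by nn.
case: (\Sum_j (g j)%:E)%E => [b| |] // b0.
  by rewrite SumZr//; exact: (fun i => f0 i).
have [/eqP F0|F0] := boolP ((\Sum_i (f i)%:E)%E == 0%E).
  rewrite F0 mul0e Sum0// => i; suff -> : f i = 0 by rewrite mul0e.
  apply/eqP; rewrite eq_le f0 andbT -lee_fin.
  apply: (@le_trans _ _ (\Sum_i (f i)%:E)%E); last by rewrite F0.
  by apply: (Sum_ub (f := fun i => (f i)%:E)) => j; nn.
have Fgt0 : (0 < \Sum_i (f i)%:E)%E by rewrite lt_def F0; nn.
rewrite gt0_muley//; apply/eqP; rewrite -leye_eq.
have [i fi] : exists i, 0 < f i.
  apply: contrapT => nf; move: F0; rewrite Sum0 ?eqxx// => i.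
  by apply/eqP; rewrite eqe eq_le f0 andbT leNgt; apply/negP => fi; apply: nf; exists i.
apply: le_trans (Sum_ub (f := fun i => ((f i)%:E * +oo)%E) i _).
  by rewrite gt0_muley.
by move=> j; apply: mule_ge0; rewrite ?lee_fin.
Qed.

Ltac pos := repeat first [ done | progress intros | rewrite lee_fin
  | apply: mulr_ge0 | rewrite invr_ge0 | apply: mule_ge0 | apply: Sum_ge0 ].

(** The five ratios cancel up to four products that are known only through an inequality: the two
    link laws ([m12], [m31]), the mass [pq] of a class of Bob's inputs, and the weight [k2] of the
    second run. *)
Lemma ratio_algebra (R : realFieldType)
    (a k b1 c2 a1 a2 pyz nu px r s sn py pn pz l m12 k2 m31 pq w2 : R) :
  0 < a -> 0 < k -> 0 < b1 -> 0 < c2 -> 0 < a1 -> 0 < a2 -> 0 < pyz -> 0 < nu ->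
  0 < px -> 0 < r -> 0 < s -> 0 < sn -> 0 < py -> 0 < pn -> 0 < pz -> 0 < l ->
  0 < m12 -> 0 < k2 -> 0 < m31 -> 0 < pq -> 0 < w2 ->
  m12 <= a1 * b1 -> m31 <= a2 * c2 -> pq * nu <= pn -> k2 <= l * w2 ->
  m31 * (pyz * pq / (py * pz)) * (px * w2)^-1 <=
  (a * b1 * c2 / k) * (a1 * a2 * (pyz * nu) / (px * a * r * s)) *
  (r * sn / (py * nu)) * (s * pn / (sn * (pz * nu))) * (l * k / (m12 * k2)).
Proof.
move=> a0 k0 b10 c20 a10 a20 pyz0 nu0 px0 r0 s0 sn0 py0 pn0 pz0 l0 m120 k20 m310.
move=> pq0 w20 h1 h2 h3 h4.
have -> : (a * b1 * c2 / k) * (a1 * a2 * (pyz * nu) / (px * a * r * s)) *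
  (r * sn / (py * nu)) * (s * pn / (sn * (pz * nu))) * (l * k / (m12 * k2)) =
  (a1 * b1) * (a2 * c2) * pn * (l * w2) * (pyz / (px * py * nu * pz * m12 * k2 * w2)).
  by field; rewrite ?gt_eqF.
have -> : m31 * (pyz * pq / (py * pz)) * (px * w2)^-1 =
  m12 * m31 * (pq * nu) * k2 * (pyz / (px * py * nu * pz * m12 * k2 * w2)).
  by field; rewrite ?gt_eqF.
apply: ler_wpM2r; first by apply: divr_ge0; rewrite ?ltW// !mulr_gt0.
have g1 : 0 <= m12 * m31 by rewrite mulr_ge0 ?ltW.
have g2 : 0 <= m12 * m31 * (pq * nu) by rewrite mulr_ge0 ?mulr_ge0 ?ltW.
by do !apply: ler_pM => //; rewrite ?mulr_ge0 ?ltW.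
Qed.

(** The constant 5 counts the ratios: each use of [ln t <= t - 1] gives back 1. *)
Lemma ln_prod5_le (R : realType) (m e1 e2 s0 s1 s2 s3 s5 : R) :
  0 < m -> 0 < e1 -> 0 < e2 -> 0 < s0 -> 0 < s1 -> 0 < s2 -> 0 < s3 -> 0 < s5 ->
  m * e1 * e2^-1 <= s0 * s1 * s2 * s3 * s5 ->
  ln e1 + - ln e2 + 5%:R <= - ln m + (s0 + s1 + s2 + s3) + s5.
Proof.
move=> m0 e10 e20 s00 s10 s20 s30 s50.
rewrite -ler_ln ?posrE ?mulr_gt0 ?invr_gt0//.
rewrite !lnM ?posrE ?mulr_gt0 ?invr_gt0// lnV ?posrE//.
have lnt (t : R) : 0 < t -> ln t <= t - 1.
  move=> tp; have := @le_ln1Dx _ (t - 1); rewrite addrCA subrr addr0; apply.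
  by lra.
have := lnt _ s00; have := lnt _ s10; have := lnt _ s20; have := lnt _ s30.
have := lnt _ s50; lra.
Qed.

(* [u], [v], [n] stand for the transcripts M12, M31, M23; [K x y] is their joint law on
   inputs x, y; [kap x] and [lam y] are the laws of (M12, M31) and (M12, M23), which by
   privacy depend on one input only; [zeta] is Charlie's output. *)
Section Core.
Variables (R : realType) (X Y Z : finType) (U V N : choiceType).
Variables (K : X -> Y -> U -> V -> N -> R) (W : X -> Y -> Z -> R).
Variables (zeta : V -> N -> Z).
Variables (kap : X -> U -> V -> R) (lam : Y -> U -> N -> R) (Th : Z -> N -> R).
Hypothesis K_ge0 : forall x y u v n, 0 <= K x y u v n.
Hypothesis W_ge0 : forall x y z, 0 <= W x y z.
Hypothesis W_sum : forall x y, \sum_(z : Z) W x y z = 1.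
Hypothesis kap_ge0 : forall x u v, 0 <= kap x u v.
Hypothesis lam_ge0 : forall y u n, 0 <= lam y u n.
Local Open Scope ereal_scope.
Hypothesis K_kap : forall x y u v z,
  \Sum_n (K x y u v n * (zeta v n == z)%:R)%:E = (kap x u v * W x y z)%:E.
Hypothesis K_lam : forall x y u n z,
  \Sum_v (K x y u v n * (zeta v n == z)%:R)%:E = (lam y u n * W x y z)%:E.
Hypothesis K_Th : forall x y n z,
  \Sum_u \Sum_v (K x y u v n * (zeta v n == z)%:R)%:E = (Th z n * W x y z)%:E.
Hypothesis K_sum : forall x y, \Sum_u \Sum_v \Sum_n (K x y u v n)%:E = 1.
Variables (x0 : X) (y0 : Y).

Let nnK : forall x y u v n z, (0 <= K x y u v n * (zeta v n == z)%:R)%R.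
Proof. by move=> *; apply: mulr_ge0. Qed.

Lemma W_Sum x y : \Sum_z (W x y z)%:E = 1.
Proof.
rewrite Sum_fin; last by move=> i; rewrite lee_fin.
by rewrite sumEFin W_sum.
Qed.

Lemma K_zeta x y u v n :
  (K x y u v n)%:E = \Sum_z (K x y u v n * (zeta v n == z)%:R)%:E.
Proof. by rewrite (@Sum_delta _ _ (fun=> K x y u v n)). Qed.

Lemma Sum_K_n x y u v : \Sum_n (K x y u v n)%:E = (kap x u v)%:E.
Proof.
under eq_Sum do rewrite K_zeta.
rewrite Sum_swap; last by move=> *; nn.
under eq_Sum do rewrite K_kap.
by rewrite SumrZl// W_Sum mule1.
Qed.

Lemma Sum_K_v x y u n : \Sum_v (K x y u v n)%:E = (lam y u n)%:E.
Proof.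
under eq_Sum do rewrite K_zeta.
rewrite Sum_swap; last by move=> *; nn.
under eq_Sum do rewrite K_lam.
by rewrite SumrZl// W_Sum mule1.
Qed.

Lemma kap_sum x : \Sum_u \Sum_v (kap x u v)%:E = 1.
Proof.
rewrite -(K_sum x y0); apply: eq_Sum => u; apply: eq_Sum => v.
by rewrite Sum_K_n.
Qed.

Lemma lam_sum y : \Sum_n \Sum_u (lam y u n)%:E = 1.
Proof.
rewrite Sum_swap; last by move=> *; nn.
rewrite -(K_sum x0 y); apply: eq_Sum => u.
rewrite [RHS]Sum_swap; last by move=> *; nn.
by apply: eq_Sum => n; rewrite (Sum_K_v x0).
Qed.

(** The law of M23 given Y = y; privacy against Bob makes it independent of x. *)
Definition nu y n : R := rsum (fun u => lam y u n).

Lemma nu_ge0 y n : (0 <= nu y n)%R.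
Proof. exact: rsum_ge0. Qed.

Lemma lam_nu y n : \Sum_u (lam y u n)%:E = (nu y n)%:E.
Proof.
apply: (@rsumE _ _ _ 1) => //; rewrite -(lam_sum y).
by apply: (Sum_ub (f := fun n => \Sum_u (lam y u n)%:E)) => i; nn.
Qed.

Lemma nu_sum y : \Sum_n (nu y n)%:E = 1.
Proof. by rewrite -(lam_sum y); apply: eq_Sum => n; rewrite lam_nu. Qed.

Lemma Sum_K_uv x y n z :
  \Sum_u \Sum_v (K x y u v n * (zeta v n == z)%:R)%:E = (nu y n * W x y z)%:E.
Proof.
under eq_Sum do rewrite K_lam.
by rewrite SumrZr// lam_nu.
Qed.

(** When z is possible on (x, y), the law of M23 given (x, y, z) is [nu y] by privacy against Bob
    and [Th z] by privacy against Charlie. Hence [nu y] depends only on a common function of Y and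
    Z. *)
Lemma nu_eq x y x' y' z n : (0 < W x y z)%R -> (0 < W x' y' z)%R -> nu y n = nu y' n.
Proof.
have H x1 y1 : (0 < W x1 y1 z)%R -> nu y1 n = Th z n.
  move=> W1; have := Sum_K_uv x1 y1 n z; rewrite K_Th => -[] /esym.
  by apply/mulIf; rewrite gt_eqF.
by move=> /H -> /H ->.
Qed.

Lemma Sum_K_uvn x y z :
  \Sum_u \Sum_v \Sum_n (K x y u v n * (zeta v n == z)%:R)%:E = (W x y z)%:E.
Proof.
under eq_Sum do under eq_Sum do rewrite K_kap.
under eq_Sum do rewrite SumrZr//.
rewrite SumZr//; last by move=> ?; nn.
by rewrite kap_sum mul1e.
Qed.

(** One term of [K_lam] is kept. This is the pointwise form of H(X, M31 | Y, M12, M23) >= H(X, Z |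
    Y): Z is a function of (M31, M23), and (X, Z) is independent of (M12, M23) given Y. *)
Lemma K_le_lam x y u v n : (K x y u v n <= lam y u n * W x y (zeta v n))%R.
Proof.
rewrite -lee_fin -K_lam.
have -> : (K x y u v n)%:E = (K x y u v n * (zeta v n == zeta v n)%:R)%:E.
  by rewrite eqxx mulr1.
by apply: (Sum_ub (f := fun v0 => (K x y u v0 n * (zeta v0 n == zeta v n)%:R)%:E)) => i; nn.
Qed.

Lemma K_le_kap x y u v n : (K x y u v n <= kap x u v * W x y (zeta v n))%R.
Proof.
rewrite -lee_fin -K_kap.
have -> : (K x y u v n)%:E = (K x y u v n * (zeta v n == zeta v n)%:R)%:E.
  by rewrite eqxx mulr1.
by apply: (Sum_ub (f := fun n0 => (K x y u v n0 * (zeta v n0 == zeta v n)%:R)%:E)) => i; nn.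
Qed.

Lemma Sum_swap31 (T1 T2 T3 T4 : choiceType) (f : T1 -> T2 -> T3 -> T4 -> \bar R) :
  (forall a b c d, 0 <= f a b c d) ->
  \Sum_a \Sum_b \Sum_c \Sum_d f a b c d = \Sum_d \Sum_a \Sum_b \Sum_c f a b c d.
Proof.
move=> f0.
under eq_Sum => a do under eq_Sum => b do (rewrite Sum_swap; last by move=> *; nn).
under eq_Sum => a do (rewrite Sum_swap; last by move=> *; nn).
by rewrite Sum_swap//; move=> *; nn.
Qed.

Lemma Sum_swap32 (T1 T2 T3 T4 T5 : choiceType)
    (f : T1 -> T2 -> T3 -> T4 -> T5 -> \bar R) :
  (forall a b c d e, 0 <= f a b c d e) ->
  \Sum_a \Sum_b \Sum_c \Sum_d \Sum_e f a b c d e =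
  \Sum_d \Sum_e \Sum_a \Sum_b \Sum_c f a b c d e.
Proof.
move=> f0; rewrite Sum_swap31; last by move=> *; nn.
by apply: eq_Sum => d; rewrite Sum_swap31//; move=> *; nn.
Qed.

Section Rho.
Variables (pX : X -> R) (pY : Y -> R).
Hypothesis pX_gt0 : forall x, (0 < pX x)%R.
Hypothesis pY_gt0 : forall y, (0 < pY y)%R.
Hypothesis pX_sum : \Sum_x (pX x)%:E = 1.
Hypothesis pY_sum : \Sum_y (pY y)%:E = 1.

Let pX_ge0 x : (0 <= pX x)%R. Proof. exact: ltW. Qed.
Let pY_ge0 y : (0 <= pY y)%R. Proof. exact: ltW. Qed.
Hint Resolve pX_ge0 pY_ge0 K_ge0 W_ge0 kap_ge0 lam_ge0 nu_ge0 : core.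

Local Notation P x u v y n := (pX x * pY y * K x y u v n)%R.

Lemma P_ge0 x u v y n : (0 <= P x u v y n)%R.
Proof. by rewrite !mulr_ge0. Qed.

Hint Resolve P_ge0 : core.

Definition pYZ y z : R := (pY y * \sum_(x : X) pX x * W x y z)%R.
Definition pZ z : R := (\sum_(y : Y) pYZ y z)%R.
Definition pN n : R := (\sum_(y : Y) pY y * nu y n)%R.
(** The joint law of Z and M23, which are independent given Y by privacy against Bob. *)
Definition pZN z n : R := (\sum_(y : Y) pYZ y z * nu y n)%R.

Lemma pYZ_ge0 y z : (0 <= pYZ y z)%R.
Proof. by apply: mulr_ge0 => //; apply: sumr_ge0 => x _; exact: mulr_ge0. Qed.

Lemma pZN_ge0 z n : (0 <= pZN z n)%R.
Proof. by apply: sumr_ge0 => y _; apply: mulr_ge0 => //; exact: pYZ_ge0. Qed.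

Lemma pN_ge0 n : (0 <= pN n)%R.
Proof. by apply: sumr_ge0 => y _; apply: mulr_ge0. Qed.
Hint Resolve pYZ_ge0 pZN_ge0 pN_ge0 : core.

Lemma pYZ_Sum y z : \Sum_x (pX x * pY y * W x y z)%:E = (pYZ y z)%:E.
Proof.
rewrite Sum_fin; last by move=> x; rewrite lee_fin !mulr_ge0.
rewrite sumEFin /pYZ big_distrr/=; congr EFin; apply: eq_bigr => x _.
by rewrite mulrA [(pX x * _)%R]mulrC.
Qed.

Lemma Sum_fin_real (T : finType) (f : T -> R) :
  (forall i, 0 <= f i)%R -> \Sum_i (f i)%:E = (\sum_i f i)%:E.
Proof. by move=> f0; rewrite Sum_fin ?sumEFin// => i; rewrite lee_fin. Qed.

Lemma pYZ_zSum y : \Sum_z (pYZ y z)%:E = (pY y)%:E.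
Proof.
under eq_Sum do rewrite -pYZ_Sum.
rewrite Sum_swap; last by move=> *; rewrite lee_fin !mulr_ge0.
under eq_Sum do (rewrite SumrZl// ?W_Sum ?mule1; last by rewrite mulr_ge0).
by rewrite SumrZr// pX_sum mul1e.
Qed.

Lemma pN_sum : \Sum_n (pN n)%:E = 1.
Proof.
transitivity (\Sum_y \Sum_n (pY y * nu y n)%:E).
  rewrite Sum_swap; last by move=> *; rewrite lee_fin mulr_ge0.
  by apply: eq_Sum => n; rewrite Sum_fin_real// => y; rewrite mulr_ge0.
by rewrite -pY_sum; apply: eq_Sum => y; rewrite SumrZl// nu_sum mule1.
Qed.

Lemma P_kap x u v (g : R) : (0 <= g)%R ->
  \Sum_y \Sum_n (P x u v y n * g)%:E = (pX x * kap x u v * g)%:E.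
Proof.
move=> g0; rewrite (_ : (pX x * kap x u v * g)%:E =
  \Sum_y (pY y * (pX x * kap x u v * g))%:E); last first.
  by rewrite SumrZr ?pY_sum ?mul1e// !mulr_ge0.
apply: eq_Sum => y; rewrite SumrZr// SumrZl//; last exact: mulr_ge0.
by rewrite Sum_K_n -!EFinM; congr EFin; ring.
Qed.

Lemma P_nu y n (g : R) : (0 <= g)%R ->
  \Sum_x \Sum_u \Sum_v (P x u v y n * g)%:E = (pY y * nu y n * g)%:E.
Proof.
move=> g0; rewrite (_ : (pY y * nu y n * g)%:E =
  \Sum_x (pX x * (pY y * nu y n * g))%:E); last first.
  by rewrite SumrZr ?pX_sum ?mul1e// !mulr_ge0.
apply: eq_Sum => x.
transitivity (\Sum_u (pX x * pY y * g * lam y u n)%:E).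
  apply: eq_Sum => u; rewrite SumrZr// SumrZl//; last exact: mulr_ge0.
  by rewrite (Sum_K_v x) -!EFinM; congr EFin; ring.
by rewrite SumrZl ?mulr_ge0// lam_nu -EFinM; congr EFin; ring.
Qed.

Lemma P_zeta y n (g : Z -> R) : (forall z, 0 <= g z)%R ->
  \Sum_x \Sum_u \Sum_v (P x u v y n * g (zeta v n))%:E =
  \Sum_z (pYZ y z * nu y n * g z)%:E.
Proof.
move=> g0.
transitivity (\Sum_x \Sum_u \Sum_v \Sum_z
   (pX x * pY y * g z * (K x y u v n * (zeta v n == z)%:R))%:E).
  apply: eq_Sum => x; apply: eq_Sum => u; apply: eq_Sum => v.
  rewrite -(@Sum_delta _ _ (fun z => P x u v y n * g z)%R) ?mulr_ge0//.
  by apply: eq_Sum => z; congr EFin; ring.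
rewrite Sum_swap31; last by move=> *; rewrite lee_fin !mulr_ge0.
apply: eq_Sum => z.
transitivity (\Sum_x (pX x * pY y * W x y z * (nu y n * g z))%:E).
  apply: eq_Sum => x.
  under eq_Sum do (rewrite SumrZl; [|by rewrite !mulr_ge0|by move=> ?; rewrite mulr_ge0]).
  rewrite SumZl ?mulr_ge0//; last by pos.
  by rewrite Sum_K_uv -EFinM; congr EFin; ring.
rewrite SumrZr ?mulr_ge0//; last by move=> *; rewrite !mulr_ge0.
by rewrite pYZ_Sum -EFinM; congr EFin; ring.
Qed.

Lemma P_expect (g : X -> Y -> Z -> R) : (forall x y z, 0 <= g x y z)%R ->
  \Sum_x \Sum_u \Sum_v \Sum_y \Sum_n (P x u v y n * g x y (zeta v n))%:E =
  (\sum_x \sum_y \sum_z pX x * pY y * W x y z * g x y z)%:E.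
Proof.
move=> g0.
transitivity (\Sum_x \Sum_y \Sum_z (pX x * pY y * W x y z * g x y z)%:E); last first.
  rewrite -Sum_fin_real; last first.
    by move=> x; do 2!apply: sumr_ge0 => *; rewrite !mulr_ge0.
  apply: eq_Sum => x; rewrite -Sum_fin_real; last first.
    by move=> y; apply: sumr_ge0 => *; rewrite !mulr_ge0.
  by apply: eq_Sum => y; rewrite -Sum_fin_real// => z; rewrite !mulr_ge0.
apply: eq_Sum => x.
transitivity (\Sum_u \Sum_v \Sum_n \Sum_y (P x u v y n * g x y (zeta v n))%:E).
  apply: eq_Sum => u; apply: eq_Sum => v.
  by rewrite Sum_swap// => *; rewrite lee_fin mulr_ge0.
rewrite Sum_swap31; last by move=> *; rewrite lee_fin mulr_ge0.
apply: eq_Sum => y.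
transitivity (\Sum_u \Sum_v \Sum_n \Sum_z
   (pX x * pY y * g x y z * (K x y u v n * (zeta v n == z)%:R))%:E).
  apply: eq_Sum => u; apply: eq_Sum => v; apply: eq_Sum => n.
  rewrite -(@Sum_delta _ _ (fun z => P x u v y n * g x y z)%R) ?mulr_ge0//.
  by apply: eq_Sum => z; congr EFin; ring.
rewrite Sum_swap31; last by move=> *; rewrite lee_fin !mulr_ge0.
apply: eq_Sum => z.
under eq_Sum do under eq_Sum do
  (rewrite SumrZl; [|by rewrite !mulr_ge0|by move=> ?; rewrite mulr_ge0]).
under eq_Sum do (rewrite SumZl; [|by rewrite !mulr_ge0|by pos]).
rewrite SumZl ?mulr_ge0//; last by pos.
by rewrite Sum_K_uvn -EFinM; congr EFin; ring.
Qed.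

(* [A], [B], [C] are the contributions of the three parties to [K]; [a1], [b1] (resp.
   [a2], [c2]) are strategies for the two ends of the link M12 (resp. M31) whose product
   is the marginal law of that link. *)
Section Factors.
Let pYZnu_ge0 y z n : (0 <= pYZ y z * nu y n)%R.
Proof. exact: mulr_ge0. Qed.
Hint Resolve pYZnu_ge0 P_ge0 : core.
Variables (A : X -> U -> V -> R) (B : Y -> U -> N -> R) (C : V -> N -> R).
Variables (a1 b1 : U -> R) (a2 c2 : V -> R).
Hypothesis A_ge0 : forall x u v, (0 <= A x u v)%R.
Hypothesis B_ge0 : forall y u n, (0 <= B y u n)%R.
Hypothesis C_ge0 : forall v n, (0 <= C v n)%R.
Hypothesis a1_ge0 : forall u, (0 <= a1 u)%R.
Hypothesis b1_ge0 : forall u, (0 <= b1 u)%R.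
Hypothesis a2_ge0 : forall v, (0 <= a2 v)%R.
Hypothesis c2_ge0 : forall v, (0 <= c2 v)%R.
Hypothesis K_fac : forall x y u v n,
  (0 < K x y u v n -> K x y u v n = A x u v * B y u n * C v n)%R.
Hypothesis K_uniq : forall x x' y u v n,
  (0 < K x y u v n)%R -> (0 < K x' y u v n)%R -> x = x'.
Hypothesis mass1 : forall x, \Sum_u \Sum_v (A x u v * b1 u * c2 v)%:E <= 1.
Hypothesis mass2 : forall y,
  \Sum_u \Sum_v \Sum_n (a1 u * a2 v * B y u n * C v n)%:E <= 1.
Hint Resolve A_ge0 B_ge0 C_ge0 a1_ge0 b1_ge0 a2_ge0 c2_ge0 : core.

(** The laws of M12 and, below, of M31 under a product input law; by privacy against Alice only [pX]
    enters. *)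
Definition mu12 u : R := (\sum_x pX x * rsum (fun v => kap x u v))%R.
Definition mu31 v : R := (\sum_x pX x * rsum (fun u => kap x u v))%R.

Lemma mu12E u : \Sum_x \Sum_v (pX x * kap x u v)%:E = (mu12 u)%:E.
Proof.
rewrite /mu12 -Sum_fin_real; last by move=> x; rewrite mulr_ge0// rsum_ge0.
apply: eq_Sum => x; rewrite SumrZl// EFinM; congr (_ * _).
apply: (@rsumE _ _ _ 1) => //; rewrite -(kap_sum x).
by apply: (Sum_ub (f := fun u => \Sum_v (kap x u v)%:E)) => i; pos.
Qed.

Lemma mu31E v : \Sum_x \Sum_u (pX x * kap x u v)%:E = (mu31 v)%:E.
Proof.
rewrite /mu31 -Sum_fin_real; last by move=> x; rewrite mulr_ge0// rsum_ge0.
apply: eq_Sum => x; rewrite SumrZl// EFinM; congr (_ * _).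
apply: (@rsumE _ _ _ 1) => //; rewrite -(kap_sum x) Sum_swap; last by pos.
by apply: (Sum_ub (f := fun v => \Sum_u (kap x u v)%:E)) => i; pos.
Qed.

Lemma mu12_ge0 u : (0 <= mu12 u)%R.
Proof. by apply: sumr_ge0 => x _; rewrite mulr_ge0// rsum_ge0. Qed.

Lemma mu31_ge0 v : (0 <= mu31 v)%R.
Proof. by apply: sumr_ge0 => x _; rewrite mulr_ge0// rsum_ge0. Qed.

Lemma mu31_sum : \Sum_v (mu31 v)%:E = 1.
Proof.
under eq_Sum do rewrite -mu31E.
rewrite Sum_swap; last by move=> *; apply: Sum_ge0 => ?; rewrite lee_fin mulr_ge0.
rewrite -pX_sum; apply: eq_Sum => x.
rewrite Sum_swap; last by move=> *; rewrite lee_fin mulr_ge0.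
under eq_Sum do rewrite SumrZl//.
by rewrite SumZl ?kap_sum ?mule1// => *; pos.
Qed.

Lemma mu12_sum : \Sum_u (mu12 u)%:E = 1.
Proof.
under eq_Sum do rewrite -mu12E.
rewrite Sum_swap; last by move=> *; apply: Sum_ge0 => ?; rewrite lee_fin mulr_ge0.
rewrite -pX_sum; apply: eq_Sum => x.
under eq_Sum do rewrite SumrZl//.
by rewrite SumZl ?kap_sum ?mule1// => *; pos.
Qed.

Lemma kap_eq0 x u v : (forall n, K x y0 u v n = 0%R) -> kap x u v = 0%R.
Proof.
by move=> K0; apply: EFin_inj; rewrite -(Sum_K_n x y0) Sum0// => n; rewrite K0.
Qed.

Lemma mu12_eq0 u : (forall x v n, K x y0 u v n = 0%R) -> mu12 u = 0%R.
Proof.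
move=> K0; rewrite /mu12 big1// => x _; rewrite /rsum Sum0 ?mulr0// => v.
by rewrite kap_eq0.
Qed.

Lemma mu31_eq0 v : (forall x u n, K x y0 u v n = 0%R) -> mu31 v = 0%R.
Proof.
move=> K0; rewrite /mu31 big1// => x _; rewrite /rsum Sum0 ?mulr0// => u.
by rewrite kap_eq0.
Qed.

Hypothesis mu12_le : forall u, (mu12 u <= a1 u * b1 u)%R.
Hypothesis mu31_le : forall v, (mu31 v <= a2 v * c2 v)%R.

(** When Alice plays [a1] and [a2] independently, the weight of (y, z, n) splits into Bob's part
    [Re y n] and Charlie's part [Se z n]. Taken alone, either sum may be infinite, hence the
    extended reals. *)
Definition Re y n := \Sum_u (a1 u * (pY y * B y u n))%:E.
Definition Se z n := \Sum_v (a2 v * C v n * (zeta v n == z)%:R)%:E.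
Definition Sne n := \Sum_v (a2 v * C v n)%:E.
Definition Rr y n : R := fine (Re y n).
Definition Sr z n : R := fine (Se z n).
Definition Sn n : R := fine (Sne n).

Lemma Re_ge0 y n : 0 <= Re y n.
Proof. by apply: Sum_ge0 => u; rewrite lee_fin !mulr_ge0. Qed.
Lemma Se_ge0 z n : 0 <= Se z n.
Proof. by apply: Sum_ge0 => v; rewrite lee_fin !mulr_ge0. Qed.
Lemma Sne_ge0 n : 0 <= Sne n.
Proof. by apply: Sum_ge0 => v; rewrite lee_fin !mulr_ge0. Qed.
Hint Resolve Re_ge0 Se_ge0 Sne_ge0 : core.
Let Rr_ge0 y n : (0 <= Rr y n)%R. Proof. exact: fine_ge0. Qed.
Let Sr_ge0 y n : (0 <= Sr y n)%R. Proof. exact: fine_ge0. Qed.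
Let Sn_ge0 n : (0 <= Sn n)%R. Proof. exact: fine_ge0. Qed.
Hint Resolve Rr_ge0 Sr_ge0 Sn_ge0 mu12_ge0 mu31_ge0 : core.

Lemma fineM_le (a b : \bar R) : 0 <= a -> 0 <= b -> (fine a * fine b)%:E <= a * b.
Proof.
case: a => [a| |] // a0; case: b => [b| |] // b0; rewrite ?mulr0 ?mul0r /=.
all: exact: mule_ge0.
Qed.

(** An infinite sum has [fine] value 0, and division by 0 gives 0, so the degenerate cases hold for
    free. *)
Lemma divfine_le (a b : \bar R) (q : R) : (0 <= q)%R -> 0 <= a -> 0 <= b ->
  (q / (fine a * fine b))%:E * (a * b) <= q%:E.
Proof.
move=> q0; case: a => [a| |] // a0; case: b => [b| |] // b0;
  rewrite ?mulr0 ?mul0r ?invr0 ?mulr0 ?mul0e ?lee_fin//.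
rewrite /= -mulrA; have [->|ab] := eqVneq (a * b)%R 0%R; first by rewrite !mulr0.
by rewrite mulVf// mulr1.
Qed.

Lemma Se_Sne n : \Sum_z Se z n = Sne n.
Proof.
rewrite Sum_swap; last by move=> *; rewrite lee_fin !mulr_ge0.
by apply: eq_Sum => v; rewrite (@Sum_delta _ _ (fun=> (a2 v * C v n)%R)) ?mulr_ge0.
Qed.

(** This is [mass2] averaged over [pY]: [Re y n * Sne n] is the weight of (y, n) under Alice's split
    play. *)
Lemma ReSne_le : \Sum_y \Sum_n (Re y n * Sne n) <= 1.
Proof.
rewrite -[leRHS]pY_sum; apply: le_Sum => y.
suff -> : \Sum_n (Re y n * Sne n) =
  \Sum_u \Sum_v \Sum_n (pY y * (a1 u * a2 v * B y u n * C v n))%:E.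
  under eq_Sum do under eq_Sum do
    (rewrite SumrZl; [|by []|by move=> ?; rewrite !mulr_ge0]).
  under eq_Sum do (rewrite SumZl; [|by []|by move=> ?; apply: Sum_ge0 => ?; rewrite lee_fin !mulr_ge0]).
  rewrite SumZl; [|by []|by move=> ?; do 2!apply: Sum_ge0 => ?; rewrite lee_fin !mulr_ge0].
  by rewrite -[leRHS]mule1 lee_pmul2l// lte_fin.
transitivity (\Sum_n \Sum_u \Sum_v (a1 u * (pY y * B y u n) * (a2 v * C v n))%:E).
  by apply: eq_Sum => n; rewrite SumM// => *; rewrite !mulr_ge0.
transitivity (\Sum_u \Sum_v \Sum_n (a1 u * (pY y * B y u n) * (a2 v * C v n))%:E).
  rewrite Sum_swap; last by move=> *; apply: Sum_ge0 => ?; rewrite lee_fin !mulr_ge0.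
  by apply: eq_Sum => u; rewrite Sum_swap// => *; rewrite lee_fin !mulr_ge0.
do 3![apply: eq_Sum => ?]; congr EFin; ring.
Qed.

(** [Re y n * Sne n] is at most 1, so neither factor can be infinite while the other is positive,
    and a run of positive weight makes both positive. *)
Lemma Re_fin y u v n : (0 < a1 u)%R -> (0 < B y u n)%R -> (0 < a2 v)%R ->
  (0 < C v n)%R -> [/\ (0 < Rr y n)%R, (0 < Sr (zeta v n) n)%R & (0 < Sn n)%R].
Proof.
move=> a10 B0 a20 C0.
have R0 : 0 < Re y n.
  apply: lt_le_trans (Sum_ub (f := fun u => (a1 u * (pY y * B y u n))%:E) u _).
    by rewrite lte_fin !mulr_gt0.
  by move=> i; rewrite lee_fin !mulr_ge0.
have S0 : 0 < Se (zeta v n) n.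
  apply: lt_le_trans (Sum_ub
    (f := fun v' => (a2 v' * C v' n * (zeta v' n == zeta v n)%:R)%:E) v _).
    by rewrite eqxx mulr1 lte_fin !mulr_gt0.
  by move=> i; rewrite lee_fin !mulr_ge0.
have SSn : Se (zeta v n) n <= Sne n.
  by rewrite -Se_Sne; apply: (Sum_ub (f := fun z => Se z n)).
have Sn0 := lt_le_trans S0 SSn.
have RS1 : Re y n * Sne n <= 1.
  apply: le_trans ReSne_le; apply: le_trans (Sum_ub (f := fun y =>
    \Sum_n (Re y n * Sne n)) y _); last by move=> i; apply: Sum_ge0 => ?; exact: mule_ge0.
  by apply: (Sum_ub (f := fun n => Re y n * Sne n)) => i; exact: mule_ge0.
have Rf : Re y n < +oo.
  rewrite ltNge leye_eq; apply/negP => /eqP RE; move: RS1.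
  by rewrite RE gt0_mulye.
have Snf : Sne n < +oo.
  rewrite ltNge leye_eq; apply/negP => /eqP SE; move: RS1.
  by rewrite SE gt0_muley.
split; apply: fine_gt0; apply/andP; split => //.
exact: le_lt_trans SSn Snf.
Qed.

(* The ratios to which [ln t <= t - 1] is applied.  [t0]: Bob and Charlie play [b1] and
   [c2] against Alice.  [t1]: Alice plays [a1] and [a2], given (y, z, n).  [t2], [t3]: the
   laws of (y, n) and of z given n induced by that play, against the true ones.  [t4]:
   dropping the conditioning on M23 in the entropy of M31 given M12. *)
Definition t0 x u v : R := (A x u v * b1 u * c2 v / kap x u v)%R.
Definition t1 x u v y n : R := (a1 u * a2 v * (pYZ y (zeta v n) * nu y n) /
  (pX x * A x u v * Rr y n * Sr (zeta v n) n))%R.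
Definition t2 y n : R := (Rr y n * Sn n / (pY y * nu y n))%R.
Definition t3 z n : R := (Sr z n * pN n / (Sn n * pZN z n))%R.
Definition t4 x u v y n : R :=
  (lam y u n * kap x u v / (mu12 u * K x y u v n))%R.

Lemma t0_ge0 x u v : (0 <= t0 x u v)%R.
Proof. by rewrite /t0; pos. Qed.
Lemma t1_ge0 x u v y n : (0 <= t1 x u v y n)%R.
Proof. by rewrite /t1; pos. Qed.
Lemma t2_ge0 y n : (0 <= t2 y n)%R.
Proof. by rewrite /t2; pos. Qed.
Lemma t3_ge0 z n : (0 <= t3 z n)%R.
Proof. by rewrite /t3; pos. Qed.
Lemma t4_ge0 x u v y n : (0 <= t4 x u v y n)%R.
Proof. by rewrite /t4; pos. Qed.
Hint Resolve t0_ge0 t1_ge0 t2_ge0 t3_ge0 t4_ge0 : core.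

Lemma t0_mass : \Sum_x \Sum_u \Sum_v \Sum_y \Sum_n (P x u v y n * t0 x u v)%:E <= 1.
Proof.
rewrite -[leRHS]pX_sum; apply: le_Sum => x.
apply: (@le_trans _ _ (\Sum_u \Sum_v (pX x * (A x u v * b1 u * c2 v))%:E)).
  apply: le_Sum => u; apply: le_Sum => v; rewrite P_kap// lee_fin -mulrA.
  apply: ler_wpM2l => //; rewrite /t0 mulrCA -[leRHS]mulr1; apply: ler_wpM2l.
    by pos.
  (* A ratio with zero denominator is 0, so the mass can only drop. The same case split closes the
     other mass bounds. *)
  have [->|k0] := eqVneq (kap x u v) 0%R; first by rewrite mul0r ler01.
  by rewrite divff.
under eq_Sum do (rewrite SumrZl; [|by []|by pos]).
rewrite SumZl; [|by []|by pos].
by rewrite -[leRHS]mule1 lee_pmul2l// lte_fin.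
Qed.

Lemma t2_mass : \Sum_x \Sum_u \Sum_v \Sum_y \Sum_n (P x u v y n * t2 y n)%:E <= 1.
Proof.
rewrite Sum_swap32; last by pos.
apply: le_trans ReSne_le; apply: le_Sum => y; apply: le_Sum => n.
rewrite P_nu//; apply: (@le_trans _ _ (Rr y n * Sn n)%:E); last exact: fineM_le.
rewrite lee_fin /t2 mulrCA -[leRHS]mulr1; apply: ler_wpM2l; first by pos.
have [->|k0] := eqVneq (pY y * nu y n)%R 0%R; first by rewrite mul0r ler01.
by rewrite divff.
Qed.

Lemma t3_mass :
  \Sum_x \Sum_u \Sum_v \Sum_y \Sum_n (P x u v y n * t3 (zeta v n) n)%:E <= 1.
Proof.
rewrite Sum_swap32; last by pos.
under eq_Sum do under eq_Sum do (rewrite (P_zeta _ _ (g := fun z => t3 z _)); [|by []]).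
rewrite Sum_swap; last by pos.
rewrite -pN_sum; apply: le_Sum => n.
rewrite Sum_swap; last by pos.
(* For fixed n the quotients [Sr z n / Sn n] sum to at most 1 over z, which leaves the mass of
   [pN]. *)
apply: (@le_trans _ _ (\Sum_z ((pN n / Sn n)%:E * (Sr z n)%:E))).
  apply: le_Sum => z; rewrite SumrZr//.
  rewrite Sum_fin_real//.
  rewrite -/(pZN z n) -!EFinM lee_fin /t3 invfM.
  rewrite [leLHS](_ : _ = (pN n / Sn n * Sr z n) * (pZN z n / pZN z n))%R; last by ring.
  rewrite -[leRHS]mulr1; apply: ler_wpM2l; first by pos.
  have [->|k0] := eqVneq (pZN z n) 0%R; first by rewrite mul0r ler01.
  by rewrite divff.
rewrite SumZl; [|by pos|by pos].
have [SnE|Snoo] := boolP (Sne n \is a fin_num); last first.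
  have -> : Sn n = 0%R.
    rewrite /Sn; move: Snoo; rewrite ge0_fin_numE// -leNgt leye_eq => /eqP -> //.
  by rewrite invr0 mulr0 mul0e lee_fin.
have -> : \Sum_z (Sr z n)%:E = (Sn n)%:E.
  rewrite /Sn fineK// -Se_Sne; apply: eq_Sum => z; rewrite fineK//.
  rewrite ge0_fin_numE//; apply: le_lt_trans (_ : Sne n < +oo).
    by rewrite -Se_Sne; apply: (Sum_ub (f := fun z => Se z n)).
  by rewrite -ge0_fin_numE.
rewrite -EFinM lee_fin -mulrA -[leRHS]mulr1; apply: ler_wpM2l => //.
have [->|k0] := eqVneq (Sn n) 0%R; first by rewrite mulr0 ler01.
by rewrite mulVf.
Qed.

(** For fixed (y, n, u) the sum of [pX x * kap x u v] over (x, v) is [mu12 u]; it cancels and leaves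
    the law of (Y, M12, M23). *)
Lemma t4_mass : \Sum_x \Sum_u \Sum_v \Sum_y \Sum_n (P x u v y n * t4 x u v y n)%:E <= 1.
Proof.
rewrite Sum_swap32; last by pos.
have -> : 1%:E = \Sum_y \Sum_n \Sum_u (pY y * lam y u n)%:E.
  rewrite -pY_sum; apply: eq_Sum => y.
  under eq_Sum do rewrite SumrZl//.
  by rewrite SumZl ?lam_sum ?mule1// => *; pos.
apply: le_Sum => y; apply: le_Sum => n.
rewrite Sum_swap; last by pos.
apply: le_Sum => u.
apply: (@le_trans _ _ (\Sum_x \Sum_v
   ((pY y * lam y u n / mu12 u)%:E * (pX x * kap x u v)%:E))).
  apply: le_Sum => x; apply: le_Sum => v; rewrite -EFinM lee_fin /t4 invfM.
  rewrite [leLHS](_ : _ = (pY y * lam y u n / mu12 u * (pX x * kap x u v)) *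
    (K x y u v n / K x y u v n))%R; last by ring.
  rewrite -[leRHS]mulr1; apply: ler_wpM2l; first by pos.
  have [->|k0] := eqVneq (K x y u v n) 0%R; first by rewrite mul0r ler01.
  by rewrite divff.
have g0 : (0 <= pY y * lam y u n / mu12 u)%R by pos.
under eq_Sum do (rewrite SumZl; [|exact: g0|by pos]).
rewrite SumZl//; last by pos.
rewrite mu12E -EFinM lee_fin.
rewrite [leLHS](_ : _ = pY y * lam y u n * ((mu12 u)^-1 * mu12 u))%R; last by ring.
rewrite -[leRHS]mulr1; apply: ler_wpM2l; first by pos.
have [->|k0] := eqVneq (mu12 u) 0%R; first by rewrite mulr0 ler01.
by rewrite mulVf.
Qed.

Lemma t1_mass :
  \Sum_x \Sum_u \Sum_v \Sum_y \Sum_n (P x u v y n * t1 x u v y n)%:E <= 1.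
Proof.
rewrite Sum_swap32; last by pos.
have -> : 1%:E = \Sum_y \Sum_n \Sum_z (pYZ y z * nu y n)%:E.
  rewrite -pY_sum; apply: eq_Sum => y.
  under eq_Sum do (rewrite SumrZr; [|by []|by []]).
  under eq_Sum do rewrite pYZ_zSum.
  by rewrite SumZl ?nu_sum ?mule1// => *; pos.
apply: le_Sum => y; apply: le_Sum => n.
pose h u v := (a1 u * (pY y * B y u n) * (a2 v * C v n) *
  (pYZ y (zeta v n) * nu y n / (Rr y n * Sr (zeta v n) n)))%R.
have h0 u v : (0 <= h u v)%R by pos.
apply: (@le_trans _ _ (\Sum_u \Sum_v (h u v)%:E)).
  rewrite Sum_swap; last by pos.
  apply: le_Sum => u.
  rewrite Sum_swap; last by pos.
  apply: le_Sum => v.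
  have z x : ~ (0 < K x y u v n)%R -> (P x u v y n * t1 x u v y n)%:E = 0.
    move=> nK; have -> : P x u v y n = 0%R; last by rewrite mul0r.
    suff -> : K x y u v n = 0%R by rewrite mulr0.
    by apply/eqP; rewrite eq_le K_ge0 andbT leNgt; apply/negP.
  (* Here it matters that the transcripts determine Alice's input: by [K_uniq] at most one x
     contributes, so no sum over x is left once [A x u v] and [pX x] have cancelled. *)
  have [[x Kx]|nK] := pselect (exists x, 0 < K x y u v n)%R; last first.
    by rewrite Sum0 ?lee_fin// => x; apply: z => Kx; apply: nK; exists x.
  rewrite (@Sum_one _ _ _ x); first last.
  - move=> x' xx'; apply: z => Kx'; move/eqP: xx'; apply.
    exact: K_uniq Kx' Kx.
  - by rewrite lee_fin mulr_ge0.
  have := Kx; rewrite K_fac// => ABC.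
  have An0 : A x u v != 0%R by apply/eqP => A0; move: ABC; rewrite A0 !mul0r ltxx.
  rewrite lee_fin /t1 /h !invfM.
  rewrite [leLHS](_ : _ = (a1 u * (pY y * B y u n) * (a2 v * C v n) *
    (pYZ y (zeta v n) * nu y n * ((Rr y n)^-1 * (Sr (zeta v n) n)^-1)) *
    ((pX x / pX x) * (A x u v / A x u v))))%R; last by ring.
  by rewrite !divff ?mulr1// gt_eqF.
(* Grouping the v with the same [zeta v n] makes the sum over (u, v) a product [Re y n * Se z n],
   which the denominator absorbs. *)
rewrite [leLHS](_ : _ = \Sum_z \Sum_u \Sum_v
    ((pYZ y z * nu y n / (Rr y n * Sr z n))%:E *
     ((a1 u * (pY y * B y u n))%:E * (a2 v * C v n * (zeta v n == z)%:R)%:E)));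
    last first.
  rewrite [RHS]Sum_swap; last by pos.
  apply: eq_Sum => u; rewrite [RHS]Sum_swap; last by pos.
  apply: eq_Sum => v; rewrite -(@Sum_delta _ _ (fun z => a1 u * (pY y * B y u n) *
    (a2 v * C v n) * (pYZ y z * nu y n / (Rr y n * Sr z n)))%R); last by pos.
  by apply: eq_Sum => z; rewrite -!EFinM; congr EFin; ring.
apply: le_Sum => z.
have g0 : (0 <= pYZ y z * nu y n / (Rr y n * Sr z n))%R.
  by pos.
have n1 u : (0 <= a1 u * (pY y * B y u n))%R by pos.
have n2 v : (0 <= a2 v * C v n * (zeta v n == z)%:R)%R by pos.
under eq_Sum do (rewrite SumZl; [|exact: g0|by move=> ?; apply: mule_ge0; rewrite lee_fin]).
rewrite SumZl//; last by move=> ?; apply: Sum_ge0 => ?; apply: mule_ge0; rewrite lee_fin.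
rewrite [X in _ * X <= _](_ : _ = Re y n * Se z n); last exact: (SumM n1 n2).
exact: divfine_le.
Qed.

Variable f : Y -> nat.
Hypothesis f_nu : forall y y', f y = f y' -> forall n, nu y n = nu y' n.

Definition pQ y : R := (\sum_(y' | f y' == f y) pY y')%R.

(** Pointwise form of I(f(Y); M23) <= H(f(Y)): [nu y] is also the law of M23 given the class of y,
    and that class is only one part of the mixture [pN]. *)
Lemma pQ_nu y n : (pQ y * nu y n <= pN n)%R.
Proof.
rewrite /pQ /pN big_distrl/= [leRHS](bigID (fun y' => f y' == f y))/=.
rewrite -[leLHS]addr0; apply: lerD; last by apply: sumr_ge0 => *; rewrite mulr_ge0.
by apply: ler_sum => y' /eqP yy'; rewrite (f_nu yy').
Qed.

(** Every y' compatible with z has the same law of M23, by [nu_eq]. *)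
Lemma pZN_pZ y z n : (0 < pYZ y z)%R -> pZN z n = (pZ z * nu y n)%R.
Proof.
have H y' : (0 < pYZ y' z)%R -> exists x, (0 < W x y' z)%R.
  move=> yz; apply: contrapT => nW; move: yz; rewrite /pYZ big1 ?mulr0 ?ltxx// => x _.
  suff -> : W x y' z = 0%R by rewrite mulr0.
  by apply/eqP; rewrite eq_le W_ge0 andbT leNgt; apply/negP => ?; apply: nW; exists x.
move=> yz; rewrite /pZN /pZ big_distrl/=; apply: eq_bigr => y' _.
have := pYZ_ge0 y' z; rewrite le_eqVlt => /predU1P[<-|y'z]; first by rewrite !mul0r.
have [x Wx] := H _ yz; have [x' Wx'] := H _ y'z.
by rewrite (nu_eq n Wx' Wx).
Qed.

(** In nats, the expectation of [c1] is I(Y; Z) - H(f(Y)), and that of [c2'] below is H(X, Z |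
    Y). *)
Definition c1 y z : R := ln (pYZ y z * pQ y / (pY y * pZ z)).
Definition c2' x y z : R := (- ln (pX x * W x y z))%R.

(** The two runs share x, u and v. Their positivity makes every factor positive, and [ratio_algebra]
    can be turned into logarithms. *)
Lemma pointwise_bound x u v y n y' n' :
  (0 < K x y u v n)%R -> (0 < K x y' u v n')%R ->
  (c1 y (zeta v n) + c2' x y' (zeta v n') + 5%:R <=
   - ln (mu31 v) + (t0 x u v + t1 x u v y n + t2 y n + t3 (zeta v n) n)
   + t4 x u v y' n')%R.
Proof.
move=> K1 K2.
have ABC := K1; rewrite (K_fac K1) in ABC.
have A0 : (0 < A x u v)%R.
  by rewrite lt_def A_ge0 andbT; apply/eqP => E; move: ABC; rewrite E !mul0r ltxx.
have B0 : (0 < B y u n)%R.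
  by rewrite lt_def B_ge0 andbT; apply/eqP => E; move: ABC; rewrite E mulr0 mul0r ltxx.
have C0 : (0 < C v n)%R.
  by rewrite lt_def C_ge0 andbT; apply/eqP => E; move: ABC; rewrite E mulr0 ltxx.
have gt0_l (a b c : R) : (0 <= a)%R -> (0 <= b)%R -> (0 < c)%R -> (c <= a * b)%R ->
    (0 < a)%R /\ (0 < b)%R.
  move=> a0 b0 c0 cab; have := lt_le_trans c0 cab.
  by split; rewrite lt_def ?a0 ?b0 andbT; apply/eqP => E; move: H; rewrite E ?mulr0 ?mul0r ltxx.
have [k0 W1] : (0 < kap x u v)%R /\ (0 < W x y (zeta v n))%R.
  exact: gt0_l K1 (K_le_kap _ _ _ _ _).
have [l0 W2] : (0 < lam y' u n')%R /\ (0 < W x y' (zeta v n'))%R.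
  exact: gt0_l K2 (K_le_lam _ _ _ _ _).
have [l1 _] : (0 < lam y u n)%R /\ (0 < W x y (zeta v n))%R.
  exact: gt0_l K1 (K_le_lam _ _ _ _ _).
have pk0 : (0 < pX x * kap x u v)%R by rewrite mulr_gt0.
have m120 : (0 < mu12 u)%R.
  rewrite -lte_fin -mu12E; apply: (@lt_le_trans _ _ (pX x * kap x u v)%:E) => //.
  apply: le_trans (Sum_ub (f := fun x => \Sum_v (pX x * kap x u v)%:E) x _); last by pos.
  by apply: (Sum_ub (f := fun v => (pX x * kap x u v)%:E)); pos.
have m310 : (0 < mu31 v)%R.
  rewrite -lte_fin -mu31E; apply: (@lt_le_trans _ _ (pX x * kap x u v)%:E) => //.
  apply: le_trans (Sum_ub (f := fun x => \Sum_u (pX x * kap x u v)%:E) x _); last by pos.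
  by apply: (Sum_ub (f := fun u => (pX x * kap x u v)%:E)); pos.
have [a10 b10] := gt0_l _ _ _ (a1_ge0 u) (b1_ge0 u) m120 (mu12_le u).
have [a20 c20] := gt0_l _ _ _ (a2_ge0 v) (c2_ge0 v) m310 (mu31_le v).
have [R0 S0 Sn0] := Re_fin a10 B0 a20 C0.
have nu0 : (0 < nu y n)%R.
  rewrite -lte_fin -lam_nu; apply: (@lt_le_trans _ _ (lam y u n)%:E) => //.
  by apply: (Sum_ub (f := fun u => (lam y u n)%:E)); pos.
have yz0 : (0 < pYZ y (zeta v n))%R.
  rewrite mulr_gt0// (bigD1 x)//= ltr_pwDl ?mulr_gt0//.
  by apply: sumr_ge0 => *; rewrite mulr_ge0.
have z0 : (0 < pZ (zeta v n))%R.
  rewrite /pZ (bigD1 y)//= ltr_pwDl//.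
  by apply: sumr_ge0 => *.
have q0 : (0 < pQ y)%R.
  rewrite /pQ (bigD1 y)//= ltr_pwDl//.
  by apply: sumr_ge0 => *.
have n0 : (0 < pN n)%R by apply: lt_le_trans (pQ_nu y n); rewrite mulr_gt0.
have zn := pZN_pZ n yz0.
have T0 : (0 < t0 x u v)%R by rewrite divr_gt0 ?mulr_gt0.
have T1 : (0 < t1 x u v y n)%R.
  by apply: divr_gt0; [apply: mulr_gt0; apply: mulr_gt0|do 3?apply: mulr_gt0].
have T2 : (0 < t2 y n)%R by rewrite divr_gt0 ?mulr_gt0.
have T3 : (0 < t3 (zeta v n) n)%R.
  by rewrite /t3 zn; apply: divr_gt0; [exact: mulr_gt0|do 2?apply: mulr_gt0].
have T5 : (0 < t4 x u v y' n')%R by rewrite divr_gt0 ?mulr_gt0.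
have := ratio_algebra A0 k0 b10 c20 a10 a20 yz0 nu0 (pX_gt0 x) R0 S0 Sn0 (pY_gt0 y)
  n0 z0 l0 m120 K2 m310 q0 W2 (mu12_le u) (mu31_le v) (pQ_nu y n) (K_le_lam _ _ _ _ _).
rewrite -/(t0 x u v) -/(t1 x u v y n) -/(t2 y n) -zn -/(t3 (zeta v n) n)
  -/(t4 x u v y' n').
have E1 : (0 < pYZ y (zeta v n) * pQ y / (pY y * pZ (zeta v n)))%R.
  by apply: divr_gt0; apply: mulr_gt0.
have E2 : (0 < pX x * W x y' (zeta v n'))%R by rewrite mulr_gt0.
exact: ln_prod5_le.
Qed.

End Factors.
End Rho.

(** * Averaging the pointwise bound over two coupled runs *)

Section Conclusion.
Variables (pX : X -> R) (pY1 pY2 : Y -> R).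
Hypothesis pX_gt0 : forall x, (0 < pX x)%R.
Hypothesis pY1_gt0 : forall y, (0 < pY1 y)%R.
Hypothesis pY2_gt0 : forall y, (0 < pY2 y)%R.
Hypothesis pX_sum : \Sum_x (pX x)%:E = 1.
Hypothesis pY1_sum : \Sum_y (pY1 y)%:E = 1.
Hypothesis pY2_sum : \Sum_y (pY2 y)%:E = 1.
Variables (A : X -> U -> V -> R) (B : Y -> U -> N -> R) (C : V -> N -> R).
Variables (a1 b1 : U -> R) (a2 c2 : V -> R).
Hypothesis A_ge0 : forall x u v, (0 <= A x u v)%R.
Hypothesis B_ge0 : forall y u n, (0 <= B y u n)%R.
Hypothesis C_ge0 : forall v n, (0 <= C v n)%R.
Hypothesis a1_ge0 : forall u, (0 <= a1 u)%R.
Hypothesis b1_ge0 : forall u, (0 <= b1 u)%R.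
Hypothesis a2_ge0 : forall v, (0 <= a2 v)%R.
Hypothesis c2_ge0 : forall v, (0 <= c2 v)%R.
Hypothesis K_fac : forall x y u v n,
  (0 < K x y u v n -> K x y u v n = A x u v * B y u n * C v n)%R.
Hypothesis K_uniq : forall x x' y u v n,
  (0 < K x y u v n)%R -> (0 < K x' y u v n)%R -> x = x'.
Hypothesis mass1 : forall x, \Sum_u \Sum_v (A x u v * b1 u * c2 v)%:E <= 1.
Hypothesis mass2 : forall y,
  \Sum_u \Sum_v \Sum_n (a1 u * a2 v * B y u n * C v n)%:E <= 1.
Hypothesis mu12_le : forall u, (mu12 pX u <= a1 u * b1 u)%R.
Hypothesis mu31_le : forall v, (mu31 pX v <= a2 v * c2 v)%R.
Variable f : Y -> nat.
Hypothesis f_nu : forall y y', f y = f y' -> forall n, nu y n = nu y' n.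

Let pX_ge0 x : (0 <= pX x)%R. Proof. exact: ltW. Qed.
Let pY1_ge0 y : (0 <= pY1 y)%R. Proof. exact: ltW. Qed.
Let pY2_ge0 y : (0 <= pY2 y)%R. Proof. exact: ltW. Qed.
Hint Resolve pX_ge0 pY1_ge0 pY2_ge0 K_ge0 W_ge0 kap_ge0 lam_ge0 nu_ge0 : core.
Hint Resolve A_ge0 B_ge0 C_ge0 a1_ge0 b1_ge0 a2_ge0 c2_ge0 : core.

Lemma Sum_quint (h : X -> U -> V -> Y -> N -> R) :
  (forall x u v y n, 0 <= h x u v y n)%R ->
  \Sum_(s : X * U * V) \Sum_(d : Y * N) (h s.1.1 s.1.2 s.2 d.1 d.2)%:E =
  \Sum_x \Sum_u \Sum_v \Sum_y \Sum_n (h x u v y n)%:E.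
Proof.
move=> h0.
rewrite (Sum_pair (f := fun (xu : X * U) v =>
  \Sum_(d : Y * N) (h xu.1 xu.2 v d.1 d.2)%:E)); last by pos.
rewrite (Sum_pair (f := fun x u => \Sum_v
  \Sum_(d : Y * N) (h x u v d.1 d.2)%:E)); last by pos.
do 3![apply: eq_Sum => ?].
by rewrite (Sum_pair (f := fun y n => (h _ _ _ y n)%:E))//; pos.
Qed.

Lemma Sum_triple (h : X -> U -> V -> R) : (forall x u v, 0 <= h x u v)%R ->
  \Sum_(s : X * U * V) (h s.1.1 s.1.2 s.2)%:E = \Sum_x \Sum_u \Sum_v (h x u v)%:E.
Proof.
move=> h0.
rewrite (Sum_pair (f := fun (xu : X * U) v => (h xu.1 xu.2 v)%:E)); last by pos.
by rewrite (Sum_pair (f := fun x u => \Sum_v (h x u v)%:E)); last by pos.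
Qed.

Lemma Sum_quintD (g h : X -> U -> V -> Y -> N -> R) :
  (forall x u v y n, 0 <= g x u v y n)%R -> (forall x u v y n, 0 <= h x u v y n)%R ->
  \Sum_x \Sum_u \Sum_v \Sum_y \Sum_n (g x u v y n + h x u v y n)%:E =
  \Sum_x \Sum_u \Sum_v \Sum_y \Sum_n (g x u v y n)%:E +
  \Sum_x \Sum_u \Sum_v \Sum_y \Sum_n (h x u v y n)%:E.
Proof.
move=> g0 h0.
by do 5![rewrite -SumD; [apply: eq_Sum => ?|by pos|by pos]].
Qed.

Theorem transcript_entropy_bound :
  (\sum_x \sum_y \sum_z pX x * pY1 y * W x y z * c1 pX pY1 f y z +
   \sum_x \sum_y \sum_z pX x * pY2 y * W x y z * c2' pX x y z)%R%:E <=
  \Sum_v (mu31 pX v * - ln (mu31 pX v))%:E.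
Proof.
(* [c1] may be negative, while the countable sums need nonnegative terms. The shift [M] ends up on
   both sides and cancels. *)
pose M : R := (\sum_y \sum_z `|c1 pX pY1 f y z|)%R.
have M0 : (0 <= M)%R by do 2!apply: sumr_ge0 => ? _.
have c1M y z : (0 <= c1 pX pY1 f y z + M)%R.
  suff : (`|c1 pX pY1 f y z| <= M)%R by rewrite ler_norml => /andP[? _]; lra.
  rewrite /M (bigD1 y)//= (bigD1 z)//= -addrA lerDl addr_ge0//.
    by apply: sumr_ge0.
  by do 2!apply: sumr_ge0 => ? _.
have mu31_1 v : (mu31 pX v <= 1)%R.
  rewrite -lee_fin -(@mu31_sum pX)//.
  by apply: (Sum_ub (f := fun v => (mu31 pX v)%:E)) => w; rewrite lee_fin mu31_ge0.
have L0 v : (0 <= - ln (mu31 pX v))%R.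
  by rewrite oppr_ge0; apply: ln_le0.
have pXW x y z : (pX x * W x y z <= 1)%R.
  have W1 : (W x y z <= 1)%R.
    by rewrite -(W_sum x y) (bigD1 z)//= lerDl; apply: sumr_ge0.
  have p1 : (pX x <= 1)%R.
    by rewrite -lee_fin -pX_sum; apply: (Sum_ub (f := fun x => (pX x)%:E)); pos.
  by rewrite -[leRHS]mulr1; apply: ler_pM.
have c20 x y z : (0 <= c2' pX x y z)%R by rewrite /c2' oppr_ge0; apply: ln_le0.
pose t04 x u v y n := (t0 A b1 c2 x u v + t1 pX pY1 A B C a1 a2 x u v y n +
  t2 pY1 B C a1 a2 y n + t3 pX pY1 C a2 (zeta v n) n)%R.
pose t44 x u v y n : R := t4 pX x u v y n.
have t00 x u v : (0 <= t0 A b1 c2 x u v)%R by exact: t0_ge0.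
have t10 x u v y n : (0 <= t1 pX pY1 A B C a1 a2 x u v y n)%R by exact: t1_ge0.
have t20 y n : (0 <= t2 pY1 B C a1 a2 y n)%R by exact: t2_ge0.
have t30 z n : (0 <= t3 pX pY1 C a2 z n)%R by exact: t3_ge0.
have t40 x u v y n : (0 <= t44 x u v y n)%R by exact: t4_ge0.
have t040 x u v y n : (0 <= t04 x u v y n)%R by rewrite !addr_ge0.
(* The shared data [s] is (x, u, v) and [d] is the rest (y, n) of a run. The ratios are weighted by
   the law of the run, which [coupled_bound] divides out again. *)
have KEY := @coupled_bound R (X * U * V)%type (Y * N)%type
  (fun s => pX s.1.1 * kap s.1.1 s.1.2 s.2)%R (fun s => - ln (mu31 pX s.2))%R M 5%:R
  (fun s d => pX s.1.1 * pY1 d.1 * K s.1.1 d.1 s.1.2 s.2 d.2)%R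
  (fun s d => pX s.1.1 * pY2 d.1 * K s.1.1 d.1 s.1.2 s.2 d.2)%R
  (fun s d => c1 pX pY1 f d.1 (zeta s.2 d.2) + M)%R
  (fun s d => c2' pX s.1.1 d.1 (zeta s.2 d.2))
  (fun s d => pX s.1.1 * pY1 d.1 * K s.1.1 d.1 s.1.2 s.2 d.2 *
     t04 s.1.1 s.1.2 s.2 d.1 d.2)%R
  (fun s d => pX s.1.1 * pY2 d.1 * K s.1.1 d.1 s.1.2 s.2 d.2 *
     t44 s.1.1 s.1.2 s.2 d.1 d.2)%R
  M0 (ler0n _ _).
have nP1 x u v y n : (0 <= pX x * pY1 y * K x y u v n)%R by pos.
have nP2 x u v y n : (0 <= pX x * pY2 y * K x y u v n)%R by pos.
have {KEY} :
  \Sum_x \Sum_u \Sum_v \Sum_y \Sum_n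
     (pX x * pY1 y * K x y u v n * (c1 pX pY1 f y (zeta v n) + M))%:E +
  \Sum_x \Sum_u \Sum_v \Sum_y \Sum_n
     (pX x * pY2 y * K x y u v n * c2' pX x y (zeta v n))%:E + 5%:E * 1 <=
  \Sum_v (mu31 pX v * - ln (mu31 pX v))%:E +
  \Sum_x \Sum_u \Sum_v \Sum_y \Sum_n
     (pX x * pY1 y * K x y u v n * t04 x u v y n)%:E +
  \Sum_x \Sum_u \Sum_v \Sum_y \Sum_n
     (pX x * pY2 y * K x y u v n * t44 x u v y n)%:E + M%:E * 1.
  have p1 : \Sum_(s : X * U * V) (pX s.1.1 * kap s.1.1 s.1.2 s.2)%:E = 1.
    rewrite (Sum_triple (h := fun x u v => pX x * kap x u v)%R); last by pos.
    rewrite -pX_sum; apply: eq_Sum => x.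
    under eq_Sum do rewrite SumrZl//.
    by rewrite SumZl ?kap_sum ?mule1// => *; pos.
  have pL : \Sum_(s : X * U * V)
      (pX s.1.1 * kap s.1.1 s.1.2 s.2 * - ln (mu31 pX s.2))%:E =
      \Sum_v (mu31 pX v * - ln (mu31 pX v))%:E.
    rewrite (Sum_triple (h := fun x u v => pX x * kap x u v * - ln (mu31 pX v))%R);
      last by pos.
    transitivity (\Sum_x \Sum_v \Sum_u (pX x * kap x u v * - ln (mu31 pX v))%:E).
      by apply: eq_Sum => x; rewrite Sum_swap//; pos.
    rewrite Sum_swap; last by pos.
    apply: eq_Sum => v; rewrite EFinM -(@mu31E pX)//.
    rewrite -SumZr//; last by pos.
    by apply: eq_Sum => x; rewrite -SumZr//; pos.
  rewrite -!Sum_quint; do ?[by pos]; rewrite -p1 -pL; apply: KEY => //; do ?[by pos].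
  - move=> [[x u] v] /=.
    rewrite (Sum_pair (f := fun y n => (pX x * pY1 y * K x y u v n)%:E)); last by pos.
    have := @P_kap pX pY1 pX_gt0 pY1_gt0 pY1_sum x u v 1%R ler01.
    by under eq_Sum do under eq_Sum do rewrite mulr1; rewrite mulr1.
  - move=> [[x u] v] /=.
    rewrite (Sum_pair (f := fun y n => (pX x * pY2 y * K x y u v n)%:E)); last by pos.
    have := @P_kap pX pY2 pX_gt0 pY2_gt0 pY2_sum x u v 1%R ler01.
    by under eq_Sum do under eq_Sum do rewrite mulr1; rewrite mulr1.
  - move=> [[x u] v] [y n] [y' n'] /= K1 K2.
    have d (a b : R) : (0 < a)%R -> (a * b / a = b)%R.
      by move=> a0; rewrite mulrAC divff ?mul1r ?gt_eqF.
    rewrite !d//; move: K1 K2; rewrite !pmulr_rgt0 ?mulr_gt0// => K1 K2.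
    have := @pointwise_bound pX pY1 pX_gt0 pY1_gt0 pY1_sum A B C a1 b1 a2 c2
      A_ge0 B_ge0 C_ge0 a1_ge0 b1_ge0 a2_ge0 c2_ge0 K_fac mass2 mu12_le mu31_le f f_nu
      x u v y n y' n' K1 K2.
    by rewrite /t04 /t44; lra.
rewrite (P_expect pX_gt0 pY1_gt0 (g := fun x y z => c1 pX pY1 f y z + M)%R)//.
rewrite (P_expect pX_gt0 pY2_gt0 (g := fun x y z => c2' pX x y z))//.
have rsum1 (T : finType) (p : T -> R) : (forall t, 0 <= p t)%R ->
    \Sum_t (p t)%:E = 1 -> (\sum_t p t = 1)%R.
  by move=> p0; rewrite Sum_fin_real// => -[].
have E1 : (\sum_x \sum_y \sum_z pX x * pY1 y * W x y z * (c1 pX pY1 f y z + M) =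
    \sum_x \sum_y \sum_z pX x * pY1 y * W x y z * c1 pX pY1 f y z + M)%R.
  transitivity (\sum_x (\sum_y \sum_z pX x * pY1 y * W x y z * c1 pX pY1 f y z +
      pX x * M))%R; last first.
    by rewrite big_split/= -big_distrl/= (rsum1 _ pX)// mul1r.
  apply: eq_bigr => x _.
  transitivity (\sum_y (\sum_z pX x * pY1 y * W x y z * c1 pX pY1 f y z +
      pX x * pY1 y * M))%R; last first.
    by rewrite big_split/= -big_distrl/= -big_distrr/= (rsum1 _ pY1)// mulr1.
  apply: eq_bigr => y _.
  transitivity (\sum_z (pX x * pY1 y * W x y z * c1 pX pY1 f y z +
      pX x * pY1 y * W x y z * M))%R; first by apply: eq_bigr => z _; rewrite mulrDr.
  by rewrite big_split/= -[X in (_ + X)%R]big_distrl/= -big_distrr/= W_sum mulr1.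
have m0 : \Sum_x \Sum_u \Sum_v \Sum_y \Sum_n
  (pX x * pY1 y * K x y u v n * t0 A b1 c2 x u v)%:E <= 1 by exact: t0_mass.
have m1 : \Sum_x \Sum_u \Sum_v \Sum_y \Sum_n
  (pX x * pY1 y * K x y u v n * t1 pX pY1 A B C a1 a2 x u v y n)%:E <= 1.
  exact: t1_mass.
have m2 : \Sum_x \Sum_u \Sum_v \Sum_y \Sum_n
  (pX x * pY1 y * K x y u v n * t2 pY1 B C a1 a2 y n)%:E <= 1 by exact: t2_mass.
have m3 : \Sum_x \Sum_u \Sum_v \Sum_y \Sum_n
  (pX x * pY1 y * K x y u v n * t3 pX pY1 C a2 (zeta v n) n)%:E <= 1.
  exact: t3_mass.
have m5 : \Sum_x \Sum_u \Sum_v \Sum_y \Sum_n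
  (pX x * pY2 y * K x y u v n * t44 x u v y n)%:E <= 1 by exact: t4_mass.
have m4 : \Sum_x \Sum_u \Sum_v \Sum_y \Sum_n
  (pX x * pY1 y * K x y u v n * t04 x u v y n)%:E <= 4%:E.
  pose q0 x u v y n := (pX x * pY1 y * K x y u v n * t0 A b1 c2 x u v)%R.
  pose q1 x u v y n :=
    (pX x * pY1 y * K x y u v n * t1 pX pY1 A B C a1 a2 x u v y n)%R.
  pose q2 x u v y n := (pX x * pY1 y * K x y u v n * t2 pY1 B C a1 a2 y n)%R.
  pose q3 x u v y n :=
    (pX x * pY1 y * K x y u v n * t3 pX pY1 C a2 (zeta v n) n)%R.
  have q00 x u v y n : (0 <= q0 x u v y n)%R by exact: mulr_ge0.
  have q10 x u v y n : (0 <= q1 x u v y n)%R by exact: mulr_ge0.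
  have q20 x u v y n : (0 <= q2 x u v y n)%R by exact: mulr_ge0.
  have q30 x u v y n : (0 <= q3 x u v y n)%R by exact: mulr_ge0.
  have q010 x u v y n : (0 <= q0 x u v y n + q1 x u v y n)%R by exact: addr_ge0.
  have q0120 x u v y n : (0 <= q0 x u v y n + q1 x u v y n + q2 x u v y n)%R.
    exact: addr_ge0.
  have -> : \Sum_x \Sum_u \Sum_v \Sum_y \Sum_n
      (pX x * pY1 y * K x y u v n * t04 x u v y n)%:E =
    \Sum_x \Sum_u \Sum_v \Sum_y \Sum_n
      (q0 x u v y n + q1 x u v y n + q2 x u v y n + q3 x u v y n)%:E.
    by do 5![apply: eq_Sum => ?]; congr EFin; rewrite /t04 !mulrDr.
  rewrite (Sum_quintD q0120 q30) (Sum_quintD q010 q20) (Sum_quintD q00 q10).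
  rewrite (_ : 4%:E = 1 + 1 + 1 + 1 :> \bar R); last by rewrite -!EFinD; congr EFin; lra.
  exact: (leeD (leeD (leeD m0 m1) m2) m3).
rewrite E1 !mule1 => key.
have H0 : 0 <= \Sum_v (mu31 pX v * - ln (mu31 pX v))%:E.
  by apply: Sum_ge0 => v; rewrite lee_fin mulr_ge0// mu31_ge0.
(* Mass 4 from the first run and mass 1 from the second balance the constant 5; if the entropy is
   infinite nothing remains to be shown. *)
have {key} : (\sum_x \sum_y \sum_z pX x * pY1 y * W x y z * c1 pX pY1 f y z + M)%R%:E +
   (\sum_x \sum_y \sum_z pX x * pY2 y * W x y z * c2' pX x y z)%R%:E + 5%:E <=
   \Sum_v (mu31 pX v * - ln (mu31 pX v))%:E + 4%:E + 1%:E + M%:E.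
  apply: (le_trans key); apply: leeD; last exact: lexx.
  by apply: leeD m5; apply: leeD m4; exact: lexx.
case: (\Sum_v (mu31 pX v * - ln (mu31 pX v))%:E) H0 => [H| |] // _.
  by rewrite -!EFinD !lee_fin; lra.
by move=> _; rewrite leey.
Qed.

End Conclusion.
End Core.

(** * Entropies of the functionality *)

Section FiniteEntropy.
Variable R : realType.

Definition push (T : finType) (U : eqType) (p : T -> R) (g : T -> U) (u : U) : R :=
  \sum_(t : T | g t == u) p t.

Lemma ent_log2 (x : R) : ent x = x * - log2 x.
Proof. by rewrite /ent; case: eqVneq => [->|_]; rewrite ?mul0r// mulrN. Qed.

(** Written as expectations over the sample space, entropies of different functions can be combined
    term by term. *)
Lemma Hf_push (T : finType) (U : eqType) (p : T -> R) (g : T -> U) :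
  Hf p g = \sum_(t : T) p t * - log2 (push p g (g t)).
Proof.
transitivity (\sum_(u <- undup (map g (enum T))) \sum_(t : T | g t == u)
  p t * - log2 (push p g (g t))).
  apply: eq_bigr => u _; rewrite ent_log2 big_distrl/=.
  by apply: eq_bigr => t /eqP <-.
rewrite (exchange_big_dep xpredT)//=; apply: eq_bigr => t _.
have gt : g t \in undup (map g (enum T)) by rewrite mem_undup map_f ?mem_enum.
rewrite big_mkcond (bigD1_seq (g t))/= ?undup_uniq// eqxx big1 ?addr0// => u.
by rewrite eq_sym => /negbTE ->.
Qed.

Lemma push_bij (S T : finType) (U : eqType) (e : S -> T) (p : T -> R) (g : T -> U) u :
  bijective e -> push (p \o e) (g \o e) u = push p g u.
Proof.
by move=> be; rewrite /push [RHS](reindex e)//; exact: onW_bij.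
Qed.

Lemma Hf_bij (S T : finType) (U : eqType) (e : S -> T) (p : T -> R) (g : T -> U) :
  bijective e -> Hf (p \o e) (g \o e) = Hf p g.
Proof.
move=> be; rewrite !Hf_push [RHS](reindex e)/=; last exact: onW_bij.
by apply: eq_bigr => s _; rewrite push_bij.
Qed.

Lemma Hf_inj (T : finType) (U V : eqType) (h : U -> V) (p : T -> R) (g : T -> U) :
  injective h -> Hf p (h \o g) = Hf p g.
Proof.
move=> hI; rewrite !Hf_push; apply: eq_bigr => t _; congr (_ * - log2 _).
by apply: eq_bigl => t' /=; rewrite (inj_eq hI).
Qed.

Lemma RI_bij (S T : finType) (U V : eqType) (e : S -> T) (p : T -> R)
    (ga : T -> U) (gb : T -> V) :
  bijective e -> RI (p \o e) (ga \o e) (gb \o e) = RI p ga gb.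
Proof.
move=> be; rewrite /RI /Ifin !(Hf_bij _ _ be).
rewrite (Hf_bij _ (fun t => (ga t, gb t)) be); congr (_ - _)%E.
congr ereal_sup; apply/seteqP; split => _ [f [g [fg ->]]]; exists f, g; split.
- move=> t pt; case: be => e' _ e'K.
  by have := fg (e' t); rewrite /= e'K; apply.
- by rewrite -(Hf_bij _ (fun t => f (ga t)) be).
- by move=> s ps; exact: fg.
- by rewrite -(Hf_bij _ (fun t => f (ga t)) be).
Qed.

Lemma log2M (x y : R) : 0 < x -> 0 < y -> log2 (x * y) = log2 x + log2 y.
Proof. by move=> x0 y0; rewrite /log2 lnM// mulrDl. Qed.

Lemma log2V (x : R) : 0 < x -> log2 x^-1 = - log2 x.
Proof. by move=> x0; rewrite /log2 lnV// mulNr. Qed.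

(** [commonH] is a supremum that is subtracted, so any single admissible pair (f, g) gives an upper
    bound. *)
Lemma RI_le (T : finType) (U V : eqType) (p : T -> R) (ga : T -> U) (gb : T -> V)
    (f : U -> nat) (g : V -> nat) :
  (forall t, 0 <= p t) -> (forall t, 0 < p t -> f (ga t) = g (gb t)) ->
  (RI p ga gb <= (\sum_t p t * log2
     (push p (fun t => (ga t, gb t)) (ga t, gb t) *
      push p (fun t => f (ga t)) (f (ga t)) /
      (push p ga (ga t) * push p gb (gb t))))%:E)%E.
Proof.
move=> p0 fg.
apply: (@le_trans _ _ ((Ifin p ga gb)%:E - (Hf p (fun t => f (ga t)))%:E)%E).
  by apply: leeB => //; apply: ereal_sup_ubound; exists f, g.
rewrite -EFinB lee_fin /Ifin !Hf_push -big_split/= -!sumrB.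
apply: ler_sum => t _; have := p0 t; rewrite le_eqVlt => /predU1P[<-|pt].
  by rewrite !mul0r; lra.
have pp (W : eqType) (h : T -> W) : 0 < push p h (h t).
  by rewrite /push (bigD1 t)//= ltr_pwDl// sumr_ge0.
have lq (a b c d : R) : 0 < a -> 0 < b -> 0 < c -> 0 < d ->
    log2 (a * b / (c * d)) = log2 a + log2 b - log2 c - log2 d.
  move=> a0 b0 c0 d0; rewrite (@log2M (a * b)) ?invr_gt0 ?mulr_gt0//.
  by rewrite log2V ?mulr_gt0// !log2M//; lra.
rewrite lq// -!mulrDr -!mulrBr ler_pM2l//; lra.
Qed.

End FiniteEntropy.

Lemma rhs2_rhs1 (R : realType) (X Y Z : finType) (W : X -> Y -> Z -> R) :
  rhs2 W = rhs1 (fun y x z => W x y z).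
Proof.
pose e (t : Y * X * Z) : X * Y * Z := (t.1.2, t.1.1, t.2).
have be : bijective e by exists (fun t => (t.1.2, t.1.1, t.2)) => -[[? ?] ?].
have eJ pX pY : jointF (fun y x z => W x y z) pY pX = jointF W pX pY \o e.
  by apply/funext => -[[y x] z]; rewrite /jointF/= [pY y * _]mulrC.
have eRI pX pY : RI (jointF W pX pY) (@tX X Y Z) (@tZ X Y Z) =
    RI (jointF (fun y x z => W x y z) pY pX) (@tY Y X Z) (@tZ Y X Z).
  by rewrite eJ -(RI_bij _ _ _ be).
have eH pX pY : Hf (jointF W pX pY) id - Hf (jointF W pX pY) (@tX X Y Z) =
    Hf (jointF (fun y x z => W x y z) pY pX) id -
    Hf (jointF (fun y x z => W x y z) pY pX) (@tY Y X Z).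
  rewrite eJ -(Hf_bij _ (@tX X Y Z) be) -(Hf_bij _ id be); congr (_ - _).
  exact: (Hf_inj _ _ (bij_inj be)).
rewrite /rhs2 /rhs1; congr ereal_sup; apply/seteqP.
split => _ [pY [dY ->]]; exists pY; split => //; congr (ereal_sup _ + ereal_sup _)%E;
  apply/seteqP; split => _ [pX [dX ->]]; exists pX; split => //;
  by rewrite ?eRI ?eH.
Qed.

(** Only finite terms can be moved across an inequality of extended reals; in the application [B]
    consists of real conditional entropies. *)
Lemma le_ereal_supD (R : realType) (A B : set (\bar R)) (h : \bar R) :
  (forall b, B b -> b \is a fin_num) ->
  (forall a b, A a -> B b -> a + b <= h)%E -> (ereal_sup A + ereal_sup B <= h)%E.
Proof.
move=> Bf H.
have [->|/set0P[b0 Bb0]] := eqVneq B set0.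
  by rewrite ereal_sup0 addeNy leNye.
have supA b : B b -> (ereal_sup A <= h - b)%E.
  by move=> Bb; apply: ge_ereal_sup => a Aa; rewrite leeBrDr ?Bf//; exact: H.
case hE : h => [r| |]; last 2 first.
- by rewrite leey.
- have := supA _ Bb0; have := Bf _ Bb0; rewrite hE.
  by case: b0 {Bb0} => // b _; rewrite leeNy_eq => /eqP ->; rewrite addNye.
case sE : (ereal_sup A) => [s| |]; last 2 first.
- have := supA _ Bb0; have := Bf _ Bb0; rewrite sE hE.
  by case: b0 {Bb0}.
- by rewrite addNye leNye.
rewrite addeC -leeBrDr//; apply: ge_ereal_sup => b Bb.
by rewrite leeBrDr// addeC -leeBrDr ?Bf// -sE -hE; exact: supA.
Qed.

Section JointEntropies.
Variables (R : realType) (X Y Z : finType) (W : X -> Y -> Z -> R).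
Hypothesis W_ge0 : forall x y z, 0 <= W x y z.
Hypothesis W_sum : forall x y, \sum_(z : Z) W x y z = 1.
Variables (pX : X -> R) (pY : Y -> R).
Hypothesis dX : fullDist pX.
Hypothesis dY : fullDist pY.

Let pX_ge0 x : 0 <= pX x. Proof. by case: dX => H _; exact: ltW. Qed.
Let pY_ge0 y : 0 <= pY y. Proof. by case: dY => H _; exact: ltW. Qed.
Let p := jointF W pX pY.

Lemma jointF_ge0 t : 0 <= p t.
Proof. by rewrite /p /jointF !mulr_ge0. Qed.

Lemma sum_triple (F : X -> Y -> Z -> R) :
  \sum_(t : X * Y * Z) F t.1.1 t.1.2 t.2 = \sum_x \sum_y \sum_z F x y z.
Proof.
rewrite -(pair_bigA _ (fun (xy : X * Y) z => F xy.1 xy.2 z))/=.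
by rewrite -(pair_bigA _ (fun x y => \sum_z F x y z)).
Qed.

Lemma push_Y (Q : pred Y) :
  \sum_(t | Q (tY t)) p t = \sum_(y | Q y) pY y.
Proof.
rewrite big_mkcond/= (sum_triple (fun x y z => if Q y then pX x * pY y * W x y z else 0)).
rewrite exchange_big/= [RHS]big_mkcond/=; apply: eq_bigr => y _.
case: (Q y); last by rewrite big1// => *; rewrite big1.
under eq_bigr do rewrite -big_distrr/= W_sum mulr1.
by rewrite -big_distrl/=; case: dX => _ ->; rewrite mul1r.
Qed.

Lemma push_YZ (Q : Y -> Z -> bool) :
  \sum_(t | Q (tY t) (tZ t)) p t = \sum_y \sum_(z | Q y z) pYZ W pX pY y z.
Proof.
rewrite big_mkcond/=
  (sum_triple (fun x y z => if Q y z then pX x * pY y * W x y z else 0)).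
rewrite exchange_big/=; apply: eq_bigr => y _.
rewrite exchange_big/= [RHS]big_mkcond/=; apply: eq_bigr => z _.
case: (Q y z); last by rewrite big1.
by rewrite /pYZ big_distrr/=; apply: eq_bigr => x _; ring.
Qed.

Lemma RI_le_c1 (f : Y -> nat) (g : Z -> nat) :
  (forall x y z, 0 < W x y z -> f y = g z) ->
  (RI p (@tY X Y Z) (@tZ X Y Z) <=
   ((\sum_x \sum_y \sum_z pX x * pY y * W x y z * c1 W pX pY f y z) / ln 2)%:E)%E.
Proof.
move=> fg; apply: (le_trans (RI_le (f := f) (g := g) _ _)) => [t|t|].
- exact: jointF_ge0.
- rewrite /p /jointF; case: t => -[x y] z /=; case: dX => pX0 _; case: dY => pY0 _.
  by rewrite pmulr_rgt0 ?mulr_gt0//; exact: fg.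
rewrite lee_fin -sum_triple big_distrl/=; apply: ler_sum => -[[x y] z] _ /=.
rewrite /push; set a := (X in log2 (X * _ / _)); set b := (X in log2 (_ * X / _)).
set c := (X in log2 (_ / (X * _))); set d := (X in log2 (_ / (_ * X))).
have -> : a = pYZ W pX pY y z.
  transitivity (\sum_(t | (tY t == y) && (tZ t == z)) p t).
    by apply: eq_bigl => t; rewrite xpair_eqE.
  rewrite (push_YZ (fun y' z' => (y' == y) && (z' == z))) (bigD1 y)//= eqxx/=.
  rewrite big_pred1_eq big1 ?addr0// => y' /negbTE ->.
  by rewrite big_pred0.
have -> : b = pQ pY f y by exact: (push_Y (fun y' => f y' == f y)).
have -> : c = pY y by rewrite /c (push_Y (fun y' => y' == y)) big_pred1_eq.
have -> : d = pZ W pX pY z.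
  rewrite /d (push_YZ (fun y' z' => z' == z)) /pZ; apply: eq_bigr => y' _.
  by rewrite big_pred1_eq.
by rewrite /p /jointF /= /c1 /log2 mulrA.
Qed.

Lemma Hf_id_Y :
  Hf p id - Hf p (@tY X Y Z) =
  (\sum_x \sum_y \sum_z pX x * pY y * W x y z * c2' W pX x y z) / ln 2.
Proof.
rewrite !Hf_push -sumrB -sum_triple big_distrl/=; apply: eq_bigr => -[[x y] z] _ /=.
have -> : push p id (x, y, z) = p (x, y, z) by rewrite /push big_pred1_eq.
have -> : push p (@tY X Y Z) y = pY y.
  by rewrite /push (push_Y (fun y' => y' == y)) big_pred1_eq.
rewrite /p /jointF /= /c2'; case: dX => pX0 _; case: dY => pY0 _.
have := W_ge0 x y z; rewrite le_eqVlt => /predU1P[<-|Wp]; first by rewrite mulr0 !mul0r subrr.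
rewrite (_ : pX x * pY y * W x y z = pX x * W x y z * pY y); last by ring.
rewrite log2M ?mulr_gt0// /log2; ring.
Qed.

End JointEntropies.

Lemma fullDist_Sum (R : realType) (T : finType) (p : T -> R) : fullDist p ->
  (\Sum_t (p t)%:E = 1)%E.
Proof.
by move=> [p0 p1]; rewrite Sum_fin ?sumEFin ?p1// => t; rewrite lee_fin ltW.
Qed.

(** The two inner suprema become two independent laws of Bob's input with a common [pX]; division by
    [ln 2] passes from nats to bits. *)
Lemma rhs1_le (R : realType) (X Y Z : finType) (W : X -> Y -> Z -> R)
    (f : Y -> nat) (g : Z -> nat) (h : \bar R) :
  (forall x y z, 0 <= W x y z) -> (forall x y, \sum_(z : Z) W x y z = 1) ->
  (forall x y z, 0 < W x y z -> f y = g z) ->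
  (forall pX pY1 pY2, fullDist pX -> fullDist pY1 -> fullDist pY2 ->
   (((\sum_x \sum_y \sum_z pX x * pY1 y * W x y z * c1 W pX pY1 f y z +
      \sum_x \sum_y \sum_z pX x * pY2 y * W x y z * c2' W pX x y z) / ln 2)%:E <= h)%E) ->
  (rhs1 W <= h)%E.
Proof.
move=> W0 W1 fg H; apply: ge_ereal_sup => _ [pX [dX ->]].
apply: le_ereal_supD => [_ [pY [dY ->]] //|_ _ [pY1 [dY1 ->]] [pY2 [dY2 ->]]].
apply: le_trans (H pX pY1 pY2 dX dY1 dY2).
rewrite mulrDl [X in (_ <= X)%E]EFinD; apply: leeD; first exact: RI_le_c1 fg.
by rewrite lee_fin -Hf_id_Y.
Qed.

(** * Histories and transcripts *)

Section Transcripts.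
Local Open Scope nat_scope.

Lemma trimT_rcons0 (s : seq msg) : trimT (rcons s [::]) = trimT s.
Proof.
rewrite /trimT rev_rcons size_rcons /= subSS -cats1 takel_cat//.
exact: leq_subr.
Qed.

Lemma trimT_rcons (s : seq msg) (m : msg) : m != [::] -> trimT (rcons s m) = rcons s m.
Proof. by move=> m0; rewrite /trimT rev_rcons /= m0 subn0 take_size. Qed.

(** The default value of [nth] is the empty word, which is exactly what trimming removes. *)
Lemma nth_trimT (s : seq msg) k : nth [::] (trimT s) k = nth [::] s k.
Proof.
elim/last_ind: s => // s m IH; have [->|m0] := eqVneq m [::]; last by rewrite trimT_rcons.
rewrite trimT_rcons0 IH nth_rcons; case: ltngtP => // ks.
  by rewrite nth_default// ltnW.
by rewrite nth_default// ks.
Qed.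

Lemma trimT_nseq (s : seq msg) k : trimT (s ++ nseq k [::]) = trimT s.
Proof.
elim: k => [|k IH]; first by rewrite cats0.
by rewrite -addn1 nseqD catA cats1 trimT_rcons0.
Qed.

Lemma mkseq_pad (s : seq msg) n : size s <= n ->
  mkseq (nth [::] s) n = s ++ nseq (n - size s) [::].
Proof.
move=> sn; apply: (@eq_from_nth _ [::]).
  by rewrite size_mkseq size_cat size_nseq subnKC.
move=> i; rewrite size_mkseq => ni; rewrite nth_mkseq// nth_cat.
by case: ltnP => // si; rewrite nth_nseq if_same nth_default.
Qed.

Lemma trimT_ext (s s' : seq msg) :
  (forall k, nth [::] s k = nth [::] s' k) -> trimT s = trimT s'.
Proof.
move=> ss'; pose n := maxn (size s) (size s').
rewrite -(trimT_nseq s (n - size s)) -(trimT_nseq s' (n - size s')).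
rewrite -!mkseq_pad ?leq_maxl ?leq_maxr//; congr trimT.
exact: eq_mkseq.
Qed.

End Transcripts.

Section Histories.
Local Open Scope nat_scope.
Variables (R : realType) (X Y Z : finType) (P : protocol R X Y Z).

Definition onl (l : link) (t : nat) : bool := link_eqb (lnk (sched P t)) l.

Lemma rounds_filter (h : seq msg) (p : pred nat) :
  [seq tm.2 | tm <- rounds h & p tm.1] =
  map (nth [::] h) (seq.filter p (iota 0 (size h))).
Proof.
have -> : rounds h = [seq (t, nth [::] h t) | t <- iota 0 (size h)].
  rewrite /rounds -{2}(mkseq_nth [::] h) /mkseq.
  by rewrite -{1}[iota _ _]map_id zip_map.
by rewrite filter_map -map_comp.
Qed.

Lemma linkhistE l h :
  linkhist P l h = map (nth [::] h) (seq.filter (onl l) (iota 0 (size h))).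
Proof. exact: rounds_filter. Qed.

Lemma viewE i h :
  view P i h = map (nth [::] h)
    (seq.filter (fun t => involved i (lnk (sched P t))) (iota 0 (size h))).
Proof. exact: (rounds_filter h (fun t => involved i (lnk (sched P t)))). Qed.

Lemma view_ext i h h' : size h = size h' ->
  (forall t, t < size h -> involved i (lnk (sched P t)) ->
     nth [::] h t = nth [::] h' t) -> view P i h = view P i h'.
Proof.
move=> sh E; rewrite !viewE -sh; apply/eq_in_map => t.
by rewrite mem_filter mem_iota => /andP[it] /= th; apply: E.
Qed.

Definition rank l t : nat := count (onl l) (iota 0 t).

(** The inverse of splitting a history by links: [rank] is the position of round t within its link,
    and beyond the end of a transcript the empty word is read. *)
Definition msgt (m : link -> seq msg) t : msg :=
  nth [::] (m (lnk (sched P t))) (rank (lnk (sched P t)) t).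

Definition hist m T : seq msg := mkseq (msgt m) T.

Lemma size_hist m T : size (hist m T) = T.
Proof. exact: size_mkseq. Qed.

Lemma nth_hist m T t : t < T -> nth [::] (hist m T) t = msgt m t.
Proof. exact: nth_mkseq. Qed.

Lemma take_hist m t T : t <= T -> take t (hist m T) = hist m t.
Proof.
move=> tT; apply: (@eq_from_nth _ [::]).
  by rewrite size_takel ?size_hist.
move=> i; rewrite size_takel ?size_hist// => it.
by rewrite nth_take// !nth_hist// (leq_trans it).
Qed.

Lemma histS m T : hist m T.+1 = rcons (hist m T) (msgt m T).
Proof. by rewrite /hist /mkseq -addn1 iotaD map_cat cats1. Qed.

Lemma linkhist_rcons l h x : linkhist P l (rcons h x) =
  if onl l (size h) then rcons (linkhist P l h) x else linkhist P l h.
Proof.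
have E : map (nth [::] (rcons h x)) (seq.filter (onl l) (iota 0 (size h))) =
    map (nth [::] h) (seq.filter (onl l) (iota 0 (size h))).
  apply/eq_in_map => t; rewrite mem_filter mem_iota => /andP[_] /= th.
  by rewrite nth_rcons th.
rewrite !linkhistE size_rcons -addn1 iotaD filter_cat map_cat E /= add0n.
case: ifP => _ /=; last by rewrite cats0.
by rewrite nth_rcons ltnn eqxx cats1.
Qed.

Lemma onl_lnk t : onl (lnk (sched P t)) t.
Proof. by rewrite /onl; case: (lnk _). Qed.

Lemma onlP l t : onl l t -> lnk (sched P t) = l.
Proof. by rewrite /onl; case: (lnk _); case: l. Qed.

Lemma rankS l t : rank l t.+1 = rank l t + onl l t.
Proof. by rewrite /rank -addn1 iotaD count_cat /= addn0 add0n. Qed.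

Lemma linkhist_hist l m T :
  linkhist P l (hist m T) = mkseq (nth [::] (m l)) (rank l T).
Proof.
elim: T => [|T IH]; first by rewrite linkhistE.
rewrite histS linkhist_rcons size_hist IH rankS.
case: ifP => oT; last by rewrite addn0.
by rewrite addn1 /mkseq -[in RHS]addn1 iotaD map_cat cats1 /msgt (onlP oT).
Qed.

Lemma size_linkhist l h : size (linkhist P l h) = rank l (size h).
Proof. by rewrite linkhistE size_map size_filter. Qed.

Lemma nth_linkhist h t :
  nth [::] (linkhist P (lnk (sched P t)) h) (rank (lnk (sched P t)) t) = nth [::] h t.
Proof.
set l := lnk _; have [th|ht] := ltnP t (size h); last first.
  rewrite !nth_default// size_linkhist /rank -(subnKC ht) iotaD count_cat.
  exact: leq_addr.
rewrite linkhistE -(subnKC th) addSn -addnS iotaD filter_cat map_cat /= add0n.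
rewrite onl_lnk /= nth_cat size_map size_filter ltnn subnn /=; congr nth.
Qed.

Lemma msgt_Mtrans h t : msgt (fun l => Mtrans P l h) t = nth [::] h t.
Proof. by rewrite /msgt /Mtrans nth_trimT nth_linkhist. Qed.

Lemma hist_Mtrans h T : size h <= T ->
  hist (fun l => Mtrans P l h) T = h ++ nseq (T - size h) [::].
Proof.
by move=> hT; rewrite -mkseq_pad//; apply: eq_mkseq => t; rewrite msgt_Mtrans.
Qed.

Lemma msgt_ext m m' t : m (lnk (sched P t)) = m' (lnk (sched P t)) ->
  msgt m t = msgt m' t.
Proof. by rewrite /msgt => ->. Qed.

Lemma trimT_linkhist_hist l m h T : m l = Mtrans P l h -> size h <= T ->
  trimT (linkhist P l (hist m T)) = m l.
Proof.
move=> ml hT; rewrite linkhist_hist ml /Mtrans; apply: trimT_ext => k.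
have [kT|Tk] := ltnP k (rank l T); first by rewrite nth_mkseq// nth_trimT.
rewrite !nth_default ?size_mkseq// size_linkhist; apply: leq_trans Tk.
by rewrite /rank -(subnKC hT) iotaD count_cat leq_addr.
Qed.

(** Up to padding by empty words both histories are read off the same transcripts, so the shorter is
    a prefix of the longer; minimality excludes a proper terminal prefix. *)
Lemma Mtrans_inj h h' : min_terminal P h -> min_terminal P h' ->
  (forall l, Mtrans P l h = Mtrans P l h') -> h = h'.
Proof.
wlog hh' : h h' / size h <= size h'.
  move=> W mh mh' E; case/orP: (leq_total (size h) (size h')) => s.
    exact: W.
  by apply/esym; apply: W.
move=> [th _] [th' mh'] E.
have Nth t : nth [::] h t = nth [::] h' t.
  by rewrite -!msgt_Mtrans; apply: msgt_ext.
have hE : h = take (size h) h'.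
  apply: (@eq_from_nth _ [::]); first by rewrite size_takel.
  by move=> i ih; rewrite nth_take.
have [hl|] := ltnP (size h) (size h'); first by case: (mh' _ hl); rewrite -hE.
by move=> h'h; rewrite hE take_oversize.
Qed.

Lemma linkhist_nseq l h k : exists j,
  linkhist P l (h ++ nseq k [::]) = linkhist P l h ++ nseq j [::].
Proof.
elim: k => [|k [j IH]]; first by exists 0%N; rewrite !cats0.
rewrite -addn1 nseqD catA cats1 linkhist_rcons IH.
case: ifP => _; last by exists j.
by exists j.+1; rewrite -[j.+1]addn1 nseqD catA cats1.
Qed.

End Histories.

(** * Kernels and strategies *)

Import numFieldNormedType.Exports.

Definition dir_eqb (d d' : dir) : bool :=
  match d, d' with
  | d12, d12 | d21, d21 | d23, d23 | d32, d32 | d31, d31 | d13, d13 => true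
  | _, _ => false end.

Lemma dir_eqbP d d' : reflect (d = d') (dir_eqb d d').
Proof. by case: d; case: d'; constructor. Qed.

Section Kernels.
Variables (R : realType) (X Y Z : finType) (P : protocol R X Y Z).
Implicit Types (k q : seq msg -> msg -> R) (m : link -> seq msg).

(** A total below 1 is allowed because [clip] and [strat] have zero rows; the bound concerns only
    rounds with direction [d]. *)
Definition substoch k d : Prop := (forall h x, 0 <= k h x) /\
  (forall h, sched P (size h) = d -> (\Sum_x (k h x)%:E <= 1)%E).

Definition Fac k d T m : R :=
  \prod_(t < T) (if dir_eqb (sched P t) d then k (hist P m t) (msgt P m t) else 1).

(** A trimmed transcript does not record the length of the run, so the weight is taken over all
    rounds; it is a limit of nonincreasing products. *)
Definition G k d m : R := limn (fun T => Fac k d T m).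

Lemma FacS k d T m : Fac k d T.+1 m = Fac k d T m *
  (if dir_eqb (sched P T) d then k (hist P m T) (msgt P m T) else 1).
Proof. by rewrite /Fac big_ord_recr. Qed.

Lemma Fac_ge0 k d T m : substoch k d -> 0 <= Fac k d T m.
Proof. by move=> [k0 _]; apply: prodr_ge0 => t _; case: ifP. Qed.

Lemma Fac_noninc k d m : substoch k d -> nonincreasing_seq (fun T => Fac k d T m).
Proof.
move=> kd; apply/nonincreasing_seqP => T; rewrite FacS -[leRHS]mulr1.
apply: ler_wpM2l; first exact: Fac_ge0.
case: kd => k0 k1; case: dir_eqbP => // dT; rewrite -lee_fin.
apply: le_trans (k1 (hist P m T) _); last by rewrite size_hist.
by apply: (Sum_ub (f := fun x => (k (hist P m T) x)%:E)) => x; rewrite lee_fin.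
Qed.

Lemma Fac_cvg k d m : substoch k d -> cvgn (fun T => Fac k d T m).
Proof.
move=> kd; apply: nonincreasing_is_cvgn; first exact: Fac_noninc.
by exists 0 => _ [T _ <-]; exact: Fac_ge0.
Qed.

Lemma G_le_Fac k d T m : substoch k d -> G k d m <= Fac k d T m.
Proof.
by move=> kd; apply: (nonincreasing_cvgn_ge (Fac_noninc m kd) (Fac_cvg kd)).
Qed.

Lemma G_ge0 k d m : substoch k d -> 0 <= G k d m.
Proof.
move=> kd; apply: limr_ge; first exact: Fac_cvg.
by apply: nearW => T; exact: Fac_ge0.
Qed.

Lemma G_ext k d m m' :
  (forall t, sched P t = d ->
    k (hist P m t) (msgt P m t) = k (hist P m' t) (msgt P m' t)) ->
  G k d m = G k d m'.
Proof.
move=> E; congr (limn _); apply/funext => T; apply: eq_bigr => t _.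
by case: dir_eqbP => // /E.
Qed.

(** The six directions are grouped by sender, which yields the weights of Alice, Bob and Charlie. *)
Definition sum6 (c : dir -> seq msg -> msg -> R) T m : R :=
  Fac (c d12) d12 T m * Fac (c d13) d13 T m * (Fac (c d21) d21 T m * Fac (c d23) d23 T m)
  * (Fac (c d31) d31 T m * Fac (c d32) d32 T m).

Lemma sum6E (c : dir -> seq msg -> msg -> R) T m :
  \prod_(t < T) c (sched P t) (hist P m t) (msgt P m t) = sum6 c T m.
Proof.
elim: T => [|T IH]; first by rewrite /sum6 /Fac !big_ord0 !mulr1.
rewrite big_ord_recr/= IH /sum6 !FacS; case: (sched P T) => /=; ring.
Qed.

Definition pathw q (h : seq msg) : R :=
  \prod_(t < size h) q (take t h) (nth [::] h t).

Lemma pathw_rcons q h x : pathw q (rcons h x) = pathw q h * q h x.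
Proof.
rewrite /pathw size_rcons big_ord_recr/= nth_rcons ltnn eqxx -cats1 take_size_cat//.
congr (_ * _); apply: eq_bigr => t _; rewrite nth_cat ltn_ord takel_cat//.
exact: ltnW.
Qed.

Lemma pathw_ge0 q h : (forall h x, 0 <= q h x) -> 0 <= pathw q h.
Proof. by move=> q0; apply: prodr_ge0. Qed.

Lemma pathw_mass q T : (forall h x, 0 <= q h x) ->
  (forall h, \Sum_x (q h x)%:E <= 1)%E ->
  (\esum_(h in [set h | size h = T]) (pathw q h)%:E <= 1)%E.
Proof.
move=> q0 q1; elim: T => [|T IH].
  rewrite (_ : [set h | size h = 0%N] = [set [::]]); last first.
    by apply/seteqP; split => [h /size0nil|h ->].
  by rewrite esum_set1 ?lee_fin /pathw big_ord0.
rewrite (reindex_esum ([set h | size h = T] `*` [set: msg]) _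
  (fun hx => rcons hx.1 hx.2)); last first.
  split.
  - by move=> [h x] [/= hT _]; rewrite size_rcons hT.
  - by move=> [h x] [h' x'] _ _ /= /rcons_inj[-> ->].
  - move=> h /= hT; case/lastP: h hT => // h x; rewrite size_rcons => -[hT].
    by exists (h, x).
have -> : \esum_(i in [set h | size h = T] `*` [set: msg])
    (pathw q (rcons i.1 i.2))%:E =
    \esum_(h in [set h | size h = T]) (\Sum_x (pathw q h * q h x)%:E)%E.
  rewrite (@esum_esum _ _ _ [set h | size h = T] (fun=> [set: msg])); last first.
    by move=> *; rewrite lee_fin mulr_ge0// pathw_ge0.
  by apply: eq_esum => -[h x] _; rewrite pathw_rcons.
apply: le_trans IH; apply: le_esum => h _; rewrite SumrZl ?pathw_ge0//.
by rewrite -[leRHS]mule1; apply: lee_wpmul2l; rewrite ?lee_fin ?pathw_ge0.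
Qed.

(** Excludes sequences that end with an empty word or are too long for the schedule; a history built
    from such a sequence would not return it. Different links may use different witnesses. *)
Definition realizable l (u : seq msg) : Prop := exists h, u = Mtrans P l h.

Lemma realizable_hist (I : eqType) (em : I -> link -> seq msg) (s : seq I) :
  (forall i, i \in s -> forall l, realizable l (em i l)) ->
  exists T, forall i, i \in s -> forall l, trimT (linkhist P l (hist P (em i) T)) = em i l.
Proof.
have [h hE] : exists h : I -> link -> seq msg, forall i l,
    realizable l (em i l) -> em i l = Mtrans P l (h i l).
  suff /choice[h hP] : forall i, exists hi : link -> seq msg, forall l,
      realizable l (em i l) -> em i l = Mtrans P l (hi l) by exists h.
  move=> i; suff /choice[h hP] : forall l, exists h : seq msg,
      realizable l (em i l) -> em i l = Mtrans P l h by exists h.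
  move=> l; have [[h0 E]|nr] := pselect (realizable l (em i l)); first by exists h0.
  by exists [::] => /nr.
move=> rs.
exists (\max_(i <- s) (size (h i L12) + size (h i L23) + size (h i L31)))%N => i is_ l.
apply: (trimT_linkhist_hist (hE i l (rs i is_ l))).
apply: leq_trans (leq_bigmax_seq _ is_ _) => //.
by case: l; rewrite ?leq_addl// -addnA ?leq_addr// addnCA leq_addr.
Qed.

(** Finitely many realizable triples are told apart by their histories of one common length [T].
    There each [G] is at most the finite product [Fac], and the paths of length [T] have total
    weight at most 1. *)
Theorem G_mass (I : choiceType) (em : I -> link -> seq msg)
    (c : dir -> seq msg -> msg -> R) (w : I -> R) :
  (forall d, substoch (c d) d) ->
  (forall i j, (forall l, em i l = em j l) -> i = j) ->
  (forall i, w i <= G (c d12) d12 (em i) * G (c d13) d13 (em i) *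
    (G (c d21) d21 (em i) * G (c d23) d23 (em i)) *
    (G (c d31) d31 (em i) * G (c d32) d32 (em i))) ->
  (forall i, w i != 0 -> forall l, realizable l (em i l)) ->
  (\Sum_i (w i)%:E <= 1)%E.
Proof.
move=> cd inj wG wr; apply: Sum_le_finite => s us.
rewrite (bigID (fun i => w i != 0))/= [X in (_ + X)%E]big1 ?adde0; last first.
  by move=> i /negPn/eqP ->.
rewrite -big_filter; set s' := [seq i <- s | w i != 0].
have us' : uniq s' by rewrite filter_uniq.
have [|T TE] := @realizable_hist I em s'.
  by move=> i; rewrite mem_filter => /andP[wi _]; exact: wr.
pose q h x := c (sched P (size h)) h x.
have q0 h x : 0 <= q h x by case: (cd (sched P (size h))) => + _; apply.
have q1 h : (\Sum_x (q h x)%:E <= 1)%E.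
  by case: (cd (sched P (size h))) => _; apply.
have hinj : {in s' &, injective (fun i => hist P (em i) T)}.
  move=> i j si sj E; apply: inj => l; rewrite -(TE i si) -(TE j sj).
  by rewrite E.
apply: (@le_trans _ _ (\sum_(i <- s') (pathw q (hist P (em i) T))%:E)%E).
  apply: lee_sum => i _; rewrite lee_fin (le_trans (wG i))//.
  have -> : pathw q (hist P (em i) T) = sum6 c T (em i).
    rewrite -sum6E /pathw size_hist; apply: eq_bigr => t _.
    by rewrite (take_hist P (em i) (ltnW (ltn_ord t))) nth_hist// /q size_hist.
  have g0 d := G_ge0 (em i) (cd d).
  by rewrite /sum6; do !apply: ler_pM; rewrite ?mulr_ge0 ?G_le_Fac.
rewrite -(big_map (fun i => hist P (em i) T) xpredT (fun h => (pathw q h)%:E)).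
have uh : uniq [seq hist P (em i) T | i <- s'] by rewrite map_inj_in_uniq.
apply: le_trans (pathw_mass T q0 q1); apply: esum_ge.
exists [set` [seq hist P (em i) T | i <- s']].
  split; first exact: finite_seq.
  by move=> h /= /mapP[i _ ->]; rewrite size_hist.
by rewrite -fsbig_seq.
Qed.

End Kernels.

Section Strategies.
Variables (R : realType) (X Y Z : finType) (P : protocol R X Y Z).
Variables (l : link) (mu : seq msg -> R).
Hypothesis mu_ge0 : forall u, 0 <= mu u.
Hypothesis mu_le1 : (\Sum_u (mu u)%:E <= 1)%E.

(* Transcripts are trimmed, hence compared with [s] after padding with empty words. *)
Definition agree (s u : seq msg) : bool := mkseq (nth [::] u) (size s) == s.

Lemma agree_rcons s x u : agree (rcons s x) u = agree s u && (nth [::] u (size s) == x).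
Proof.
by rewrite /agree size_rcons /mkseq -addn1 iotaD map_cat /= cats1 eqseq_rcons.
Qed.

Definition gpre (s : seq msg) : R := rsum (fun u => mu u * (agree s u)%:R).

Lemma gpreE s : (\Sum_u (mu u * (agree s u)%:R)%:E = (gpre s)%:E)%E.
Proof.
apply: (@rsumE _ _ _ 1) => [u|]; first by rewrite mulr_ge0.
apply: le_trans mu_le1; apply: le_Sum => u; rewrite lee_fin -[leRHS]mulr1.
by apply: ler_wpM2l => //; case: (agree s u).
Qed.

Lemma gpre_ge0 s : 0 <= gpre s.
Proof. by apply: rsum_ge0 => u; rewrite mulr_ge0. Qed.

Lemma gpre_rcons s : (\Sum_x (gpre (rcons s x))%:E = (gpre s)%:E)%E.
Proof.
under eq_Sum do rewrite -gpreE.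
rewrite Sum_swap; last by move=> *; rewrite lee_fin mulr_ge0.
rewrite -gpreE; apply: eq_Sum => u.
rewrite -(@Sum_delta _ _ (fun=> mu u * (agree s u)%:R) (nth [::] u (size s))) ?mulr_ge0//.
apply: eq_Sum => x; rewrite agree_rcons.
by case: (agree s u); rewrite /= ?mulr1// mulr0 mul0r.
Qed.

Lemma gpre_le1 s : gpre s <= 1.
Proof.
rewrite -lee_fin -gpreE; apply: le_trans mu_le1; apply: le_Sum => u.
rewrite lee_fin -[leRHS]mulr1.
by apply: ler_wpM2l => //; case: (agree s u).
Qed.

(* The conditional law of the next message on the link [l], given the past of [l] alone. *)
Definition strat (h : seq msg) (x : msg) : R :=
  gpre (rcons (linkhist P l h) x) / gpre (linkhist P l h).

Lemma strat_substoch d : substoch P strat d.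
Proof.
split=> [h x|h _]; first by rewrite divr_ge0 ?gpre_ge0.
rewrite SumrZr ?invr_ge0 ?gpre_ge0//; last by move=> ?; exact: gpre_ge0.
rewrite gpre_rcons -EFinM lee_fin.
have [->|g0] := eqVneq (gpre (linkhist P l h)) 0; first by rewrite mul0r.
by rewrite divff.
Qed.

Lemma agree_hist (m : link -> seq msg) T : agree (linkhist P l (hist P m T)) (m l).
Proof. by rewrite /agree linkhist_hist size_mkseq. Qed.

Lemma gpre_hist_ge (m : link -> seq msg) T : mu (m l) <= gpre (linkhist P l (hist P m T)).
Proof.
rewrite -lee_fin -gpreE; apply: le_trans (Sum_ub (f := fun u =>
  (mu u * (agree (linkhist P l (hist P m T)) u)%:R)%:E) (m l) _).
  by rewrite agree_hist mulr1.
by move=> u; rewrite lee_fin mulr_ge0.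
Qed.

Variables d d' : dir.
Hypothesis dd' : forall e, link_eqb (lnk e) l = dir_eqb e d || dir_eqb e d'.
Hypothesis dNd' : ~~ dir_eqb d d'.

(** Each round on the link is sent in direction [d] or [d'], and when both ends play [strat] the
    conditional laws telescope. *)
Lemma Fac_strat (m : link -> seq msg) T : 0 < mu (m l) ->
  Fac P strat d T m * Fac P strat d' T m * gpre [::] = gpre (linkhist P l (hist P m T)).
Proof.
move=> mum; have gp T' : gpre (linkhist P l (hist P m T')) != 0.
  by rewrite gt_eqF// (lt_le_trans mum)// gpre_hist_ge.
elim: T => [|T IH]; first by rewrite /Fac !big_ord0 !mul1r linkhistE.
rewrite !FacS histS linkhist_rcons size_hist /onl dd'.
have strE : strat (hist P m T) (msgt P m T) * gpre (linkhist P l (hist P m T)) =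
    gpre (rcons (linkhist P l (hist P m T)) (msgt P m T)).
  by rewrite /strat mulfVK.
case: dir_eqbP => [ed|_]; case: dir_eqbP => [ed'|_] /=.
- by move: dNd'; rewrite -ed -ed'; case: (sched P T).
- by rewrite -strE -IH; ring.
- by rewrite -strE -IH; ring.
- by rewrite !mulr1.
Qed.

(** A prefix has at least the mass of the whole transcript, and [gpre [::]] is at most 1. Thus the
    law of a single link is dominated by a product of one strategy per end. *)
Lemma G_strat (m : link -> seq msg) : mu (m l) <= G P strat d m * G P strat d' m.
Proof.
have sd := strat_substoch d; have sd' := strat_substoch d'.
have := mu_ge0 (m l); rewrite le_eqVlt => /predU1P[<-|mum].
  by rewrite mulr_ge0 ?G_ge0.
have cv : (fun T => Fac P strat d T m * Fac P strat d' T m) @ \oo -->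
    G P strat d m * G P strat d' m by apply: cvgM; exact: Fac_cvg.
rewrite -(cvg_lim (@Rhausdorff R) cv); apply: limr_ge; first exact: (cvgP _ cv).
apply: nearW => T /=; apply: le_trans (gpre_hist_ge m T) _.
rewrite -(Fac_strat T mum) -[leRHS]mulr1; apply: ler_wpM2l (gpre_le1 _).
by rewrite mulr_ge0 ?Fac_ge0.
Qed.

End Strategies.

Lemma G_strat_ext (R : realType) (X Y Z : finType) (P : protocol R X Y Z) l mu d
    (m m' : link -> seq msg) : lnk d = l -> m l = m' l ->
  G P (strat P l mu) d m = G P (strat P l mu) d m'.
Proof.
move=> dl ml; apply: G_ext => t td.
by rewrite /strat !linkhist_hist ml (@msgt_ext _ _ _ _ _ m m')// td dl.
Qed.

Section Clip.
Variables (R : realType) (X Y Z : finType) (P : protocol R X Y Z).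
Variables (i : party) (kk : nat -> seq msg -> msg -> R) (Q : seq msg -> Prop).
Hypothesis Q_kk : forall h, Q h -> sender (sched P (size h)) = i ->
  (forall x, 0 <= kk (size h) (view P i h) x) /\
  (\Sum_x (kk (size h) (view P i h) x)%:E = 1)%E.

(* Off the views of party [i] reachable with positive probability the kernel [kk]
   is unconstrained, possibly negative: there it is replaced by 0. *)
Definition clip (h : seq msg) (x : msg) : R :=
  if `[< sender (sched P (size h)) = i /\
         exists h', [/\ Q h', size h' = size h & view P i h' = view P i h] >]
  then kk (size h) (view P i h) x else 0.

Lemma clip_substoch d : substoch P clip d.
Proof.
split=> [h x|h _]; rewrite /clip; case: asboolP => [[si [h' [Qh' sh vh]]]|_].
- by case: (Q_kk Qh'); rewrite ?sh// vh => + _; apply.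
- by [].
- by case: (Q_kk Qh'); rewrite ?sh// vh => _ ->.
- by rewrite Sum0 ?lee_fin.
Qed.

Lemma clipE h x : Q h -> sender (sched P (size h)) = i ->
  clip h x = kk (size h) (view P i h) x.
Proof. by move=> Qh si; rewrite /clip asboolT//; split => //; exists h. Qed.

Lemma view_hist_ext (m m' : link -> seq msg) t :
  (forall l, involved i l -> m l = m' l) ->
  view P i (hist P m t) = view P i (hist P m' t).
Proof.
move=> E; apply: view_ext => [|s]; rewrite !size_hist// => st il.
by rewrite !nth_hist//; apply: msgt_ext; exact: E.
Qed.

(** A clipped kernel sees only the party's view, so its weight ignores the third link. *)
Lemma G_clip_ext d (m m' : link -> seq msg) : involved i (lnk d) ->
  (forall l, involved i l -> m l = m' l) -> G P clip d m = G P clip d m'.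
Proof.
move=> il E; apply: G_ext => t td.
rewrite /clip !size_hist (view_hist_ext t E) (@msgt_ext _ _ _ _ _ m m')// td.
exact: E.
Qed.

End Clip.

Definition tr (u n v : seq msg) (l : link) : seq msg :=
  match l with L12 => u | L23 => n | L31 => v end.

Section Factorization.
Variables (R : realType) (X Y Z : finType) (P : protocol R X Y Z).
Hypothesis P_valid : valid_protocol P.

Lemma histP_rcons x y h m : histP P x y (rcons h m) = histP P x y h * stepP P x y h m.
Proof. exact: (pathw_rcons (stepP P x y)). Qed.

Lemma histP_nil x y : histP P x y [::] = 1.
Proof. by rewrite /histP big_ord0. Qed.

Lemma stepP_ge0 x y h m : 0 < histP P x y h -> 0 <= stepP P x y h m.
Proof. by move=> hh; case: P_valid => _ [/(_ x y h hh)[+ _] _]; apply. Qed.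

Lemma stepP_sum x y h : 0 < histP P x y h -> (\Sum_m (stepP P x y h m)%:E = 1)%E.
Proof. by move=> hh; case: P_valid => _ [/(_ x y h hh)[_ [_ +]] _]. Qed.

Lemma stepP_code x y h m : 0 < histP P x y h -> 0 < stepP P x y h m ->
  Defs.code P (lnk (sched P (size h))) (linkhist P (lnk (sched P (size h))) h) m.
Proof. by move=> hh; case: P_valid => _ [/(_ x y h hh)[_ [+ _]] _]; apply. Qed.

Lemma histP_ge0 x y h : 0 <= histP P x y h.
Proof.
elim/last_ind: h => [|h m IH]; first by rewrite histP_nil ler01.
rewrite histP_rcons; move: IH; rewrite le_eqVlt => /predU1P[<-|hh].
  by rewrite mul0r.
by rewrite mulr_ge0 ?stepP_ge0 ?ltW.
Qed.

(* An empty codeword is the only codeword of its prefix-free code, hence is sent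
   with probability 1. *)
Lemma histP_done x y h k : terminal P h ->
  histP P x y (h ++ nseq k [::]) = histP P x y h.
Proof.
move=> th; elim: k => [|k IH]; first by rewrite cats0.
rewrite -addn1 nseqD catA cats1 histP_rcons IH.
have := histP_ge0 x y h; rewrite le_eqVlt => /predU1P[<-|hh]; first by rewrite mul0r.
have hk : 0 < histP P x y (h ++ nseq k [::]) by rewrite IH.
have := stepP_sum hk; rewrite (@Sum_one _ _ _ [::]).
- by case=> ->; rewrite mulr1.
- by rewrite lee_fin stepP_ge0.
move=> m m0; congr EFin; apply/eqP; rewrite eq_le stepP_ge0// andbT leNgt.
apply/negP => /(stepP_code hk).
have [j ->] := linkhist_nseq P (lnk (sched P (size (h ++ nseq k [::])))) h k.
move=> cm; case: P_valid => pf _; move/eqP: m0; apply.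
by apply/esym; apply: (pf _ _ [::] m (th _ j) cm); rewrite prefix0s.
Qed.

Let QA x h := exists y, 0 < histP P x y h.
Let QB y h := exists x, 0 < histP P x y h.
Let QC h := exists x y, 0 < histP P x y h.

Lemma QA_kk x h : QA x h -> sender (sched P (size h)) = Alice ->
  (forall m, 0 <= kA P (size h) x (view P Alice h) m) /\
  (\Sum_m (kA P (size h) x (view P Alice h) m)%:E = 1)%E.
Proof.
move=> [y hh] s; have := stepP_sum hh; have := fun m => stepP_ge0 m hh.
by rewrite /stepP s.
Qed.

Lemma QB_kk y h : QB y h -> sender (sched P (size h)) = Bob ->
  (forall m, 0 <= kB P (size h) y (view P Bob h) m) /\
  (\Sum_m (kB P (size h) y (view P Bob h) m)%:E = 1)%E.
Proof.
move=> [x hh] s; have := stepP_sum hh; have := fun m => stepP_ge0 m hh.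
by rewrite /stepP s.
Qed.

Lemma QC_kk h : QC h -> sender (sched P (size h)) = Charlie ->
  (forall m, 0 <= kC P (size h) (view P Charlie h) m) /\
  (\Sum_m (kC P (size h) (view P Charlie h) m)%:E = 1)%E.
Proof.
move=> [x [y hh]] s; have := stepP_sum hh; have := fun m => stepP_ge0 m hh.
by rewrite /stepP s.
Qed.

Definition sA x := clip P Alice (fun t => kA P t x) (QA x).
Definition sB y := clip P Bob (fun t => kB P t y) (QB y).
Definition sC := clip P Charlie (kC P) QC.

Lemma sA_substoch x d : substoch P (sA x) d.
Proof. by apply: clip_substoch; exact: QA_kk. Qed.
Lemma sB_substoch y d : substoch P (sB y) d.
Proof. by apply: clip_substoch; exact: QB_kk. Qed.
Lemma sC_substoch d : substoch P sC d.
Proof. by apply: clip_substoch; exact: QC_kk. Qed.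

Definition tab x y (d : dir) : seq msg -> msg -> R :=
  match sender d with Alice => sA x | Bob => sB y | Charlie => sC end.

Lemma tab_substoch x y d d' : substoch P (tab x y d) d'.
Proof.
by rewrite /tab; case: (sender d);
  [exact: sA_substoch|exact: sB_substoch|exact: sC_substoch].
Qed.

Lemma stepP_tab x y h m : 0 < histP P x y h ->
  stepP P x y h m = tab x y (sched P (size h)) h m.
Proof.
move=> hh; rewrite /stepP /tab; case s : (sender _).
- by rewrite /sA clipE//; exists y.
- by rewrite /sB clipE//; exists x.
- by rewrite /sC clipE//; exists x, y.
Qed.

Lemma histP_sum6 x y (m : link -> seq msg) T :
  histP P x y (hist P m T) = sum6 P (tab x y) T m.
Proof.
rewrite -sum6E; elim: T => [|T IH]; first by rewrite histP_nil big_ord0.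
rewrite histS histP_rcons big_ord_recr/= -IH.
have := histP_ge0 x y (hist P m T); rewrite le_eqVlt => /predU1P[<-|hh].
  by rewrite !mul0r.
by rewrite (stepP_tab _ hh) size_hist.
Qed.

(** The empty transcript stands in for the link that the party does not see; by [AfE] any other
    choice gives the same value. *)
Definition Af x u v : R :=
  G P (sA x) d12 (tr u [::] v) * G P (sA x) d13 (tr u [::] v).
Definition Bf y u n : R :=
  G P (sB y) d21 (tr u n [::]) * G P (sB y) d23 (tr u n [::]).
Definition Cf v n : R :=
  G P sC d31 (tr [::] n v) * G P sC d32 (tr [::] n v).

Lemma AfE x u n v : Af x u v = G P (sA x) d12 (tr u n v) * G P (sA x) d13 (tr u n v).
Proof. by congr (_ * _); apply: G_clip_ext => // -[]. Qed.
Lemma BfE y u n v : Bf y u n = G P (sB y) d21 (tr u n v) * G P (sB y) d23 (tr u n v).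
Proof. by congr (_ * _); apply: G_clip_ext => // -[]. Qed.
Lemma CfE u n v : Cf v n = G P sC d31 (tr u n v) * G P sC d32 (tr u n v).
Proof. by congr (_ * _); apply: G_clip_ext => // -[]. Qed.

Lemma Af_ge0 x u v : 0 <= Af x u v.
Proof. by rewrite mulr_ge0// G_ge0//; exact: sA_substoch. Qed.
Lemma Bf_ge0 y u n : 0 <= Bf y u n.
Proof. by rewrite mulr_ge0// G_ge0//; exact: sB_substoch. Qed.
Lemma Cf_ge0 v n : 0 <= Cf v n.
Proof. by rewrite mulr_ge0// G_ge0//; exact: sC_substoch. Qed.

Lemma sum6_cvg (c : dir -> seq msg -> msg -> R) m : (forall d, substoch P (c d) d) ->
  sum6 P c T m @[T --> \oo] --> G P (c d12) d12 m * G P (c d13) d13 m *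
    (G P (c d21) d21 m * G P (c d23) d23 m) * (G P (c d31) d31 m * G P (c d32) d32 m).
Proof.
by move=> cd; do 2?apply: cvgM; do ?apply: cvgM; apply: Fac_cvg.
Qed.

(** After the end of a terminal history the forced empty words have probability 1. The finite
    products are therefore eventually constant, and their limit splits by sender. *)
Lemma histP_factor x y h : terminal P h ->
  histP P x y h = Af x (Mtrans P L12 h) (Mtrans P L31 h) *
    Bf y (Mtrans P L12 h) (Mtrans P L23 h) * Cf (Mtrans P L31 h) (Mtrans P L23 h).
Proof.
move=> th; set u := Mtrans P L12 h; set n := Mtrans P L23 h; set v := Mtrans P L31 h.
rewrite (AfE x u n v) (BfE y u n v) (CfE u n v).
have := @sum6_cvg (tab x y) (tr u n v) (fun d => tab_substoch x y d d).
move/(cvg_lim (@Rhausdorff R)) => <-; apply/esym/cvg_lim; first exact: Rhausdorff.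
apply: cvg_near_cst; exists (size h) => // T /= hT; rewrite -histP_sum6.
have -> : hist P (tr u n v) T = hist P (fun l => Mtrans P l h) T.
  by apply: eq_mkseq => t; apply: msgt_ext; case: (lnk _).
by rewrite hist_Mtrans// histP_done.
Qed.

Definition hset (u n v : seq msg) : set (seq msg) :=
  [set h | min_terminal P h /\ Mtrans P L12 h = u /\ Mtrans P L23 h = n /\
           Mtrans P L31 h = v].

Definition Kf x y u v n : R := fine (\esum_(h in hset u n v) (histP P x y h)%:E).

Lemma hset_cases u n v : hset u n v = set0 \/
  exists2 h, hset u n v h & hset u n v = [set h].
Proof.
have [[h hh]|nh] := pselect (exists h, hset u n v h); last first.
  by left; apply/seteqP; split => // h hh; apply: nh; exists h.
right; exists h => //; apply/seteqP; split => [h' hh' /=|h' ->//].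
case: hh => mh [hu [hn hv]]; case: hh' => mh' [hu' [hn' hv']].
by apply: Mtrans_inj mh' mh _ => -[]; rewrite ?hu ?hn ?hv.
Qed.

Lemma KfE x y u v n : (\esum_(h in hset u n v) (histP P x y h)%:E = (Kf x y u v n)%:E)%E.
Proof.
rewrite /Kf; case: (hset_cases u n v) => [->|[h _ ->]]; first by rewrite esum_set0.
by rewrite esum_set1 ?lee_fin ?histP_ge0.
Qed.

Lemma Kf_ge0 x y u v n : 0 <= Kf x y u v n.
Proof.
by rewrite -lee_fin -KfE; apply: esum_ge0 => h _; rewrite lee_fin histP_ge0.
Qed.

Lemma Kf_gt0 x y u v n : 0 < Kf x y u v n ->
  exists h, hset u n v h /\ forall x' y', Kf x' y' u v n = histP P x' y' h.
Proof.
case: (hset_cases u n v) => [E|[h hh E]].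
  by rewrite -lte_fin -KfE E esum_set0 ltxx.
move=> _; exists h; split => // x' y'; apply: EFin_inj; rewrite -KfE E.
by rewrite esum_set1 ?lee_fin ?histP_ge0.
Qed.

(** Whether a triple comes from a minimal terminal history does not depend on the inputs, so
    positivity at one input pair gives the factorization at all pairs. *)
Lemma Kf_factor x y u v n : 0 < Kf x y u v n ->
  forall x' y', Kf x' y' u v n = Af x' u v * Bf y' u n * Cf v n.
Proof.
move=> /Kf_gt0[h [[[th _] [hu [hn hv]]] E]] x' y'.
by rewrite E histP_factor// hu hn hv.
Qed.

Lemma Kf_realizable x y u v n : 0 < Kf x y u v n ->
  [/\ realizable P L12 u, realizable P L31 v & realizable P L23 n].
Proof.
by move=> /Kf_gt0[h [[_ [hu [hn hv]]] _]]; split; exists h.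
Qed.

Lemma Kf_reindex x y (g : seq msg -> seq msg -> seq msg -> R) :
  (forall u v n, 0 <= g u v n) ->
  (\Sum_u \Sum_v \Sum_n (Kf x y u v n * g u v n)%:E =
  \esum_(h in [set h | min_terminal P h]) (histP P x y h *
     g (Mtrans P L12 h) (Mtrans P L31 h) (Mtrans P L23 h))%:E)%E.
Proof.
move=> g0.
transitivity (\Sum_u \Sum_v \Sum_n \esum_(h in hset u n v) (histP P x y h *
     g (Mtrans P L12 h) (Mtrans P L31 h) (Mtrans P L23 h))%:E)%E.
  apply: eq_Sum => u; apply: eq_Sum => v; apply: eq_Sum => n; rewrite EFinM -KfE.
  case: (hset_cases u n v) => [->|[h [_ [<- [<- <-]]] ->]].
    by rewrite !esum_set0 mul0e.
  by rewrite !esum_set1 ?lee_fin ?mulr_ge0 ?histP_ge0.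
under eq_Sum do under eq_Sum do under eq_Sum do rewrite esum_mkcond.
rewrite Sum_swap31; last first.
  by move=> *; case: ifP => //; rewrite lee_fin mulr_ge0// histP_ge0.
rewrite [RHS]esum_mkcond; apply: eq_Sum => h.
set u := Mtrans P L12 h; set v := Mtrans P L31 h; set n := Mtrans P L23 h.
have z u' v' n' : (u' != u) || (v' != v) || (n' != n) -> h \in hset u' n' v' = false.
  move=> ne; apply/negP; rewrite inE => -[_ [hu [hn hv]]]; move: ne.
  by rewrite -hu -hn -hv !eqxx.
have ge u' v' n' : (0 <= if h \in hset u' n' v' then (histP P x y h * g u v n)%:E else 0)%E.
  by case: ifP => //; rewrite lee_fin mulr_ge0// histP_ge0.
rewrite (@Sum_one _ _ _ u); last 2 first.
- by do 2!apply: Sum_ge0 => ?.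
- by move=> u' uu'; do 2!apply: Sum0 => ?; rewrite z ?uu'.
rewrite (@Sum_one _ _ _ v); last 2 first.
- by apply: Sum_ge0 => ?.
- by move=> v' vv'; apply: Sum0 => ?; rewrite z ?vv' ?orbT.
rewrite (@Sum_one _ _ _ n)//; last by move=> n' nn'; rewrite z ?nn' ?orbT.
have -> // : (h \in hset u n v) = (h \in [set h | min_terminal P h]).
by apply/idP/idP; rewrite !inE; [case|move=> mh; split].
Qed.

End Factorization.

(** * Consequences of security *)

Section Pivot.
Variables (R : realType) (X Y Z : finType) (U V N : choiceType).
Variables (K : X -> Y -> U -> V -> N -> R) (W : X -> Y -> Z -> R).
Variables (zeta : V -> N -> Z).
Variables (kap : X -> U -> V -> R) (lam : Y -> U -> N -> R).
Variables (ThN : Z -> N -> R) (ThV : Z -> V -> R).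
Hypothesis K_ge0 : forall x y u v n, 0 <= K x y u v n.
Hypothesis W_ge0 : forall x y z, 0 <= W x y z.
Hypothesis W_sum : forall x y, \sum_(z : Z) W x y z = 1.
Hypothesis kap_ge0 : forall x u v, 0 <= kap x u v.
Hypothesis lam_ge0 : forall y u n, 0 <= lam y u n.
Local Open Scope ereal_scope.
Hypothesis K_kap : forall x y u v z,
  \Sum_n (K x y u v n * (zeta v n == z)%:R)%:E = (kap x u v * W x y z)%:E.
Hypothesis K_lam : forall x y u n z,
  \Sum_v (K x y u v n * (zeta v n == z)%:R)%:E = (lam y u n * W x y z)%:E.
Hypothesis K_ThN : forall x y n z,
  \Sum_u \Sum_v (K x y u v n * (zeta v n == z)%:R)%:E = (ThN z n * W x y z)%:E.
Hypothesis K_ThV : forall x y v z,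
  \Sum_u \Sum_n (K x y u v n * (zeta v n == z)%:R)%:E = (ThV z v * W x y z)%:E.
Hypothesis K_sum : forall x y, \Sum_u \Sum_v \Sum_n (K x y u v n)%:E = 1.
Variables (x0 : X) (y0 : Y).
Variables (A : X -> U -> V -> R) (B : Y -> U -> N -> R) (C : V -> N -> R).
Hypothesis A_ge0 : forall x u v, (0 <= A x u v)%R.
Hypothesis B_ge0 : forall y u n, (0 <= B y u n)%R.
Hypothesis C_ge0 : forall v n, (0 <= C v n)%R.
Hypothesis K_fac : forall x y u v n, (0 < K x y u v n)%R ->
  forall x' y', K x' y' u v n = (A x' u v * B y' u n * C v n)%R.
Hypothesis W_sep : forall x x', (forall y z, W x y z = W x' y z) -> x = x'.
Hypothesis W_nopart : no_partition_X W.

(** By factorization, exchanging x and x' changes K only by the ratio of [A x u v] and [A x' u v],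
    whatever n is. With privacy this makes the rows of W at x and x' proportional; both sum to 1, so
    they are equal. *)
Lemma pivot_unique x x' y u v n :
  (0 < K x y u v n)%R -> (0 < K x' y u v n)%R -> x = x'.
Proof.
move=> Kx Kx'; apply: W_sep => y' z.
have cross n' : (A x' u v * K x y' u v n' = A x u v * K x' y' u v n')%R.
  have [[x1 [y1 K1]]|nK] := pselect (exists x1 y1, 0 < K x1 y1 u v n')%R.
    by rewrite !(K_fac K1); ring.
  have z1 x1 y1 : K x1 y1 u v n' = 0%R.
    apply/eqP; rewrite eq_le K_ge0 andbT leNgt; apply/negP => K1.
    by apply: nK; exists x1, y1.
  by rewrite !z1 !mulr0.
have kW z' : (A x' u v * (kap x u v * W x y' z') = A x u v * (kap x' u v * W x' y' z'))%R.
  apply: EFin_inj; rewrite !EFinM -![_%:E * (_%:E * _%:E)]/(_%:E * (_ * _)%:E).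
  rewrite -!K_kap -!SumrZl//; try by move=> ?; rewrite mulr_ge0.
  by apply: eq_Sum => n'; rewrite !mulrA cross.
(* Summing over z removes W and identifies the two constants of proportionality. *)
have kA : (A x' u v * kap x u v = A x u v * kap x' u v)%R.
  have : (\sum_z' A x' u v * (kap x u v * W x y' z') =
          \sum_z' A x u v * (kap x' u v * W x' y' z'))%R by apply: eq_bigr => z' _; exact: kW.
  by rewrite -!big_distrr/= !W_sum !mulr1.
have k0 : (0 < kap x' u v)%R.
  have := @K_le_kap _ _ _ _ _ _ _ _ _ _ _ K_ge0 K_kap x' y u v n.
  move=> /(lt_le_trans Kx'); apply: contraTT; rewrite -!leNgt => k0.
  by apply: mulr_le0_ge0.
have A0 : (0 < A x u v)%R.
  have := Kx; rewrite (K_fac Kx) => ABC; rewrite lt_def A_ge0 andbT.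
  by apply/eqP => E; move: ABC; rewrite E !mul0r ltxx.
have := kW z; rewrite !mulrA kA; apply: mulfI.
by rewrite mulf_neq0// gt_eqF.
Qed.

Definition side x v : R := rsum (fun u => kap x u v).

Lemma sideE x v : \Sum_u (kap x u v)%:E = (side x v)%:E.
Proof.
apply: (@rsumE _ _ _ 1) => //; rewrite -(kap_sum K_ge0 W_ge0 W_sum kap_ge0 K_kap K_sum y0 x).
rewrite Sum_swap; last by move=> *; rewrite lee_fin.
by apply: (Sum_ub (f := fun v => \Sum_u (kap x u v)%:E)) => i; nn.
Qed.

Lemma side_ge0 x v : (0 <= side x v)%R.
Proof. exact: rsum_ge0. Qed.

Lemma side_le1 x v : (side x v <= 1)%R.
Proof.
rewrite -lee_fin -sideE -(kap_sum K_ge0 W_ge0 W_sum kap_ge0 K_kap K_sum y0 x).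
rewrite Sum_swap; last by move=> *; rewrite lee_fin.
by apply: (Sum_ub (f := fun v => \Sum_u (kap x u v)%:E)) => i; nn.
Qed.

(** Privacy against Alice and privacy against Charlie both describe the law of M31 given (x, y,
    z). *)
Lemma side_Th x y z v : (0 < W x y z)%R -> side x v = ThV z v.
Proof.
move=> W0; have := K_ThV x y v z.
under eq_Sum do rewrite K_kap.
rewrite SumrZr// sideE -EFinM => -[] /mulIf; apply.
by rewrite gt_eqF.
Qed.

(** Otherwise the inputs with the value [side x v] and the remaining ones would form a forbidden
    partition, since a common possible z forces equal values. *)
Lemma side_const x x' v : side x v = side x' v.
Proof.
apply: contrapT => ne; apply: W_nopart.
exists [set x1 | side x1 v == side x v]%SET; split; last split.
- by apply/set0Pn; exists x; rewrite inE.
- by apply/set0Pn; exists x'; rewrite !inE eq_sym; apply/eqP.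
apply/eqP/setP => z; rewrite !inE; apply/negP => /andP[].
move=> /exists_inP[x1]; rewrite inE => /eqP E1 /existsP[y1 W1].
move=> /exists_inP[x2]; rewrite !inE => /eqP E2 /existsP[y2 W2].
by apply: E2; rewrite (side_Th _ W2) -E1 (side_Th _ W1).
Qed.

(** This links the entropy under the original, possibly correlated [pXY] with the product laws of
    the bound: M31 has the same law under all of them. *)
Lemma side_mix (p : X -> Y -> R) v : (forall x y, 0 <= p x y)%R ->
  (\sum_x \sum_y p x y = 1)%R ->
  \Sum_x \Sum_y \Sum_u \Sum_n (p x y * K x y u v n)%:E = (side x0 v)%:E.
Proof.
move=> p0 p1; rewrite -[side x0 v]mul1r -p1 big_distrl/= -Sum_fin_real; last first.
  by move=> x; rewrite mulr_ge0 ?side_ge0// sumr_ge0.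
apply: eq_Sum => x; rewrite big_distrl/= -Sum_fin_real; last first.
  by move=> y; rewrite mulr_ge0 ?side_ge0.
apply: eq_Sum => y; rewrite (side_const x0 x) EFinM -sideE -SumZl//; last by pos.
apply: eq_Sum => u; rewrite SumrZl//.
by rewrite (Sum_K_n K_ge0 W_ge0 W_sum kap_ge0 K_kap).
Qed.

Local Notation nu := (nu lam).

(** Bob's inputs are classed by their law of M23, and f numbers a class by the rank of a chosen
    representative. By [nu_eq] any y compatible with z gives the class of z, so g may pick one; its
    default value is never met on a possible z. *)
Lemma nu_classes : exists (f : Y -> nat) (g : Z -> nat),
  (forall y y', f y = f y' -> forall n, nu y n = nu y' n) /\
  (forall x y z, (0 < W x y z)%R -> f y = g z).
Proof.
pose eqn y y' := `[< forall n, nu y' n = nu y n >].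
pose f y := if [pick y' | eqn y y'] is Some y' then (enum_rank y' : nat) else 0%N.
have fE y : exists2 y', eqn y y' & f y = enum_rank y'.
  rewrite /f; case: pickP => [y' e|/(_ y)]; first by exists y'.
  by rewrite /eqn => /negP; case; apply/asboolP.
have f_eq y y' : (forall n, nu y n = nu y' n) -> f y = f y'.
  move=> e; rewrite /f; congr (if _ is Some y' then _ else _).
  apply: eq_pick => y1; apply/asboolP/asboolP => e1 n; first by rewrite e1 e.
  by rewrite e1 -e.
pose g z := if [pick xy : X * Y | (0 < W xy.1 xy.2 z)%R] is Some xy then f xy.2 else 0%N.
exists f, g; split.
  move=> y y' E n; have [y1 /asboolP e1 E1] := fE y; have [y2 /asboolP e2 E2] := fE y'.
  have /ord_inj/enum_rank_inj y12 : (enum_rank y1 : nat) = enum_rank y2.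
    by rewrite -E1 -E2.
  by rewrite -e1 y12 e2.
move=> x y z Wxyz; rewrite /g; case: pickP => [[x' y'] /= W'|/(_ (x, y))]; last first.
  by rewrite Wxyz.
by apply: f_eq => n; exact: (nu_eq K_ge0 W_ge0 W_sum lam_ge0 K_lam K_ThN K_sum x0 n Wxyz W').
Qed.

Hypothesis strategies : forall pX, fullDist pX -> exists (a1 b1 : U -> R) (a2 c2 : V -> R),
  [/\ forall u, (0 <= a1 u)%R, forall u, (0 <= b1 u)%R,
      forall v, (0 <= a2 v)%R & forall v, (0 <= c2 v)%R] /\
  [/\ forall x, \Sum_u \Sum_v (A x u v * b1 u * c2 v)%:E <= 1,
      forall y, \Sum_u \Sum_v \Sum_n (a1 u * a2 v * B y u n * C v n)%:E <= 1,
      forall u, (mu12 kap pX u <= a1 u * b1 u)%R &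
      forall v, (mu31 kap pX v <= a2 v * c2 v)%R].

Lemma mu31_side pX v : fullDist pX -> mu31 kap pX v = side x0 v.
Proof.
move=> [_ pX1]; rewrite /mu31 (eq_bigr (fun x => pX x * side x0 v)%R).
  by rewrite -big_distrl/= pX1 mul1r.
by move=> x _; rewrite -(side_const x).
Qed.

Theorem pivot_rhs : rhs1 W <= \Sum_v (ent (side x0 v))%:E.
Proof.
have [f [g [f_nu fg]]] := nu_classes.
apply: (@rhs1_le _ _ _ _ _ f g) => // pX pY1 pY2 dX dY1 dY2.
have [a1 [b1 [a2 [c2 [[a10 b10 a20 c20] [m1 m2 h1 h2]]]]]] := strategies dX.
have K_fac' x y u v n : (0 < K x y u v n)%R -> K x y u v n = (A x u v * B y u n * C v n)%R.
  by move=> K0; exact: K_fac K0 _ _.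
have := transcript_entropy_bound K_ge0 W_ge0 W_sum kap_ge0 lam_ge0 K_kap K_lam K_ThN
  K_sum x0 y0 dX.1 dY1.1 dY2.1 (fullDist_Sum dX) (fullDist_Sum dY1) (fullDist_Sum dY2)
  A_ge0 B_ge0 C_ge0 a10 b10 a20 c20 K_fac' pivot_unique m1 m2 h1 h2 f_nu.
(* Conversion from nats to bits. *)
have l2 : (0 < (ln 2)^-1 :> R)%R by rewrite invr_gt0 ln_gt0// ltr1n.
move=> H; rewrite EFinM.
have -> : \Sum_v (ent (side x0 v))%:E =
    (\Sum_v (mu31 kap pX v * - ln (mu31 kap pX v))%:E) * (ln 2)^-1%:E.
  rewrite -SumZr ?ltW//; last first.
    move=> v; rewrite lee_fin (mu31_side _ dX) mulr_ge0 ?side_ge0//.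
    by rewrite oppr_ge0 ln_le0// side_le1.
  by apply: eq_Sum => v; rewrite ent_log2 (mu31_side _ dX) /log2 -EFinM; congr EFin; ring.
by rewrite lee_pmul2r// lte_fin.
Qed.

End Pivot.

(** * From Markov chains to conditional kernels *)

Section Marginals.
Variables (R : realType) (T : choiceType) (J : T -> \bar R).
Local Open Scope ereal_scope.
Hypothesis J_ge0 : forall t, 0 <= J t.

Lemma marg_reindex (S U : choiceType) (e : S -> T) (g : T -> U) u :
  injective e -> (forall s, g (e s) = u) -> (forall t, g t = u -> exists s, e s = t) ->
  marg J g u = \Sum_s J (e s).
Proof.
move=> ie ge eg; apply: reindex_esum; split => [s _|s s' _ _|t /= gt].
- exact: ge.
- exact: ie.
- by have [s <-] := eg t gt; exists s.
Qed.

Lemma marg_ge0 (U : choiceType) (g : T -> U) u : 0 <= marg J g u.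
Proof. by apply: esum_ge0 => t _. Qed.

Lemma marg_le (U V : choiceType) (g : T -> U) (g' : T -> V) u v :
  (forall t, g t = u -> g' t = v) -> marg J g u <= marg J g' v.
Proof.
move=> gg'; rewrite /marg esum_mkcond [leRHS]esum_mkcond; apply: le_Sum => t.
case: ifPn => [|_]; last by case: ifP.
by rewrite inE /= => /gg' g't; rewrite ifT// inE.
Qed.

Hypothesis J_le1 : \Sum_t J t <= 1.

Lemma marg_fin (U : choiceType) (g : T -> U) u : exists2 r : R,
  (0 <= r)%R & marg J g u = r%:E.
Proof.
have : marg J g u <= 1.
  apply: le_trans J_le1; rewrite /marg esum_mkcond; apply: le_Sum => t.
  by case: ifP.
have := marg_ge0 g u; case: (marg J g u) => // r r0 _; exists r => //.
Qed.

(** The kernel [k] is the conditional law of a given b. Where b has probability 0, both joint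
    marginals vanish and its default value is harmless. *)
Lemma markov_factor (A B C : choiceType) (ga : T -> A) (gb : T -> B) (gc : T -> C) :
  Defs.markov J ga gb gc -> exists2 k : A -> B -> R, (forall a b, (0 <= k a b)%R) &
  forall a b c, marg J (fun t => (ga t, gb t, gc t)) (a, b, c) =
    (k a b)%:E * marg J (fun t => (gb t, gc t)) (b, c).
Proof.
move=> M; exists (fun a b => fine (marg J (fun t => (ga t, gb t)) (a, b)) /
  fine (marg J gb b))%R => [a b|a b c].
  by rewrite divr_ge0// fine_ge0// marg_ge0.
have := M a b c.
have [r1 r10 E1] := marg_fin (fun t => (ga t, gb t, gc t)) (a, b, c).
have [r2 r20 E2] := marg_fin gb b.
have [r3 r30 E3] := marg_fin (fun t => (ga t, gb t)) (a, b).
have [r4 r40 E4] := marg_fin (fun t => (gb t, gc t)) (b, c).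
have le1 : (r1 <= r2)%R.
  by rewrite -lee_fin -E1 -E2; apply: marg_le => t [].
have le4 : (r4 <= r2)%R.
  by rewrite -lee_fin -E4 -E2; apply: marg_le => t [].
rewrite E1 E2 E3 E4 /= => -[e]; rewrite -EFinM; congr EFin.
have [r2z|r2n] := eqVneq r2 0%R.
  have -> : r4 = 0%R by apply/eqP; rewrite eq_le r40 -r2z le4.
  by rewrite mulr0; apply/eqP; rewrite eq_le r10 -r2z le1.
by apply: (mulIf r2n); rewrite e mulrAC mulfVK.
Qed.

End Marginals.

Section Secure.
Variables (R : realType) (X Y Z : finType).
Variables (pXY : X -> Y -> R) (W : X -> Y -> Z -> R) (P : protocol R X Y Z).
Hypothesis pXY_gt0 : forall x y, 0 < pXY x y.
Hypothesis pXY_sum : \sum_(x : X) \sum_(y : Y) pXY x y = 1.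
Hypothesis W_ge0 : forall x y z, 0 <= W x y z.
Hypothesis W_sum : forall x y, \sum_(z : Z) W x y z = 1.
Hypothesis P_valid : valid_protocol P.
Local Open Scope ereal_scope.
Hypothesis P_correct : forall x y z,
  (\esum_(h in [set h | min_terminal P h])
     (histP P x y h * out P (Mtrans P L23 h) (Mtrans P L31 h) z)%:E)%R = (W x y z)%:E.

Local Notation K := (Kf P).
Local Notation J := (jointP P pXY).

Lemma out_ge0 n v z : (0 <= out P n v z)%R.
Proof. by case: P_valid => _ [_ [+ _]]; apply. Qed.

Lemma out_sum n v : (\sum_z out P n v z = 1)%R.
Proof. by case: P_valid => _ [_ [_ [+ _]]]; apply. Qed.

Let K0 x y u v n : (0 <= K x y u v n)%R. Proof. exact: Kf_ge0. Qed.
Let p0 x y : (0 <= pXY x y)%R. Proof. exact: ltW. Qed.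
Hint Resolve K0 p0 out_ge0 : core.

Lemma jointPE x y u n v z :
  J (x, y, (u, n, v), z) = (pXY x y * (K x y u v n * out P n v z))%:E.
Proof. by rewrite /jointP KfE// -!EFinM mulrA. Qed.

Lemma jointP_ge0 w : 0 <= J w.
Proof.
by case: w => -[[x y] [[u n] v]] z; rewrite jointPE lee_fin !mulr_ge0.
Qed.
Hint Resolve jointP_ge0 : core.

Lemma K_out_sum x y z :
  \Sum_u \Sum_v \Sum_n (K x y u v n * out P n v z)%:E = (W x y z)%:E.
Proof. by rewrite (Kf_reindex P_valid x y (g := fun u v n => out P n v z)). Qed.

Lemma marg_xyz (U : choiceType) (g : outcome X Y Z -> U) a x y z :
  (forall w, g w = a <-> [/\ oX w = x, oY w = y & oZ w = z]) ->
  marg J g a = (pXY x y * W x y z)%:E.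
Proof.
move=> ga.
rewrite (@marg_reindex _ _ _ (seq msg * seq msg * seq msg)%type _
  (fun s => (x, y, (s.1.1, s.2, s.1.2), z))).
- under eq_Sum do rewrite jointPE.
  rewrite (Sum_pair (f := fun (s : seq msg * seq msg) n =>
    (pXY x y * (K x y s.1 s.2 n * out P n s.2 z))%:E)); last by pos.
  rewrite (Sum_pair (f := fun u v =>
    \Sum_n (pXY x y * (K x y u v n * out P n v z))%:E)); last by pos.
  rewrite EFinM -K_out_sum -SumZl//; last by pos.
  apply: eq_Sum => u; rewrite -SumZl//; last by pos.
  by apply: eq_Sum => v; rewrite SumrZl//; pos.
- by move=> [[u v] n] [[u' v'] n'] /= [-> -> ->].
- by move=> s; apply/ga; split.
- move=> [[[x' y'] [[u n] v]] z'] /ga[/= <- <- <-].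
  by exists (u, v, n).
Qed.

Lemma jointP_total : \Sum_w J w <= 1.
Proof.
have -> : \Sum_w J w = \Sum_(s : X * Y * Z) marg J (fun w => (oX w, oY w, oZ w)) s.
  transitivity (\Sum_(s : X * Y * Z) \Sum_w
      (if (oX w, oY w, oZ w) == s then J w else 0)).
    rewrite Sum_swap; last by move=> s w; case: ifP.
    apply: eq_Sum => w; rewrite (@Sum_one _ _ _ (oX w, oY w, oZ w)) ?eqxx//.
    by move=> s; rewrite eq_sym => /negbTE ->.
  apply: eq_Sum => s; rewrite /marg [RHS]esum_mkcond; apply: eq_Sum => w.
  by case: eqP => E; [rewrite mem_set|rewrite memNset].
have -> : \Sum_(s : X * Y * Z) marg J (fun w => (oX w, oY w, oZ w)) s =
  \Sum_(s : X * Y * Z) (pXY s.1.1 s.1.2 * W s.1.1 s.1.2 s.2)%:E.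
  apply: eq_Sum => -[[x y] z]; apply: marg_xyz => w.
  by split => [[-> -> ->]|[-> -> ->]].
rewrite Sum_fin; last by pos.
rewrite sumEFin (sum_triple (fun x y z => pXY x y * W x y z)%R).
under eq_bigr do under eq_bigr do rewrite -big_distrr/= W_sum mulr1.
by rewrite pXY_sum.
Qed.

Let Kout_ge0 x y u v n z : (0 <= pXY x y * (K x y u v n * out P n v z))%R.
Proof. by rewrite !mulr_ge0. Qed.
Hint Resolve Kout_ge0 : core.

(** Full support is used here: dividing by [pXY x y] leaves an identity for every input pair in
    which the input law no longer occurs. *)
Let cancel_p x y (S : \bar R) (k w : R) : (pXY x y)%:E * S = k%:E * (pXY x y * w)%:E ->
  S = (k * w)%:E.
Proof.
move=> E; have := congr1 (fun e => (pXY x y)^-1%:E * e) E.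
rewrite muleA -EFinM mulVf ?gt_eqF// mul1e => ->.
by rewrite -!EFinM; congr EFin; field; rewrite gt_eqF.
Qed.

Lemma markov_kap : Defs.markov J (fun w => (oM12 w, oM31 w)) (@oX X Y Z) (fun w => (oY w, oZ w)) ->
  exists2 kap : X -> seq msg -> seq msg -> R, (forall x u v, (0 <= kap x u v)%R) &
  forall x y u v z, \Sum_n (K x y u v n * out P n v z)%:E = (kap x u v * W x y z)%:E.
Proof.
move=> /(markov_factor jointP_ge0 jointP_total)[k k0 E].
exists (fun x u v => k (u, v) x) => // x y u v z.
apply: (@cancel_p x y); rewrite -(@marg_xyz _ (fun w => (oX w, (oY w, oZ w))) (x, (y, z))).
  rewrite -E (@marg_reindex _ _ _ (seq msg) _ (fun n => (x, y, (u, n, v), z))).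
  - by under [RHS]eq_Sum do rewrite jointPE; rewrite SumrZl//; pos.
  - by move=> n n' [].
  - by [].
  - by move=> [[[x' y'] [[u' n] v']] z'] [/= <- <- <- <- <-]; exists n.
by move=> w; split => [[-> -> ->]|[-> -> ->]].
Qed.

Lemma markov_lam : Defs.markov J (fun w => (oM12 w, oM23 w)) (@oY X Y Z) (fun w => (oX w, oZ w)) ->
  exists2 lam : Y -> seq msg -> seq msg -> R, (forall y u n, (0 <= lam y u n)%R) &
  forall x y u n z, \Sum_v (K x y u v n * out P n v z)%:E = (lam y u n * W x y z)%:E.
Proof.
move=> /(markov_factor jointP_ge0 jointP_total)[k k0 E].
exists (fun y u n => k (u, n) y) => // x y u n z.
apply: (@cancel_p x y); rewrite -(@marg_xyz _ (fun w => (oY w, (oX w, oZ w))) (y, (x, z))).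
  rewrite -E (@marg_reindex _ _ _ (seq msg) _ (fun v => (x, y, (u, n, v), z))).
  - by under [RHS]eq_Sum do rewrite jointPE; rewrite SumrZl//; pos.
  - by move=> v v' [].
  - by [].
  - by move=> [[[x' y'] [[u' n'] v]] z'] [/= <- <- <- <- <-]; exists v.
by move=> w; split => [[-> -> ->]|[-> -> ->]].
Qed.

Lemma markov_the : Defs.markov J (fun w => (oM23 w, oM31 w)) (@oZ X Y Z) (fun w => (oX w, oY w)) ->
  exists2 the : Z -> seq msg -> seq msg -> R, (forall z v n, (0 <= the z v n)%R) &
  forall x y v n z, \Sum_u (K x y u v n * out P n v z)%:E = (the z v n * W x y z)%:E.
Proof.
move=> /(markov_factor jointP_ge0 jointP_total)[k k0 E].
exists (fun z v n => k (n, v) z) => // x y v n z.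
apply: (@cancel_p x y); rewrite -(@marg_xyz _ (fun w => (oZ w, (oX w, oY w))) (z, (x, y))).
  rewrite -E (@marg_reindex _ _ _ (seq msg) _ (fun u => (x, y, (u, n, v), z))).
  - by under [RHS]eq_Sum do rewrite jointPE; rewrite SumrZl//; pos.
  - by move=> u u' [].
  - by [].
  - by move=> [[[x' y'] [[u n'] v']] z'] [/= <- <- <- <- <-]; exists u.
by move=> w; split => [[-> -> ->]|[-> -> ->]].
Qed.

Lemma marg_M31 v : marg J (@oM31 X Y Z) v =
  \Sum_x \Sum_y \Sum_u \Sum_n (pXY x y * K x y u v n)%:E.
Proof.
rewrite (@marg_reindex _ _ _ (X * Y * seq msg * seq msg * Z)%type _
  (fun s => (s.1.1.1.1, s.1.1.1.2, (s.1.1.2, s.1.2, v), s.2))).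
- under eq_Sum do rewrite jointPE.
  rewrite (Sum_pair (f := fun (s : X * Y * seq msg * seq msg) z => (pXY s.1.1.1 s.1.1.2 *
    (K s.1.1.1 s.1.1.2 s.1.2 v s.2 * out P s.2 v z))%:E)); last by pos.
  transitivity (\Sum_(s : X * Y * seq msg * seq msg)
      (pXY s.1.1.1 s.1.1.2 * K s.1.1.1 s.1.1.2 s.1.2 v s.2)%:E).
    apply: eq_Sum => s; under eq_Sum do rewrite mulrA.
    rewrite SumrZl ?mulr_ge0//.
    rewrite Sum_fin; last by pos.
    by rewrite sumEFin out_sum mule1.
  rewrite (Sum_pair (f := fun (s : X * Y * seq msg) n =>
    (pXY s.1.1 s.1.2 * K s.1.1 s.1.2 s.2 v n)%:E)); last by pos.
  rewrite (Sum_pair (f := fun (s : X * Y) u => \Sum_n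
    (pXY s.1 s.2 * K s.1 s.2 u v n)%:E)); last by pos.
  by rewrite (Sum_pair (f := fun x y => \Sum_u \Sum_n (pXY x y * K x y u v n)%:E)); last by pos.
- by move=> [[[[x y] u] n] z] [[[[x' y'] u'] n'] z'] /= [-> -> -> -> ->].
- by [].
- by move=> [[[x y] [[u n] v']] z] /= <-; exists (x, y, u, n, z).
Qed.

Lemma marg_M23 n : marg J (@oM23 X Y Z) n =
  \Sum_y \Sum_x \Sum_u \Sum_v (pXY x y * K x y u v n)%:E.
Proof.
rewrite (@marg_reindex _ _ _ (Y * X * seq msg * seq msg * Z)%type _
  (fun s => (s.1.1.1.2, s.1.1.1.1, (s.1.1.2, n, s.1.2), s.2))).
- under eq_Sum do rewrite jointPE.
  rewrite (Sum_pair (f := fun (s : Y * X * seq msg * seq msg) z => (pXY s.1.1.2 s.1.1.1 *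
    (K s.1.1.2 s.1.1.1 s.1.2 s.2 n * out P n s.2 z))%:E)); last by pos.
  transitivity (\Sum_(s : Y * X * seq msg * seq msg)
      (pXY s.1.1.2 s.1.1.1 * K s.1.1.2 s.1.1.1 s.1.2 s.2 n)%:E).
    apply: eq_Sum => s; under eq_Sum do rewrite mulrA.
    rewrite SumrZl ?mulr_ge0//.
    rewrite Sum_fin; last by pos.
    by rewrite sumEFin out_sum mule1.
  rewrite (Sum_pair (f := fun (s : Y * X * seq msg) v =>
    (pXY s.1.2 s.1.1 * K s.1.2 s.1.1 s.2 v n)%:E)); last by pos.
  rewrite (Sum_pair (f := fun (s : Y * X) u => \Sum_v
    (pXY s.2 s.1 * K s.2 s.1 u v n)%:E)); last by pos.
  by rewrite (Sum_pair (f := fun y x => \Sum_u \Sum_v (pXY x y * K x y u v n)%:E)); last by pos.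
- by move=> [[[[y x] u] v] z] [[[[y' x'] u'] v'] z'] /= [-> -> -> -> ->].
- by [].
- by move=> [[[x y] [[u n'] v]] z] /= <-; exists (y, x, u, v, z).
Qed.

End Secure.

Section Assembly.
Variables (R : realType) (X Y Z : finType).
Variables (W : X -> Y -> Z -> R) (P : protocol R X Y Z).
Hypothesis W_ge0 : forall x y z, 0 <= W x y z.
Hypothesis W_sum : forall x y, \sum_(z : Z) W x y z = 1.
Hypothesis W_normal : normal_form W.
Hypothesis P_valid : valid_protocol P.
Variables (x0 : X) (y0 : Y).
Local Open Scope ereal_scope.

Local Notation K := (Kf P).

Let K0 x y u v n : (0 <= K x y u v n)%R. Proof. exact: Kf_ge0. Qed.
Hint Resolve K0 : core.

(** For w = 0 the sum of f may be infinite, but both sides vanish; for w > 0 the bound forces it to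
    be finite. *)
Lemma rsum_scale (T : choiceType) (f : T -> R) (w : R) :
  (forall t, 0 <= f t)%R -> (0 <= w)%R -> \Sum_t (f t * w)%:E <= 1 ->
  \Sum_t (f t * w)%:E = (rsum f * w)%:E.
Proof.
move=> f0; rewrite le_eqVlt => /predU1P[<- _|w0 le1].
  by rewrite mulr0 Sum0// => t; rewrite mulr0.
have wg := ltW w0; rewrite SumrZr// EFinM; congr (_ * _); apply: (@rsumE _ _ _ w^-1) => //.
move: le1; rewrite SumrZr// => le1.
have : 0 <= \Sum_i (f i)%:E by pos.
case: (\Sum_i (f i)%:E) le1 => [r| |]//.
  by rewrite -EFinM !lee_fin -[w^-1%R]mul1r ler_pdivlMr.
by rewrite gt0_mulye.
Qed.

Variable the : Z -> seq msg -> seq msg -> R.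
Hypothesis the_ge0 : forall z v n, (0 <= the z v n)%R.
Hypothesis K_the_out : forall x y v n z,
  \Sum_u (K x y u v n * out P n v z)%:E = (the z v n * W x y z)%:E.

(** If z and z' were both possible outputs for (v, n), privacy against Charlie would express the
    probability of (v, n) on any inputs as a fixed multiple of W at z and also of W at z'. The two
    would be proportional, against normal form. *)
Lemma out_unique x y u v n z z' : (0 < K x y u v n)%R ->
  (0 < out P n v z)%R -> (0 < out P n v z')%R -> z = z'.
Proof.
move=> Kp oz oz'; case: W_normal => _ [_]; apply.
pose k x1 y1 := \Sum_u (K x1 y1 u v n)%:E.
have kE x1 y1 z1 : (0 < out P n v z1)%R ->
    k x1 y1 = (the z1 v n * W x1 y1 z1 / out P n v z1)%:E.
  move=> o1; have := K_the_out x1 y1 v n z1; rewrite SumrZr ?(ltW o1)// -/(k _ _) => E.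
  by rewrite EFinM -E -muleA -EFinM divff ?gt_eqF// mule1.
have the0 z1 : (0 < out P n v z1)%R -> (0 < the z1 v n)%R.
  move=> o1; have : 0 < k x y.
    apply: (@lt_le_trans _ _ (K x y u v n)%:E) => //.
    by apply: (Sum_ub (f := fun u => (K x y u v n)%:E)); pos.
  rewrite (kE x y z1)// lte_fin; apply: contraTT; rewrite -!leNgt => t0.
  by do 2!(apply: mulr_le0_ge0; rewrite ?invr_ge0 ?(ltW o1)//).
exists (the z' v n * out P n v z / (out P n v z' * the z v n))%R => x1 y1.
have := kE x1 y1 z oz; rewrite (kE _ _ _ oz') => -[E].
have tz := the0 _ oz; have ot := gt_eqF oz'; have ot1 := gt_eqF oz.
have -> : W x1 y1 z = ((the z v n * W x1 y1 z / out P n v z) * (out P n v z / the z v n))%R.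
  by field; rewrite !gt_eqF.
by rewrite -E; field; rewrite !gt_eqF.
Qed.

(** At transcripts that never occur the output may stay random, hence an equality weighted by K. *)
Lemma zeta_exists : exists zeta : seq msg -> seq msg -> Z, forall x y u v n z,
  (K x y u v n * out P n v z = K x y u v n * (zeta v n == z)%:R)%R.
Proof.
have ez v n : exists z, (0 < out P n v z)%R.
  apply: contrapT => nz; have := out_sum P_valid n v; rewrite big1.
    by move/eqP; rewrite eq_sym oner_eq0.
  move=> z _; apply/eqP; rewrite eq_le (out_ge0 P_valid) andbT leNgt.
  by apply/negP => oz; apply: nz; exists z.
have [zeta zE] : exists zeta : seq msg -> seq msg -> Z, forall v n,
    (0 < out P n v (zeta v n))%R.
  suff /choice[zeta zE] : forall v, exists f : seq msg -> Z,
    forall n, (0 < out P n v (f n))%R by exists zeta.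
  by move=> v; have /choice[f fE] := ez v; exists f.
exists zeta => x y u v n z.
have := K0 x y u v n; rewrite le_eqVlt => /predU1P[<-|Kp]; first by rewrite !mul0r.
have oz z' : z' != zeta v n -> out P n v z' = 0%R.
  move=> nz; apply/eqP; rewrite eq_le (out_ge0 P_valid) andbT leNgt.
  by apply/negP => o; move/eqP: nz; apply; exact: out_unique Kp o (zE v n).
congr (_ * _)%R; case: eqP => [<-|/eqP nz]; last by rewrite oz// eq_sym.
by have := out_sum P_valid n v; rewrite (bigD1 (zeta v n))//= big1 ?addr0.
Qed.

Lemma Kf_sum x y : \Sum_u \Sum_v \Sum_n (K x y u v n)%:E = 1.
Proof.
have := Kf_reindex P_valid x y (g := fun _ _ _ => 1%R) (fun _ _ _ => ler01).
under eq_Sum do under eq_Sum do under eq_Sum do rewrite mulr1.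
move=> ->; case: P_valid => _ [_ [_ [_ /(_ x y) <-]]].
by apply: eq_esum => h _; rewrite mulr1.
Qed.

End Assembly.

(** * The strategies that replace one side of the protocol *)

Section StrategyProfiles.
Variables (R : realType) (X Y Z : finType) (P : protocol R X Y Z).
Hypothesis P_valid : valid_protocol P.
Local Open Scope ereal_scope.

Definition mute (h : seq msg) (m : msg) : R := (m == [::])%:R.

Lemma mute_substoch d : substoch P mute d.
Proof.
split=> [h x|h _]; first by rewrite /mute.
rewrite (@Sum_one _ _ _ [::]) /mute ?eqxx//.
by move=> x /negbTE ->.
Qed.

Lemma G_mute d (m : link -> seq msg) : m (lnk d) = [::] -> G P mute d m = 1%R.
Proof.
move=> md; rewrite /G (_ : (fun T => _) = cst 1%R); first exact: lim_cst.
apply/funext => T; rewrite /Fac big1// => t _; case: dir_eqbP => // td.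
by rewrite /mute /msgt td md nth_nil eqxx.
Qed.

(** [G_mass] accepts only realizable transcripts. Cutting off the others, here and in [Gr], costs
    nothing because they have probability 0. *)
Definition Cr v n : R :=
  if `[< realizable P L31 v /\ realizable P L23 n >] then Cf P v n else 0%R.

Lemma Cr_ge0 v n : (0 <= Cr v n)%R.
Proof. by rewrite /Cr; case: asboolP => // _; exact: Cf_ge0. Qed.

Lemma Kf_Cr x y u v n : (0 < Kf P x y u v n)%R ->
  forall x' y', Kf P x' y' u v n = (Af P x' u v * Bf P y' u n * Cr v n)%R.
Proof.
move=> Kp x' y'; rewrite (Kf_factor P_valid Kp) /Cr asboolT//.
by have [] := Kf_realizable P_valid Kp.
Qed.

Definition Gr l (mu : seq msg -> R) d (m : link -> seq msg) : R :=
  if `[< realizable P l (m l) >] then G P (strat P l mu) d m else 0%R.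

Lemma Gr_ge0 l mu d m : (forall u, 0 <= mu u)%R -> \Sum_u (mu u)%:E <= 1 ->
  (0 <= Gr l mu d m)%R.
Proof.
move=> mu0 mu1; rewrite /Gr; case: asboolP => // _.
by apply: G_ge0; exact: strat_substoch.
Qed.

Lemma Gr_realizable l mu d m : Gr l mu d m != 0%R -> realizable P l (m l).
Proof. by rewrite /Gr; case: asboolP => //; rewrite eqxx. Qed.

Lemma Gr_le l mu d m m' : (forall u, 0 <= mu u)%R -> \Sum_u (mu u)%:E <= 1 ->
  lnk d = l -> m l = m' l -> (Gr l mu d m <= G P (strat P l mu) d m')%R.
Proof.
move=> mu0 mu1 dl ml; rewrite /Gr (G_strat_ext _ _ dl ml); case: asboolP => // _.
by apply: G_ge0; exact: strat_substoch.
Qed.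

Lemma Gr_mu l mu d d' m : (forall u, 0 <= mu u)%R -> \Sum_u (mu u)%:E <= 1 ->
  (forall u, ~ realizable P l u -> mu u = 0%R) ->
  (forall e, link_eqb (lnk e) l = dir_eqb e d || dir_eqb e d') -> ~~ dir_eqb d d' ->
  (mu (m l) <= Gr l mu d m * Gr l mu d' m)%R.
Proof.
move=> mu0 mu1 mur e1 e2; rewrite /Gr; case: asboolP => [_|/mur ->].
  exact: G_strat.
by rewrite mul0r.
Qed.

Let sA_G x d m := G_ge0 m (sA_substoch P_valid x d).
Let sB_G y d m := G_ge0 m (sB_substoch P_valid y d).
Let sC_G d m := G_ge0 m (sC_substoch P_valid d).

Lemma realizable_nil l : realizable P l [::].
Proof. by exists [::]; rewrite /Mtrans linkhistE. Qed.

Variables (mu12 mu3 : seq msg -> R).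
Hypothesis mu12_ge0 : forall u, (0 <= mu12 u)%R.
Hypothesis mu3_ge0 : forall u, (0 <= mu3 u)%R.
Hypothesis mu12_le1 : \Sum_u (mu12 u)%:E <= 1.
Hypothesis mu3_le1 : \Sum_u (mu3 u)%:E <= 1.
Hypothesis mu12_real : forall u, ~ realizable P L12 u -> mu12 u = 0%R.

Let g12_ge0 d m : (0 <= Gr L12 mu12 d m)%R. Proof. exact: Gr_ge0. Qed.
Let g3_ge0 l d m : (0 <= Gr l mu3 d m)%R. Proof. exact: Gr_ge0. Qed.

Lemma alice_strategies : (forall v, ~ realizable P L31 v -> mu3 v = 0%R) ->
  exists (a1 b1 a2 c2 : seq msg -> R),
  [/\ forall u, (0 <= a1 u)%R, forall u, (0 <= b1 u)%R,
      forall v, (0 <= a2 v)%R & forall v, (0 <= c2 v)%R] /\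
  [/\ forall x, \Sum_u \Sum_v (Af P x u v * b1 u * c2 v)%:E <= 1,
      forall y, \Sum_u \Sum_v \Sum_n (a1 u * a2 v * Bf P y u n * Cr v n)%:E <= 1,
      forall u, (mu12 u <= a1 u * b1 u)%R &
      forall v, (mu3 v <= a2 v * c2 v)%R].
Proof.
move=> mu3_real.
exists (fun u => Gr L12 mu12 d12 (tr u [::] [::])), (fun u => Gr L12 mu12 d21 (tr u [::] [::])),
  (fun v => Gr L31 mu3 d13 (tr [::] [::] v)), (fun v => Gr L31 mu3 d31 (tr [::] [::] v)).
split; [by split|split].
- move=> x.
  rewrite -(Sum_pair (f := fun u v => (Af P x u v * Gr L12 mu12 d21 (tr u [::] [::]) *
    Gr L31 mu3 d31 (tr [::] [::] v))%:E)); last first.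
    by move=> u v; rewrite lee_fin !mulr_ge0// Af_ge0.
  (* Alice is honest; Bob and Charlie each imitate the marginal law of their link with her, and M23
     stays silent. *)
  pose c d := match d with d12 | d13 => sA P x | d21 => strat P L12 mu12
    | d31 => strat P L31 mu3 | d23 | d32 => mute end.
  apply: (@G_mass _ _ _ _ P _ (fun s => tr s.1 [::] s.2) c) => [d|s s' E|s|s].
  + by case: d => /=; [exact: sA_substoch|exact: strat_substoch|exact: mute_substoch|
      exact: mute_substoch|exact: strat_substoch|exact: sA_substoch].
  + by have := E L12; have := E L31; case: s {E}; case: s' => /= ? ? ? ? -> ->.
  + rewrite /= !(@G_mute _ (tr s.1 [::] s.2))// !mulr1 -AfE//.
    by apply: ler_pM; [|exact: g3_ge0|apply: ler_pM|];
      rewrite ?mulr_ge0 ?Af_ge0//; apply: Gr_le.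
  + rewrite !mulf_eq0 !negb_or => /andP[/andP[_ /Gr_realizable r1] /Gr_realizable r2].
    by case => //=; exact: realizable_nil.
- move=> y.
  rewrite -(Sum_pair (f := fun u v => \Sum_n (Gr L12 mu12 d12 (tr u [::] [::]) *
    Gr L31 mu3 d13 (tr [::] [::] v) * Bf P y u n * Cr v n)%:E)); last first.
    by move=> u v; apply: Sum_ge0 => n; rewrite lee_fin !mulr_ge0// ?Bf_ge0 ?Cr_ge0.
  rewrite -(Sum_pair (f := fun (s : seq msg * seq msg) n =>
    (Gr L12 mu12 d12 (tr s.1 [::] [::]) *
    Gr L31 mu3 d13 (tr [::] [::] s.2) * Bf P y s.1 n * Cr s.2 n)%:E)); last first.
    by move=> s n; rewrite lee_fin !mulr_ge0// ?Bf_ge0 ?Cr_ge0.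
  (* Bob and Charlie are honest, while Alice treats her two links independently. *)
  pose c d := match d with d12 => strat P L12 mu12 | d13 => strat P L31 mu3
    | d21 | d23 => sB P y | d31 | d32 => sC P end.
  apply: (@G_mass _ _ _ _ P _ (fun s => tr s.1.1 s.2 s.1.2) c) => [d|s s' E|s|s].
  + by case: d => /=; [exact: strat_substoch|exact: sB_substoch|exact: sB_substoch|
      exact: sC_substoch|exact: sC_substoch|exact: strat_substoch].
  + have := E L12; have := E L31; have := E L23.
    by case: s {E} => [[? ?] ?]; case: s' => [[? ?] ?] /= -> -> ->.
  + rewrite /= -BfE// -CfE//.
    have ge1 : (0 <= Gr L12 mu12 d12 (tr s.1.1 [::] [::]) *
      Gr L31 mu3 d13 (tr [::] [::] s.1.2))%R by rewrite mulr_ge0.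
    apply: ler_pM; [by rewrite mulr_ge0 ?Bf_ge0|exact: Cr_ge0|apply: ler_pM => //|].
    * exact: Bf_ge0.
    * by apply: ler_pM => //; apply: Gr_le.
    * by rewrite /Cr; case: asboolP => // _; exact: Cf_ge0.
  + rewrite !mulf_eq0 !negb_or => /andP[/andP[/andP[/Gr_realizable r1 /Gr_realizable r2] _]].
    rewrite /Cr; case: asboolP => [[r3 r4] _|_]; last by rewrite eqxx.
    by case.
- by move=> u; apply: (@Gr_mu L12 mu12 d12 d21 (tr u [::] [::])) => // -[].
- by move=> v; apply: (@Gr_mu L31 mu3 d13 d31 (tr [::] [::] v)) => // -[].
Qed.

Lemma bob_strategies : (forall n, ~ realizable P L23 n -> mu3 n = 0%R) ->
  exists (a1 b1 a2 c2 : seq msg -> R),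
  [/\ forall u, (0 <= a1 u)%R, forall u, (0 <= b1 u)%R,
      forall n, (0 <= a2 n)%R & forall n, (0 <= c2 n)%R] /\
  [/\ forall y, \Sum_u \Sum_n (Bf P y u n * b1 u * c2 n)%:E <= 1,
      forall x, \Sum_u \Sum_n \Sum_v (a1 u * a2 n * Af P x u v * Cr v n)%:E <= 1,
      forall u, (mu12 u <= a1 u * b1 u)%R &
      forall n, (mu3 n <= a2 n * c2 n)%R].
Proof.
move=> mu3_real.
exists (fun u => Gr L12 mu12 d21 (tr u [::] [::])), (fun u => Gr L12 mu12 d12 (tr u [::] [::])),
  (fun n => Gr L23 mu3 d23 (tr [::] n [::])), (fun n => Gr L23 mu3 d32 (tr [::] n [::])).
split; [by split|split].
- move=> y.
  rewrite -(Sum_pair (f := fun u n => (Bf P y u n * Gr L12 mu12 d12 (tr u [::] [::]) *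
    Gr L23 mu3 d32 (tr [::] n [::]))%:E)); last first.
    by move=> u n; rewrite lee_fin !mulr_ge0// Bf_ge0.
  pose c d := match d with d21 | d23 => sB P y | d12 => strat P L12 mu12
    | d32 => strat P L23 mu3 | d13 | d31 => mute end.
  apply: (@G_mass _ _ _ _ P _ (fun s => tr s.1 s.2 [::]) c) => [d|s s' E|s|s].
  + by case: d => /=; [exact: strat_substoch|exact: sB_substoch|exact: sB_substoch|
      exact: strat_substoch|exact: mute_substoch|exact: mute_substoch].
  + by have := E L12; have := E L23; case: s {E}; case: s' => /= ? ? ? ? -> ->.
  + rewrite /= !(@G_mute _ (tr s.1 s.2 [::]))// !mulr1 mul1r -BfE//.
    rewrite [(Bf _ _ _ _ * _)%R]mulrC.
    by apply: ler_pM; [|exact: g3_ge0|apply: ler_pM|];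
      rewrite ?mulr_ge0 ?Bf_ge0//; apply: Gr_le.
  + rewrite !mulf_eq0 !negb_or => /andP[/andP[_ /Gr_realizable r1] /Gr_realizable r2].
    by case => //=; exact: realizable_nil.
- move=> x.
  rewrite -(Sum_pair (f := fun u n => \Sum_v (Gr L12 mu12 d21 (tr u [::] [::]) *
    Gr L23 mu3 d23 (tr [::] n [::]) * Af P x u v * Cr v n)%:E)); last first.
    by move=> u v; apply: Sum_ge0 => n; rewrite lee_fin !mulr_ge0// ?Af_ge0 ?Cr_ge0.
  rewrite -(Sum_pair (f := fun (s : seq msg * seq msg) v =>
    (Gr L12 mu12 d21 (tr s.1 [::] [::]) *
    Gr L23 mu3 d23 (tr [::] s.2 [::]) * Af P x s.1 v * Cr v s.2)%:E)); last first.
    by move=> s n; rewrite lee_fin !mulr_ge0// ?Af_ge0 ?Cr_ge0.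
  pose c d := match d with d21 => strat P L12 mu12 | d23 => strat P L23 mu3
    | d12 | d13 => sA P x | d31 | d32 => sC P end.
  apply: (@G_mass _ _ _ _ P _ (fun s => tr s.1.1 s.1.2 s.2) c) => [d|s s' E|s|s].
  + by case: d => /=; [exact: sA_substoch|exact: strat_substoch|exact: strat_substoch|
      exact: sC_substoch|exact: sC_substoch|exact: sA_substoch].
  + have := E L12; have := E L31; have := E L23.
    by case: s {E} => [[? ?] ?]; case: s' => [[? ?] ?] /= -> -> ->.
  + rewrite /= -AfE// -CfE//.
    have ge1 : (0 <= Gr L12 mu12 d21 (tr s.1.1 [::] [::]) *
      Gr L23 mu3 d23 (tr [::] s.1.2 [::]))%R by rewrite mulr_ge0.
    rewrite [leRHS](_ : _ = G P (strat P L12 mu12) d21 (tr s.1.1 s.1.2 s.2) *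
      G P (strat P L23 mu3) d23 (tr s.1.1 s.1.2 s.2) * Af P x s.1.1 s.2 *
      Cf P s.2 s.1.2)%R; last by ring.
    apply: ler_pM; [by rewrite mulr_ge0 ?Af_ge0|exact: Cr_ge0|apply: ler_pM => //|].
    * exact: Af_ge0.
    * by apply: ler_pM => //; apply: Gr_le.
    * by rewrite /Cr; case: asboolP => // _; exact: Cf_ge0.
  + rewrite !mulf_eq0 !negb_or => /andP[/andP[/andP[/Gr_realizable r1 /Gr_realizable r2] _]].
    rewrite /Cr; case: asboolP => [[r3 r4] _|_]; last by rewrite eqxx.
    by case.
- by move=> u; apply: (@Gr_mu L12 mu12 d21 d12 (tr u [::] [::])) => // -[].
- by move=> n; apply: (@Gr_mu L23 mu3 d23 d32 (tr [::] n [::])) => // -[].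
Qed.

End StrategyProfiles.

Lemma no_partition_swap (R : realType) (X Y Z : finType) (W : X -> Y -> Z -> R) :
  no_partition_Y W -> no_partition_X (fun y x z => W x y z).
Proof.
have E B : ZofX (fun y x z => W x y z) B = ZofY W B.
  apply/setP => z; rewrite !inE; apply/exists_inP/existsP.
    by move=> [y yB /existsP[x Wp]]; exists x; apply/exists_inP; exists y.
  by move=> [x /exists_inP[y yB Wp]]; exists y => //; apply/existsP; exists x.
by move=> np [B]; rewrite !E => H; apply: np; exists B.
Qed.

Theorem theorem5 (R : realType) (X Y Z : finType)
    (pXY : X -> Y -> R) (W : X -> Y -> Z -> R) (P : protocol R X Y Z) :
  (forall x y, 0 < pXY x y) ->
  \sum_(x : X) \sum_(y : Y) pXY x y = 1 ->
  cond_dist W ->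
  normal_form W ->
  secure P pXY W ->
  (no_partition_X W ->
     (rhs1 W <= Hc (jointP P pXY) (@oM31 X Y Z))%E) /\
  (no_partition_Y W ->
     (rhs2 W <= Hc (jointP P pXY) (@oM23 X Y Z))%E).
Proof.
move=> pXY_gt0 pXY_sum [W0 W1] Wn [Pv [Pc [mA [mB mC]]]].
have pXY_ge0 x y : 0 <= pXY x y by exact: ltW.
(* The total mass 1 of [pXY] provides a pair of reference inputs. *)
have [[x0 y0] _] : exists xy : X * Y, true.
  apply: contrapT => nxy; move: pXY_sum; rewrite big1; last first.
    by move=> x _; rewrite big1// => y _; case: nxy; exists (x, y).
  by move/eqP; rewrite eq_sym oner_eq0.
have [kap kap0 K_kap_out] := markov_kap pXY_gt0 pXY_sum W0 W1 Pv Pc mA.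
have [lam lam0 K_lam_out] := markov_lam pXY_gt0 pXY_sum W0 W1 Pv Pc mB.
have [the the0 K_the_out] := markov_the pXY_gt0 pXY_sum W0 W1 Pv Pc mC.
have [zeta zE] := zeta_exists W0 Wn Pv K_the_out.
have K0 x y u v n : 0 <= Kf P x y u v n by exact: Kf_ge0.
have nnK x y u v n z : 0 <= Kf P x y u v n * (zeta v n == z)%:R.
  by rewrite mulr_ge0.
have K_kap x y u v z :
    (\Sum_n (Kf P x y u v n * (zeta v n == z)%:R)%:E = (kap x u v * W x y z)%:E)%E.
  by rewrite -K_kap_out; apply: eq_Sum => n; rewrite zE.
have K_lam x y u n z :
    (\Sum_v (Kf P x y u v n * (zeta v n == z)%:R)%:E = (lam y u n * W x y z)%:E)%E.
  by rewrite -K_lam_out; apply: eq_Sum => v; rewrite zE.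
have K_the x y v n z :
    (\Sum_u (Kf P x y u v n * (zeta v n == z)%:R)%:E = (the z v n * W x y z)%:E)%E.
  by rewrite -K_the_out; apply: eq_Sum => u; rewrite zE.
have K_sum x y := Kf_sum Pv x y.
have leK x y u v n z : ((Kf P x y u v n * (zeta v n == z)%:R)%:E <= (Kf P x y u v n)%:E)%E.
  by rewrite lee_fin; case: (_ == _); rewrite ?mulr1// mulr0.
have K_ThN x y n z : (\Sum_u \Sum_v (Kf P x y u v n * (zeta v n == z)%:R)%:E =
    (rsum (fun v => the z v n) * W x y z)%:E)%E.
  rewrite Sum_swap; last by move=> u v; rewrite lee_fin.
  have E : (\Sum_v \Sum_u (Kf P x y u v n * (zeta v n == z)%:R)%:E =
      \Sum_v (the z v n * W x y z)%:E)%E by apply: eq_Sum => v; rewrite K_the.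
  rewrite E; apply: rsum_scale => //; rewrite -E -(K_sum x y).
  rewrite Sum_swap; last by move=> v u; rewrite lee_fin.
  apply: le_Sum => u; apply: le_Sum => v; apply: le_trans (leK _ _ _ _ _ _) _.
  by apply: (Sum_ub (f := fun n => (Kf P x y u v n)%:E)) => i; rewrite lee_fin.
have K_ThV x y v z : (\Sum_u \Sum_n (Kf P x y u v n * (zeta v n == z)%:R)%:E =
    (rsum (fun n => the z v n) * W x y z)%:E)%E.
  rewrite Sum_swap; last by move=> u n; rewrite lee_fin.
  have E : (\Sum_n \Sum_u (Kf P x y u v n * (zeta v n == z)%:R)%:E =
      \Sum_n (the z v n * W x y z)%:E)%E by apply: eq_Sum => n; rewrite K_the.
  rewrite E; apply: rsum_scale => //; rewrite -E -(K_sum x y).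
  rewrite Sum_swap; last by move=> n u; rewrite lee_fin.
  apply: le_Sum => u; apply: le_trans (Sum_ub (f := fun v =>
    \Sum_n (Kf P x y u v n)%:E)%E v _).
    by apply: le_Sum => n; exact: leK.
  by move=> i; apply: Sum_ge0 => n; rewrite lee_fin.
have Kz12 u : ~ realizable P L12 u -> forall x y v n, Kf P x y u v n = 0.
  move=> nr x y v n; apply/eqP; rewrite eq_le K0 andbT leNgt.
  by apply/negP => /(Kf_realizable Pv)[].
have Kz31 v : ~ realizable P L31 v -> forall x y u n, Kf P x y u v n = 0.
  move=> nr x y u n; apply/eqP; rewrite eq_le K0 andbT leNgt.
  by apply/negP => /(Kf_realizable Pv)[].
have Kz23 n : ~ realizable P L23 n -> forall x y u v, Kf P x y u v n = 0.
  move=> nr x y u v; apply/eqP; rewrite eq_le K0 andbT leNgt.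
  by apply/negP => /(Kf_realizable Pv)[].
split=> np.
  have -> : Hc (jointP P pXY) (@oM31 X Y Z) = (\Sum_v (ent (side kap x0 v))%:E)%E.
    apply: eq_Sum => v; rewrite marg_M31//.
    by rewrite (side_mix K0 W0 W1 kap0 K_kap K_ThV K_sum x0 y0 np).
  apply: (pivot_rhs K0 W0 W1 kap0 lam0 K_kap K_lam K_ThN K_ThV K_sum x0 y0
    (Af_ge0 Pv) (Bf_ge0 Pv) (Cr_ge0 Pv) (Kf_Cr Pv) _ np).
    by case: Wn.
  move=> pX dX; have pX_gt0 := dX.1; have pX_sum := fullDist_Sum dX.
  apply: alice_strategies => //.
  - exact: (mu12_ge0 kap0 pX_gt0).
  - exact: (mu31_ge0 kap0 pX_gt0).
  - by rewrite (mu12_sum K0 W0 W1 kap0 K_kap K_sum y0).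
  - by rewrite (mu31_sum K0 W0 W1 kap0 K_kap K_sum y0).
  - by move=> u /Kz12 z; apply: (mu12_eq0 K0 W0 W1 kap0 K_kap (y0 := y0)) => *; exact: z.
  - by move=> v /Kz31 z; apply: (mu31_eq0 K0 W0 W1 kap0 K_kap (y0 := y0)) => *; exact: z.
rewrite rhs2_rhs1.
(* Bob becomes the pivot: M12 keeps its place, while M23 and M31 exchange roles. *)
pose K' y x u n v := Kf P x y u v n.
pose zeta' n v := zeta v n.
pose W' y x z := W x y z.
have K'0 y x u n v : 0 <= K' y x u n v by exact: K0.
have W'0 y x z : 0 <= W' y x z by exact: W0.
have W'1 y x : \sum_z W' y x z = 1 by exact: W1.
have K'_kap y x u n z :
  (\Sum_v (K' y x u n v * (zeta' n v == z)%:R)%:E = (lam y u n * W' y x z)%:E)%E.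
  exact: K_lam.
have K'_lam y x u v z :
  (\Sum_n (K' y x u n v * (zeta' n v == z)%:R)%:E = (kap x u v * W' y x z)%:E)%E.
  exact: K_kap.
have K'_ThN y x v z : (\Sum_u \Sum_n (K' y x u n v * (zeta' n v == z)%:R)%:E =
  (rsum (fun n => the z v n) * W' y x z)%:E)%E by exact: K_ThV.
have K'_ThV y x n z : (\Sum_u \Sum_v (K' y x u n v * (zeta' n v == z)%:R)%:E =
  (rsum (fun v => the z v n) * W' y x z)%:E)%E by exact: K_ThN.
have K'_sum y x : (\Sum_u \Sum_n \Sum_v (K' y x u n v)%:E = 1)%E.
  rewrite -(K_sum x y); apply: eq_Sum => u.
  by rewrite Sum_swap// => n v; rewrite lee_fin.
have np' := no_partition_swap np.
have pYX_sum : \sum_y \sum_x pXY x y = 1 by rewrite exchange_big.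
have -> : Hc (jointP P pXY) (@oM23 X Y Z) = (\Sum_n (ent (side lam y0 n))%:E)%E.
  apply: eq_Sum => n; rewrite marg_M23//.
  have E : (\Sum_y \Sum_x \Sum_u \Sum_v (pXY x y * Kf P x y u v n)%:E =
      (side lam y0 n)%:E)%E.
    exact: (side_mix K'0 W'0 W'1 lam0 K'_kap K'_ThV K'_sum y0 x0 np' n
      (fun y x => pXY_ge0 x y) pYX_sum).
  by rewrite E.
have K'_fac y x u n v : 0 < K' y x u n v -> forall y' x',
    K' y' x' u n v = Bf P y' u n * Af P x' u v * Cr P v n.
  by move=> /(Kf_Cr Pv) E y' x'; rewrite /K' E; ring.
apply: (pivot_rhs K'0 W'0 W'1 lam0 kap0 K'_kap K'_lam K'_ThN K'_ThV K'_sum y0 x0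
  (Bf_ge0 Pv) (Af_ge0 Pv) (fun n v => Cr_ge0 Pv v n) K'_fac _ np').
  by case: Wn => _ [+ _] => H y y' E; apply: H.
move=> pY dY; have pY_gt0 := dY.1; have pY_sum := fullDist_Sum dY.
apply: bob_strategies => //.
- exact: (mu12_ge0 lam0 pY_gt0).
- exact: (mu31_ge0 lam0 pY_gt0).
- by rewrite (mu12_sum K'0 W'0 W'1 lam0 K'_kap K'_sum x0).
- by rewrite (mu31_sum K'0 W'0 W'1 lam0 K'_kap K'_sum x0).
- by move=> u /Kz12 z; apply: (mu12_eq0 K'0 W'0 W'1 lam0 K'_kap (y0 := x0)) => *; exact: z.
- by move=> n /Kz23 z; apply: (mu31_eq0 K'0 W'0 W'1 lam0 K'_kap (y0 := x0)) => *; exact: z.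
Qed.
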